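(* Let $m$ be a positive integer and let $\widetilde D$ be the deformed Macdonald--Ruijsenaars operator acting in $z$. Define $$\psi(x,z)=\prod_\nu\bigl(\widetilde D-\mathfrak m(x+\nu)\bigr)\left[q^{2(x,z)}Q(z)\right],$$ where $$Q(z)=q^{2(\rho,z)}\prod_{\alpha\in R_+}\prod_{j=1}^{m_\alpha}\bigl[(\alpha,z+\tfrac12j\alpha)\bigr]\bigl[(\alpha,z-\tfrac12j\alpha)\bigr],\qquad\mathfrak m(x)=q^{2x_1}+\dots+q^{2x_n}+\frac{q-q^{-1}}{q^m-q^{-m}}q^{2\sqrt m\,x_{n+1}},$$ and the product is taken over all $\nu\ne0$ of the form $\nu=\sum_{\alpha\in R_+}l_\alpha\alpha$ with $l_\alpha\in\{0,\dots,m_\alpha\}$. Then: (i) $\psi$ is a Baker--Akhiezer function for the deformed system $R=A_n(m)$; (ii) its coefficient $\psi_{-\rho}$ equals $\prod_\nu(\mathfrak m(x)-\mathfrak m(x+\nu))\ne0$; (iii) as a function of $z$, $\psi$ is an eigenfunction of $\widetilde D$: $\widetilde D\psi=\mathfrak m(x)\psi$.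
   Context: $q\in\mathbb C^\times$ is not a root of unity, $\log q$ fixed, $q^a=e^{a\log q}$, $[a]=q^a-q^{-a}$. $e_1,\dots,e_{n+1}$ is the standard basis of $\mathbb R^{n+1}$, $(\cdot,\cdot)$ the standard scalar product extended bilinearly to $\mathbb C^{n+1}$; $x,z\in\mathbb C^{n+1}$; $T^v$ is the shift by $v$. The deformed system $R=A_n(m)=R^0\cup R^1$: $R^0=\{\pm(e_i-e_j):1\le i<j\le n\}$ with $m_\alpha=m$, $R^1=\{\pm(e_i-\sqrt m\,e_{n+1}):1\le i\le n\}$ with $m_\alpha=1$; $R_+=\{e_i-e_j:1\le i<j\le n\}\cup\{e_i-\sqrt m\,e_{n+1}:1\le i\le n\}$; $\rho=\frac12\sum_{\alpha\in R_+}m_\alpha\alpha$; $P=\mathbb Ze_1\oplus\dots\oplus\mathbb Ze_n\oplus\sqrt m\,\mathbb Ze_{n+1}$. The deformed Macdonald--Ruijsenaars operator is $\widetilde D=\widetilde a_1(z)T^{e_1}+\dots+\widetilde a_n(z)T^{e_n}+\widetilde a_{n+1}(z)T^{\sqrt m\,e_{n+1}}$ with, for $i\le n$, $$\widetilde a_i(z)=\frac{[z_i-\sqrt m\,z_{n+1}-\frac{m+1}2]}{[z_i-\sqrt m\,z_{n+1}-\frac{m-1}2]}\prod_{j\ne i,\,1\le j\le n}\frac{[z_i-z_j-m]}{[z_i-z_j]},\qquad\widetilde a_{n+1}(z)=\frac{[1]}{[m]}\prod_{j=1}^n\frac{[\sqrt m\,z_{n+1}-z_j-\frac{m+1}2]}{[\sqrt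 m\,z_{n+1}-z_j+\frac{m-1}2]}.$$ A Baker--Akhiezer function for $R$ is a (nonzero) function $\psi=q^{2(x,z)}\sum_\nu\psi_\nu(x)q^{2(\nu,z)}$, the sum over $\nu\in\rho+P$ lying in the polytope $\mathcal N=\{-\rho+\sum_{\alpha\in R_+}l_\alpha\alpha:0\le l_\alpha\le m_\alpha\}$, satisfying in $z$: $\psi(x,z+se_i)=\psi(x,z+se_j)$ whenever $q^{2z_i}=q^{2z_j}$ ($1\le s\le m$, $1\le i<j\le n$), and $\psi(x,z+e_i)=\psi(x,z+\sqrt m\,e_{n+1})$ whenever $q^{1-m+2z_i}=q^{2\sqrt m\,z_{n+1}}$ ($i=1,\dots,n$). *)

(* Defs.v *)
From HB Require Import structures.
From mathcomp Require Import all_boot all_order all_algebra.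
From mathcomp Require Import complex.
From mathcomp Require Import all_classical all_reals all_analysis.

Set Implicit Arguments.
Unset Strict Implicit.
Unset Printing Implicit Defensive.

Import Order.TTheory GRing.Theory Num.Theory.
Local Open Scope complex_scope.
Local Open Scope classical_set_scope.
Local Open Scope ring_scope.

(* Throughout, logq is a fixed logarithm of q, and vectors of R^{n+1} are
   regarded as vectors of C^{n+1} (C = R[i]). *)

Definition expC (R : realType) (w : R[i]) : R[i] :=
  (expR (complex.Re w) * cos (complex.Im w))
    +i* (expR (complex.Re w) * sin (complex.Im w)).

(* q^a *)
Definition qpow (R : realType) (logq a : R[i]) : R[i] := expC (a * logq).

(* [a] = q^a - q^{-a} *)
Definition qbr (R : realType) (logq a : R[i]) : R[i] :=
  qpow logq a - qpow logq (- a).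

(* Bilinear, with no complex conjugation. *)
Definition dotp (R : realType) (n : nat) (u v : 'rV[R[i]]_n) : R[i] :=
  \sum_(i < n) u 0 i * v 0 i.

Section Vectors.
Context {R : realType} (n m : nat).
Local Notation C := R[i].
Local Notation V := 'rV[C]_n.+1.

Definition sqrtm : C := (Num.sqrt (m%:R : R))%:C.

(* The index i : 'I_n stands for the (i+1)-st of the first n coordinates;
   ord_max is the (n+1)-st one. *)
Definition fst_idx (i : 'I_n) : 'I_n.+1 := widen_ord (leqnSn n) i.

Definition evec (i : 'I_n) : V := delta_mx 0 (fst_idx i).

(* sqrt m e_{n+1} *)
Definition slast : V := sqrtm *: delta_mx 0 ord_max.

Definition crd (z : V) (i : 'I_n) : C := z 0 (fst_idx i).

(* sqrt m z_{n+1} *)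
Definition scrd (z : V) : C := sqrtm * z 0 ord_max.

(* R_+ : inl (i, j) stands for e_i - e_j (i < j), and inr i stands for
   e_i - sqrt m e_{n+1}. *)
Definition posroot : finType :=
  ({p : 'I_n * 'I_n | (p.1 < p.2)%N} + 'I_n)%type.

Definition root_vec (a : posroot) : V :=
  match a with
  | inl p => evec (val p).1 - evec (val p).2
  | inr i => evec i - slast
  end.

Definition mult (a : posroot) : nat :=
  match a with inl _ => m | inr _ => 1%N end.

Definition rho : V := 2^-1 *: \sum_(a : posroot) (mult a)%:R *: root_vec a.

Definition lattice : set V :=
  [set v | exists (k : 'I_n -> int) (l : int),
      v = \sum_(i < n) (k i)%:~R *: evec i + l%:~R *: slast].

Definition polytope : set V :=
  [set v | exists l : posroot -> R,
      (forall a, 0 <= l a <= (mult a)%:R) /\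
      v = - rho + \sum_(a : posroot) (l a)%:C *: root_vec a].

(* (rho + P) /\ N; this set is finite. *)
Definition ba_support : set V :=
  [set nu | lattice (nu - rho) /\ polytope nu].

(* The vectors nu <> 0 of the form sum_a l_a a with l_a in {0, ..., m_a},
   each listed once even if it has several such representations. *)
Definition nus : seq V :=
  [seq nu <- undup [seq \sum_(a : posroot) (l a : nat)%:R *: root_vec a
                   | l : {dffun forall a : posroot, 'I_(mult a).+1}]
  | nu != 0].

End Vectors.

Arguments sqrtm R m : clear implicits.
Arguments evec R {n} i.
Arguments slast R n m : clear implicits.
Arguments root_vec R {n} m a.
Arguments rho R n m : clear implicits.
Arguments lattice R n m : clear implicits.
Arguments polytope R n m : clear implicits.
Arguments ba_support R n m : clear implicits.
Arguments nus R n m : clear implicits.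

Section Operator.
Context {R : realType} (n m : nat) (logq : R[i]).
Local Notation C := R[i].
Local Notation V := 'rV[C]_n.+1.
Local Notation "[[ a ]]" := (qbr logq a).
Local Notation M := (m%:R : C).

Definition acoef (i : 'I_n) (z : V) : C :=
  [[crd z i - scrd m z - (M + 1) / 2]] / [[crd z i - scrd m z - (M - 1) / 2]]
  * \prod_(j < n | j != i) ([[crd z i - crd z j - M]] / [[crd z i - crd z j]]).

Definition acoef_last (z : V) : C :=
  [[1]] / [[M]]
  * \prod_(j < n) ([[scrd m z - crd z j - (M + 1) / 2]]
                   / [[scrd m z - crd z j + (M - 1) / 2]]).

Definition Dop (f : V -> C) (z : V) : C :=
  \sum_(i < n) acoef i z * f (z + evec R i)
  + acoef_last z * f (z + slast R n m).

(* z is not a pole of a coefficient of Dop: since x / 0 = 0 here, Dop f z has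
   its intended meaning only at such z. *)
Definition D_regular (z : V) : Prop :=
  [/\ forall i : 'I_n, [[crd z i - scrd m z - (M - 1) / 2]] != 0,
      forall i j : 'I_n, j != i -> [[crd z i - crd z j]] != 0 &
      forall j : 'I_n, [[scrd m z - crd z j + (M - 1) / 2]] != 0].

(* The points at which k successive factors Dop - const can be evaluated
   without meeting a vanishing denominator (an open dense set). *)
Fixpoint D_domain (k : nat) (z : V) : Prop :=
  match k with
  | 0 => True
  | k'.+1 => [/\ D_regular z, D_domain k' z,
                 forall i : 'I_n, D_domain k' (z + evec R i) &
                 D_domain k' (z + slast R n m)]
  end.

Definition frakm (x : V) : C :=
  \sum_(i < n) qpow logq (2 * crd x i)
  + [[1]] / [[M]] * qpow logq (2 * scrd m x).

Definition Qfun (z : V) : C :=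
  qpow logq (2 * dotp (rho R n m) z)
  * \prod_(a : posroot n) \prod_(1 <= j < (mult m a).+1)
      ([[dotp (root_vec R m a) (z + (j%:R / 2) *: root_vec R m a)]]
       * [[dotp (root_vec R m a) (z - (j%:R / 2) *: root_vec R m a)]]).

(* The factors Dop - frakm (x + nu) commute, so their order is immaterial. *)
Definition psi_op (x : V) : V -> C :=
  foldr (fun nu (f : V -> C) z => Dop f z - frakm (x + nu) * f z)
        (fun z => qpow logq (2 * dotp x z) * Qfun z)
        (nus R n m).

(* psi is a Baker--Akhiezer function with coefficients c nu x = psi_nu(x).
   They are determined by psi on ba_support, because the functions
   z |-> q^{2(nu,z)}, for nu in ba_support, are linearly independent. *)
Definition baker_akhiezer (psi : V -> V -> C) (c : V -> V -> C) : Prop :=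
  [/\ exists x z, psi x z != 0,
      forall x z, psi x z =
        qpow logq (2 * dotp x z)
        * \sum_(nu \in ba_support R n m) (c nu x * qpow logq (2 * dotp nu z)),
      forall (x z : V) (i j : 'I_n) (s : nat),
        (i < j)%N -> (1 <= s <= m)%N ->
        qpow logq (2 * crd z i) = qpow logq (2 * crd z j) ->
        psi x (z + s%:R *: evec R i) = psi x (z + s%:R *: evec R j) &
      forall (x z : V) (i : 'I_n),
        qpow logq (1 - M + 2 * crd z i) = qpow logq (2 * scrd m z) ->
        psi x (z + evec R i) = psi x (z + slast R n m)].

End Operator.

(* Main.v *)
Require Import Defs.
From HB Require Import structures.
From mathcomp Require Import all_boot all_order all_algebra.
From mathcomp Require Import complex.
From mathcomp Require Import all_classical all_reals all_analysis.
From mathcomp Require Import -(notations) mpoly.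
From mathcomp Require Import ring lra zify.

(** Write f_c for e_c (c at most n) and f_(n+1) = sqrt m e_(n+1), so that the
    operator shifts z by the f_c, and put t = q^2. In the variables Z_c = q^(2
    (f_c,z)), the last one multiplied by q^(m-1), the n+1 terms of the
    operator take one and the same form: the coefficient of T^(f_c) is a
    constant times the product over d different from c of (Z_c - t^(pp d) Z_d)
    / (Z_c - Z_d). All singularities lie on the hyperplanes Z_c = Z_d, and
    these are the hyperplanes on which the Baker--Akhiezer conditions are
    imposed. Since psi is q^(2(x,z)) times a monomial times a polynomial F in
    the Z_c, the whole question concerns polynomials F: those satisfying the
    conditions are called quasi-invariant (qi), and the conjugated operator is
    given by the relation is_D.

    The operator maps quasi-invariant polynomials to quasi-invariant
    polynomials (D_exists, qi_D). The poles cancel because terms c and d have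
    opposite residues on Z_c = Z_d, and the conditions survive because the
    terms on both sides correspond to each other, the term that would need a
    condition beyond the last one having a vanishing coefficient there. The
    polynomial part of Q is quasi-invariant because all the values involved
    vanish (qi_seed). So psi is quasi-invariant.

    Next, supports. For a direction h in which the weights of the Z_c are
    distinct, the operator acts diagonally on the monomials of highest weight
    (mcoeff_D_top), with eigenvalue obtained from frakm at x plus a vector
    read off from the monomial. Hence each factor D - frakm (x + nu) removes
    the vertices with that eigenvalue, and the factors commute (steps_top). On
    the other hand, quasi-invariance makes the Newton polytope large: on Z_c =
    Z_d the conditions form a linear system of Vandermonde type for the
    coefficients of a string of monomials, and its solutions vanish unless the
    string has length at least the multiplicity (long_string). So each edge in
    the direction of a root has at least that length, and moving from one
    generic direction to the indicator of a set K of indices one gains at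
    least the sum of the multiplicities of the roots crossed (wall_crossing).
    The Newton polytope stays inside that of Q, which is twice the zonotope of
    the roots. Hence every vertex lies, after subtraction of the corresponding
    vertex of one zonotope, in the zonotope itself; by integrality of network
    flows (integer_flow) it is a sum of l_alpha alpha with integers l_alpha
    between 0 and m_alpha (top_feasible). The product over nu removes all of
    these except 0. What is left has the vertices of one zonotope, which gives
    the support condition (supp_Psi); and applying D - frakm x removes those
    vertices as well, so the result is 0, which is the eigenfunction property
    (Dq_Psi). The coefficient at -rho starts as a vertex coefficient of Q and
    is multiplied by frakm x - frakm (x + nu) at each step (mcoeff_Psi_bot).

    The separation of vertices by eigenvalues requires different vertices to
    have different eigenvalues, which fails for special x. Therefore the
    coefficients are taken in the polynomial ring C[w], the weight of the
    shift along f_c being multiplied by w^c; then eigenvalues are distinct for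
    every x, and the theorem follows at w = 1. *)

Set Implicit Arguments.
Unset Strict Implicit.
Unset Printing Implicit Defensive.
Import Order.TTheory GRing.Theory Num.Theory.
Local Open Scope complex_scope.
Local Open Scope ring_scope.

(** * Evaluation of polynomials and weighted degrees *)

HB.lock Definition ev (N : nat) (A B : comNzRingType) (phi : {rmorphism A -> B})
  (u : 'I_N -> B) (F : mpoly N A) : B := mmap phi u F.
Arguments ev {N A B}.

Section Evaluation.
Variables (N : nat) (A B : comNzRingType) (phi : {rmorphism A -> B}).
Variable u : 'I_N -> B.
Local Notation P := (mpoly N A).
Local Notation Xv i := (mpolyX A (mnm1 i)).

Lemma evM (F G : P) : ev phi u (F * G) = ev phi u F * ev phi u G.
Proof. by rewrite ev.unlock rmorphM. Qed.

Lemma evB (F G : P) : ev phi u (F - G) = ev phi u F - ev phi u G.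
Proof. by rewrite ev.unlock rmorphB. Qed.

Lemma ev0 : ev phi u 0 = 0.
Proof. by rewrite ev.unlock rmorph0. Qed.

Lemma evC a : ev phi u (mpolyC N a) = phi a.
Proof. by rewrite ev.unlock mmapC. Qed.

Lemma evX i : ev phi u (Xv i) = u i.
Proof. by rewrite ev.unlock mmapX mmap1U. Qed.

Lemma evXn (F : P) k : ev phi u (F ^+ k) = ev phi u F ^+ k.
Proof. by rewrite ev.unlock rmorphXn. Qed.

Lemma ev_prod (T : Type) (s : seq T) (Q : pred T) (E : T -> P) :
  ev phi u (\prod_(i <- s | Q i) E i) = \prod_(i <- s | Q i) ev phi u (E i).
Proof. by rewrite ev.unlock rmorph_prod. Qed.

Lemma ev_sum (T : Type) (s : seq T) (Q : pred T) (E : T -> P) :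
  ev phi u (\sum_(i <- s | Q i) E i) = \sum_(i <- s | Q i) ev phi u (E i).
Proof. by rewrite ev.unlock raddf_sum. Qed.

Lemma evE (F : P) :
  ev phi u F = \sum_(m <- msupp F) phi (mcoeff m F) * \prod_i u i ^+ m i.
Proof. by rewrite ev.unlock. Qed.

End Evaluation.

Lemma eq_ev (N : nat) (A B : comNzRingType) (phi : {rmorphism A -> B})
    (u v : 'I_N -> B) (F : mpoly N A) : u =1 v -> ev phi u F = ev phi v F.
Proof.
move=> e; rewrite !evE; apply: eq_bigr => m _; congr (_ * _).
by apply: eq_bigr => i _; rewrite e.
Qed.

Lemma rmorph_ev (N : nat) (A B C : comNzRingType) (phi : {rmorphism A -> B})
    (psi : {rmorphism B -> C}) (u : 'I_N -> B) (F : mpoly N A) :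
  psi (ev phi u F) = ev (psi \o phi) (psi \o u) F.
Proof.
rewrite !evE raddf_sum /=; apply: eq_bigr => m _.
rewrite rmorphM rmorph_prod; congr (_ * _).
by apply: eq_bigr => i _; rewrite rmorphXn.
Qed.

Lemma ev_comp (M N : nat) (A B : comNzRingType) (phi : {rmorphism A -> B})
    (u : 'I_M -> B) (v : 'I_N -> mpoly M A) (F : mpoly N A) :
  ev phi u (ev (@mpolyC M A) v F) = ev phi (fun i => ev phi u (v i)) F.
Proof.
rewrite (evE _ v) (evE _ _ F) ev_sum; apply: eq_bigr => m _.
rewrite evM evC ev_prod; congr (_ * _); apply: eq_bigr => i _.
by elim: (m i) => [|k IH]; rewrite ?exprS ?evM ?IH // !expr0 -mpolyC1 evC rmorph1.
Qed.

Section Polynomials.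
Variables (N : nat) (A : comNzRingType).
Local Notation P := (mpoly N A).
Local Notation Xv i := (mpolyX A (mnm1 i)).

Lemma ev_id (F : P) : ev (@mpolyC N A) (fun i => Xv i) F = F.
Proof.
rewrite [RHS]mpolyE evE; apply: eq_bigr => m _.
by rewrite -mpolyXE_id mul_mpolyC.
Qed.

Definition mwt (h : 'I_N -> nat) (m : multinom N) : nat := \sum_i h i * m i.

(** The grading by h, encoded as the degree in one extra variable: the
    coefficient of degree k collects the monomials of weight k. Leading parts
    of products then reduce to univariate polynomials over a domain. *)
Definition wpoly (h : 'I_N -> nat) : P -> {poly P} :=
  ev (@polyC P \o @mpolyC N A) (fun i => (Xv i)%:P * 'X^(h i)).

Lemma wpolyM h F G : wpoly h (F * G) = wpoly h F * wpoly h G.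
Proof. exact: evM. Qed.

Lemma wpolyB h F G : wpoly h (F - G) = wpoly h F - wpoly h G.
Proof. exact: evB. Qed.

Lemma wpolyE h F :
  wpoly h F = \sum_(m <- msupp F) (mcoeff m F *: mpolyX A m)%:P * 'X^(mwt h m).
Proof.
rewrite /wpoly evE; apply: eq_bigr => m _ /=.
rewrite -mul_mpolyC rmorphM -mulrA; congr (_ * _).
rewrite (eq_bigr (fun i => (Xv i ^+ m i)%:P * 'X^(h i * m i))); last first.
  by move=> i _; rewrite exprMn rmorphXn exprM.
rewrite big_split /= -(rmorph_prod (@polyC P)) -mpolyXE_id; congr (_ * _).
by rewrite /mwt; elim/big_rec2: _ => [|i p q _ ->]; rewrite ?expr0 ?exprD.
Qed.

Lemma mcoeff_wpoly h F k m :
  mcoeff m (wpoly h F)`_k = if mwt h m == k then mcoeff m F else 0.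
Proof.
rewrite wpolyE coef_sum raddf_sum /=.
rewrite (eq_bigr (fun m' => if m' == m then
   (if mwt h m == k then mcoeff m F else 0) else 0)); last first.
  move=> m' _; rewrite coefCM coefXn eq_sym.
  have [e|ne] := eqVneq m' m.
    rewrite -e; case: (mwt h m' == k); rewrite ?mulr1 ?mulr0 ?raddf0 //.
    by rewrite mcoeffZ mcoeffX eqxx mulr1.
  case: (mwt h m' == k); rewrite ?mulr1 ?mulr0 ?raddf0 //.
  by rewrite mcoeffZ mcoeffX (negbTE ne) mulr0.
rewrite -big_mkcond /=.
have [mF|mF] := boolP (m \in msupp F).
  by rewrite -big_filter filter_pred1_uniq // big_seq1.
rewrite (memN_msupp_eq0 mF) if_same big1_seq // => m' /andP[/eqP ->].
Qed.

Lemma size_wpolyP h F k :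
  (size (wpoly h F) <= k.+1)%N <-> (forall m, mcoeff m F != 0 -> (mwt h m <= k)%N).
Proof.
split=> [sF m Fm|H].
  rewrite leqNgt; apply/negP => lt.
  have := mcoeff_wpoly h F (mwt h m) m.
  rewrite eqxx nth_default ?mcoeff0; last exact: leq_trans sF lt.
  by move=> e; rewrite -e eqxx in Fm.
apply/leq_sizeP => j kj; apply/mpolyP => m; rewrite mcoeff_wpoly mcoeff0.
case: eqP => // e; apply/eqP; apply: contraTT kj => /H.
by rewrite e -leqNgt.
Qed.

Lemma wpoly_inj h : injective (wpoly h).
Proof.
move=> F G e; apply/mpolyP => m.
have := mcoeff_wpoly h F (mwt h m) m.
by rewrite e mcoeff_wpoly eqxx => ->.
Qed.

End Polynomials.

(** * Divisibility by squares of differences of variables *)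

Section Division.
Variables (N : nat) (A : idomainType).
Local Notation P := (mpoly N A).
Local Notation Xv i := (mpolyX A (mnm1 i)).

Definition congr_mod (B : comNzRingType) (d x y : B) := exists z, x - y = d * z.

Lemma congr_modD (B : comNzRingType) (d x x' y y' : B) :
  congr_mod d x y -> congr_mod d x' y' -> congr_mod d (x + x') (y + y').
Proof. by case=> z e [z' e']; exists (z + z'); rewrite mulrDr -e -e'; ring. Qed.

Lemma congr_modM (B : comNzRingType) (d x x' y y' : B) :
  congr_mod d x y -> congr_mod d x' y' -> congr_mod d (x * x') (y * y').
Proof.
case=> z e [z' e']; exists (z * x' + y * z').
by rewrite mulrDr mulrA -e [d * (y * z')]mulrCA -e'; ring.
Qed.

Lemma congr_mod_refl (B : comNzRingType) (d x : B) : congr_mod d x x.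
Proof. by exists 0; rewrite subrr mulr0. Qed.

(** Evaluations are built from sums and products, both compatible with
    congruence; this yields the factor theorem with an explicit cofactor. *)
Lemma congr_mod_ev (B : comNzRingType) (phi : {rmorphism A -> B})
    (u v : 'I_N -> B) d (F : P) :
  (forall i, congr_mod d (u i) (v i)) ->
  congr_mod d (ev phi u F) (ev phi v F).
Proof.
move=> uv; rewrite !evE; elim/big_ind2: _ => [|x x' y y'|m _].
- exact: congr_mod_refl.
- exact: congr_modD.
apply: congr_modM; first exact: congr_mod_refl.
elim/big_ind2: _ => [|x x' y y'|i _].
- exact: congr_mod_refl.
- exact: congr_modM.
elim: (m i) => [|k IH]; first by rewrite !expr0; apply: congr_mod_refl.
by rewrite !exprS; apply: congr_modM.
Qed.

(** The universal point of the hyperplane Z_a = Z_b. *)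
Definition diag_pt (a b : 'I_N) : 'I_N -> P :=
  fun e => if e == a then Xv b else Xv e.

Definition restr a b : P -> P := ev (@mpolyC N A) (diag_pt a b).

(** Substituting Z_b for Z_a changes F by a multiple of Z_a - Z_b. *)
Lemma restr_eq0 a b (F : P) : restr a b F = 0 -> exists G, F = (Xv a - Xv b) * G.
Proof.
move=> F0.
have [|H] := @congr_mod_ev P (@mpolyC N A) (fun i => Xv i) (diag_pt a b)
  (Xv a - Xv b) F.
  move=> i; rewrite /diag_pt; case: eqP => [->|_]; last exact: congr_mod_refl.
  by exists 1; rewrite mulr1.
by rewrite ev_id -/(restr a b F) F0 subr0 => ->; exists H.
Qed.

Lemma mpolyX_inj : injective (fun i : 'I_N => Xv i).
Proof.
move=> i j /= /(congr1 (mcoeff (mnm1 i))); rewrite !mcoeffX eqxx.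
case: eqP => [e _|_ /eqP]; last by rewrite oner_eq0.
by move/(congr1 (fun m : multinom N => m i)): e; rewrite !mnmE eqxx; case: eqP.
Qed.

Lemma subX_neq0 (a b : 'I_N) : a != b -> Xv a - Xv b != 0.
Proof. by move=> ab; rewrite subr_eq0 (inj_eq mpolyX_inj). Qed.

Lemma restr_sub_neq0 (a b c d : 'I_N) :
  a != b -> c != d -> ((c, d) != (a, b)) -> ((c, d) != (b, a)) ->
  restr a b (Xv c - Xv d) != 0.
Proof.
move=> ab cd n1 n2; rewrite /restr evB !evX /diag_pt.
move: cd n1 n2; rewrite !xpair_eqE.
have [->|ca] := eqVneq c a; have [->|da] := eqVneq d a; rewrite ?eqxx //=.
- by move=> _ db _; apply: subX_neq0; rewrite eq_sym.
- by rewrite andbT => _ _ cb; apply: subX_neq0.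
- by move=> cd _ _; apply: subX_neq0.
Qed.

(** Restriction to Z_a = Z_b is a morphism to a domain which kills no other
    difference of variables. The factors already extracted can therefore be
    cancelled after restriction, and Z_a - Z_b is extracted twice from the
    cofactor. *)
Lemma prod_sq_dvd (s : seq ('I_N * 'I_N)) (F : P) :
  uniq s -> (forall p, p \in s -> (p.1 < p.2)%N) ->
  (forall p, p \in s -> exists G, F = (Xv p.1 - Xv p.2) * (Xv p.2 - Xv p.1) * G) ->
  exists G, F = (\prod_(p <- s) ((Xv p.1 - Xv p.2) * (Xv p.2 - Xv p.1))) * G.
Proof.
elim: s => [|[a b] s IH] /=; first by move=> _ _ _; exists F; rewrite big_nil mul1r.
case/andP=> abs us lts dv.
have [||G eG] := IH us; first by move=> p ps; apply: lts; rewrite inE ps orbT.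
  by move=> p ps; apply: dv; rewrite inE ps orbT.
have [H eH] := dv (a, b) (mem_head _ _).
have /= lab := lts (a, b) (mem_head _ _).
have ab : a != b by rewrite neq_ltn lab.
set D := \prod_(p <- s) _ in eG.
have rD : restr a b D != 0.
  rewrite /restr ev_prod prodf_seq_neq0; apply/allP => -[c d] cds /=.
  have /= lcd := lts (c, d); rewrite inE cds orbT in lcd.
  have {}lcd : (c < d)%N by apply: lcd.
  rewrite evM mulf_neq0 // restr_sub_neq0 //.
  - by rewrite neq_ltn lcd.
  - by apply: contraNneq abs => <-.
  - by apply/eqP => -[e1 e2]; subst; lia.
  - by rewrite neq_ltn lcd orbT.
  - by apply/eqP => -[e1 e2]; subst; lia.
  - by apply: contraNneq abs => -[<- <-].
have step G1 K : D * G1 = (Xv a - Xv b) * K -> exists G2, G1 = (Xv a - Xv b) * G2.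
  move=> e; apply: restr_eq0; apply: (mulfI rD); rewrite mulr0.
  rewrite /restr -evM e evM evB !evX /diag_pt.
  by rewrite eqxx eq_sym (negbTE ab) subrr mul0r.
have [G1 eG1] : exists G1, G = (Xv a - Xv b) * G1.
  by apply: (step G ((Xv b - Xv a) * H)); rewrite -eG eH /=; ring.
have [G2 eG2] : exists G2, G1 = (Xv a - Xv b) * G2.
  apply: (step G1 (- H)); apply: (mulfI (subX_neq0 ab)).
  by rewrite mulrCA -eG1 -eG eH /=; ring.
exists (- G2); rewrite big_cons /= -/D eG eG1 eG2; ring.
Qed.

End Division.

(** * Quasi-invariant polynomials and the difference operator *)

Section Weights.
Variables (n m : nat).
Local Notation I := 'I_n.+1.

(** The squared length of f_c: the shift along f_c multiplies Z_c by t ^+ rr m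
    c and fixes the other variables. *)
Definition rr (c : I) : nat := if c == ord_max then m else 1%N.
(** The exponent in the numerator Z_c - t ^+ pp m d Z_d of the coefficients of
    the operator; rr m d * pp m d = m for each d. *)
Definition pp (c : I) : nat := if c == ord_max then 1%N else m.
(** The multiplicity of the root f_c - f_d. *)
Definition mu (c d : I) : nat :=
  if (c == ord_max) || (d == ord_max) then 1%N else m.

Lemma muC c d : mu c d = mu d c.
Proof. by rewrite /mu orbC. Qed.

(** After mu m c d shifts along f_c, a point of the hyperplane Z_c = Z_d
    reaches the zero of the numerator facing Z_d. This is why the conditions
    stop at the multiplicity. *)
Lemma rr_mu c d : c != d -> (rr c * mu c d)%N = pp d.
Proof.
move=> cd; rewrite /rr /mu /pp; have [e|_] := eqVneq c ord_max.
  by rewrite e in cd; rewrite [d == _]eq_sym (negbTE cd) muln1.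
by case: (d == ord_max); rewrite mul1n.
Qed.

(** Two ordinary indices, or a root of multiplicity one on which rr and pp are
    exchanged; the arguments below differ only in these two cases. *)
Lemma mu_cases c d : c != d ->
  [/\ rr c = 1, rr d = 1, pp c = m, pp d = m & mu c d = m]%N \/
  [/\ mu c d = 1, pp c = rr d & pp d = rr c]%N.
Proof.
rewrite /rr /mu /pp.
case: (eqVneq c ord_max) => [->|_]; case: (eqVneq d ord_max) => [e|_] //=.
- by right.
- by right.
- by left.
Qed.

End Weights.

Section Shift.
Variables (n m : nat) (B : comNzRingType) (t : B).
Local Notation I := 'I_n.+1.

Definition shift (c : I) (s : nat) (u : I -> B) : I -> B :=
  fun e => if e == c then t ^+ (rr m c * s) * u e else u e.

Lemma shiftC c d s s' u : shift c s (shift d s' u) =1 shift d s' (shift c s u).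
Proof.
by move=> e; rewrite /shift; case: (e == c); case: (e == d); rewrite // mulrCA.
Qed.

Lemma shiftD c s s' u : shift c s (shift c s' u) =1 shift c (s + s') u.
Proof.
by move=> e; rewrite /shift; case: (e == c); rewrite // mulrA -exprD mulnDr.
Qed.

Lemma shift0 c u : shift c 0 u =1 u.
Proof. by move=> e; rewrite /shift muln0 expr0 mul1r if_same. Qed.

Lemma eq_shift c s u v : u =1 v -> shift c s u =1 shift c s v.
Proof. by move=> e x; rewrite /shift e. Qed.

End Shift.

Section QuasiInvariance.
Variables (n m : nat) (A : idomainType) (t : A) (W : 'I_n.+1 -> A).
Local Notation I := 'I_n.+1.
Local Notation P := (mpoly n.+1 A).
Local Notation sh := (shift m).
Local Notation cst := (@mpolyC n.+1 A).

(** F stands for the function q^(2(x,z)) F(Z), whose prefactor is multiplied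
    by W c under the shift along f_c. The equation is the Baker--Akhiezer
    condition of order s at the universal point of the hyperplane Z_c = Z_d.
    *)
Definition qi (F : P) : Prop := forall c d s, c != d -> (1 <= s <= mu m c d)%N ->
  cst (W c ^+ s) * ev cst (sh (mpolyC _ t) c s (diag_pt A c d)) F =
  cst (W d ^+ s) * ev cst (sh (mpolyC _ t) d s (diag_pt A c d)) F.

Lemma qi_point (B : comNzRingType) (phi : {rmorphism A -> B}) (u : I -> B) F c d s :
  qi F -> c != d -> u c = u d -> (s <= mu m c d)%N ->
  phi (W c) ^+ s * ev phi (sh (phi t) c s u) F =
  phi (W d) ^+ s * ev phi (sh (phi t) d s u) F.
Proof.
move=> qF cd ucd sm; case: s sm => [|s] sm.
  by rewrite !expr0 !mul1r; apply: eq_ev => e; rewrite !shift0.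
have /(congr1 (ev phi u)) := qF c d s.+1 cd sm.
rewrite !evM !evC !rmorphXn !ev_comp.
suff E x : (fun i => ev phi u (sh (mpolyC n.+1 t) x s.+1 (diag_pt A c d) i)) =1
           sh (phi t) x s.+1 u by rewrite !(eq_ev _ F (E _)).
have U i : ev phi u (diag_pt A c d i) = u i.
  by rewrite /diag_pt; case: eqP => [->|_]; rewrite evX.
move=> i; rewrite /shift; case: (i == x); last exact: U.
by rewrite evM evXn evC U.
Qed.

Let lin_comb (R : comNzRingType) (w w' x x' y y' a : R) :
  w * x = w' * x' -> w * y = w' * y' -> w * (x - a * y) = w' * (x' - a * y').
Proof. by move=> ex ey; rewrite !mulrBr ex !(mulrCA _ a) ey. Qed.

Lemma qiB F G a : qi F -> qi G -> qi (F - cst a * G).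
Proof.
move=> qF qG c d s cd sm; rewrite !evB !evM !evC.
exact: lin_comb (qF c d s cd sm) (qG c d s cd sm).
Qed.

End QuasiInvariance.

Section Operator.
Variables (n m : nat) (A : idomainType) (t : A) (kap W : 'I_n.+1 -> A).
Local Notation I := 'I_n.+1.
Local Notation P := (mpoly n.+1 A).
Local Notation Xv i := (mpolyX A (mnm1 i)).
Local Notation sh := (shift m).
Local Notation cst := (@mpolyC n.+1 A).

Definition den (c : I) : P := \prod_(d | d != c) (Xv c - Xv d).
Definition num (c : I) : P := \prod_(d | d != c) (Xv c - cst (t ^+ pp m d) * Xv d).
(** Each difference of variables occurs twice, with both signs, so that the
    operator becomes a question of divisibility by squares although its poles
    are simple. *)
Definition disc : P := \prod_c den c.
Definition tau (c : I) : P -> P :=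
  ev cst (sh (mpolyC _ t) c 1 (fun i => Xv i)).

Definition Dnum (F : P) : P :=
  \sum_c cst (kap c * W c) * (num c * (\prod_(a | a != c) den a) * tau c F).

(** The conjugated operator sends F to G, with denominators cleared. *)
Definition is_D (F G : P) := disc * G = Dnum F.

Lemma den_neq0 c : den c != 0.
Proof. by apply/prodf_neq0 => d dc; rewrite subX_neq0 // eq_sym. Qed.

Lemma disc_neq0 : disc != 0.
Proof. by apply/prodf_neq0 => c _; apply: den_neq0. Qed.

Lemma is_D_inj F G G' : is_D F G -> is_D F G' -> G = G'.
Proof. by rewrite /is_D => <- /(mulfI disc_neq0). Qed.

Definition dcoef (K : fieldType) (x : K) (u : I -> K) (c : I) : K :=
  \prod_(d | d != c) ((u c - x ^+ pp m d * u d) / (u c - u d)).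

Lemma is_D_point (K : fieldType) (phi : {rmorphism A -> K}) (u : I -> K) F G :
  injective u -> is_D F G ->
  ev phi u G = \sum_c phi (kap c) * phi (W c) * dcoef (phi t) u c *
                        ev phi (sh (phi t) c 1 u) F.
Proof.
move=> uI /(congr1 (ev phi u)).
have eden c : ev phi u (den c) = \prod_(d | d != c) (u c - u d).
  by rewrite ev_prod; apply: eq_bigr => d _; rewrite evB !evX.
have nz c : ev phi u (den c) != 0.
  by rewrite eden; apply/prodf_neq0 => d dc; rewrite subr_eq0 (inj_eq uI) eq_sym.
have nzd : ev phi u disc != 0 by rewrite ev_prod; apply/prodf_neq0 => c _.
rewrite evM => e; apply: (mulfI nzd); rewrite e mulr_sumr ev_sum.
apply: eq_bigr => c _; rewrite !evM evC rmorphM.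
have -> : ev phi u (tau c F) = ev phi (sh (phi t) c 1 u) F.
  rewrite ev_comp; apply: eq_ev => i; rewrite /shift.
  by case: (i == c); rewrite ?evM ?evXn ?evC evX.
have -> : ev phi u (num c) = ev phi u (den c) * dcoef (phi t) u c.
  rewrite eden -big_split ev_prod /=; apply: eq_bigr => d dc.
  rewrite evB evM evC !evX rmorphXn [RHS]mulrC divfK //.
  by rewrite subr_eq0 (inj_eq uI) eq_sym.
rewrite [disc](bigD1 c) //= evM; ring.
Qed.

End Operator.

(** * Cancellation of the poles *)

Section Existence.
Variables (n m : nat) (A : idomainType) (t : A) (kap W : 'I_n.+1 -> A).
Local Notation I := 'I_n.+1.
Local Notation P := (mpoly n.+1 A).
Local Notation Xv i := (mpolyX A (mnm1 i)).
Local Notation cst := (@mpolyC n.+1 A).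
Local Notation sh := (shift m).
Local Notation qi := (qi m t W).
Local Notation den := (@den n A).
Local Notation num := (num m t).
Local Notation tau := (tau m t).
Local Notation is_D := (is_D m t kap W).
Local Notation Dnum := (Dnum m t kap W).

Hypothesis m_gt0 : (0 < m)%N.
Hypothesis kapE : forall c d, c != d ->
  kap c * (1 - t ^+ pp m d) = kap d * (1 - t ^+ pp m c).

Lemma mu_gt0 (c d : I) : (0 < mu m c d)%N.
Proof. by rewrite /mu; case: ifP. Qed.

Lemma disc_pairs : disc n A =
  \prod_(p <- [seq p : I * I <- enum {: I * I} | (p.1 < p.2)%N])
     ((Xv p.1 - Xv p.2) * (Xv p.2 - Xv p.1)).
Proof.
rewrite big_filter big_enum_cond /=.
rewrite /disc /den pair_big_dep /=.
rewrite (bigID (fun p : I * I => (p.1 < p.2)%N)) /= big_split /=; congr (_ * _).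
  apply: eq_bigl => -[a b] /=; rewrite -val_eqE /=; lia.
rewrite (reindex_inj (h := fun p : I * I => (p.2, p.1))) /=; last first.
  by move=> [a b] [c d] [-> ->].
apply: eq_bigl => -[a b] /=; rewrite -val_eqE /=; lia.
Qed.

Lemma restr_tau a b c F :
  restr a b (tau c F) = ev cst (sh (cst t) c 1 (diag_pt A a b)) F.
Proof.
rewrite /restr ev_comp; apply: eq_ev => i; rewrite /shift.
by case: (i == c); rewrite ?evM ?evXn ?evC evX.
Qed.

Let restr_comb a b (c x y z u c' x' y' z' u' : P) :
  restr a b (c * (x * y * z * u) - c' * (x' * y' * z' * u')) =
  restr a b c * (restr a b x * restr a b y * restr a b z * restr a b u) -
  restr a b c' * (restr a b x' * restr a b y' * restr a b z' * restr a b u').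
Proof. by rewrite /restr evB !evM. Qed.

Let cancel_residues (R : comNzRingType) (ka kb wa wb qa qb x r s fa fb : R) :
  ka * (1 - qb) = kb * (1 - qa) -> wa * fa = wb * fb ->
  kb * wb * ((x - qa * x) * r * s * fb) - ka * wa * ((x - qb * x) * r * s * fa) = 0.
Proof.
move=> ek ew; apply/eqP; rewrite subr_eq0; apply/eqP.
transitivity ((kb * (1 - qa)) * (wb * fb) * (x * r * s)); first by ring.
by rewrite -ek -ew; ring.
Qed.

(** On Z_a = Z_b the terms of index a and b have opposite residues: the
    equality of the constants is kapE, that of the shifted values is
    quasi-invariance for s = 1. Every other term keeps both factors Z_a - Z_b
    and Z_b - Z_a of disc. *)
Lemma D_exists F : qi F -> exists G, is_D F G.
Proof.
move=> qF; suff [G eG] : exists G, Dnum F = disc n A * G by exists G.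
rewrite disc_pairs; apply: prod_sq_dvd.
- by rewrite filter_uniq // enum_uniq.
- by move=> p; rewrite mem_filter => /andP[].
move=> [a b]; rewrite mem_filter /= => /andP[lab _].
have ab : a != b by rewrite neq_ltn lab.
have ba : b != a by rewrite eq_sym.
pose T c := cst (kap c * W c) * (num c * \prod_(e | e != c) den e * tau c F).
have eD : Dnum F = T a + (T b + \sum_(c | (c != a) && (c != b)) T c).
  rewrite /Dnum (bigD1 a) // (bigD1 b) //.
pose E := \prod_(e | (e != a) && (e != b)) den e.
pose na := \prod_(d | (d != a) && (d != b)) (Xv a - cst (t ^+ pp m d) * Xv d).
pose nb := \prod_(d | (d != b) && (d != a)) (Xv b - cst (t ^+ pp m d) * Xv d).
pose da := \prod_(d | (d != a) && (d != b)) (Xv a - Xv d).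
pose db := \prod_(d | (d != b) && (d != a)) (Xv b - Xv d).
have ena : num a = (Xv a - cst (t ^+ pp m b) * Xv b) * na.
  by rewrite /num (bigD1 b).
have enb : num b = (Xv b - cst (t ^+ pp m a) * Xv a) * nb.
  by rewrite /num (bigD1 a).
have eda : den a = (Xv a - Xv b) * da by rewrite /den (bigD1 b).
have edb : den b = (Xv b - Xv a) * db by rewrite /den (bigD1 a).
have ea : \prod_(e | e != a) den e = (Xv b - Xv a) * db * E.
  by rewrite (bigD1 b) //= edb.
have eb : \prod_(e | e != b) den e = (Xv a - Xv b) * da * E.
  by rewrite (bigD1 a) //= eda; congr (_ * _); apply: eq_bigl => e; rewrite andbC.
(* Up to the factor E (Z_a - Z_b), the sum of the terms of index a and b; a
   second factor Z_a - Z_b is to be found in it. *)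
pose Y := cst (kap b * W b) * ((Xv b - cst (t ^+ pp m a) * Xv a) * nb * da * tau b F)
  - cst (kap a * W a) * ((Xv a - cst (t ^+ pp m b) * Xv b) * na * db * tau a F).
have [K eK] : exists K, Y = (Xv a - Xv b) * K.
  have enab : restr a b nb = restr a b na.
    rewrite /restr !ev_prod; apply: eq_big => [d|d /andP[db' da']]; first by rewrite andbC.
    by rewrite !evB !evM !evC !evX /diag_pt eqxx (negbTE ba).
  have edab : restr a b db = restr a b da.
    rewrite /restr !ev_prod; apply: eq_big => [d|d /andP[db' da']]; first by rewrite andbC.
    by rewrite !evB !evX /diag_pt eqxx (negbTE ba).
  have elin (c d : I) q : restr a b (Xv c - cst q * Xv d) =
      diag_pt A a b c - cst q * diag_pt A a b d.
    by rewrite /restr evB evM evC !evX.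
  have ecst x : restr a b (cst x) = cst x by rewrite /restr evC.
  apply: restr_eq0; rewrite /Y restr_comb enab edab !elin !ecst /diag_pt eqxx (negbTE ba).
  rewrite (rmorphM cst (kap b)) (rmorphM cst (kap a)) /=; apply: cancel_residues.
    by rewrite -(rmorph1 cst) -!(rmorphB cst) -!(rmorphM cst) /= kapE.
  rewrite !restr_tau.
  by have := qF a b 1%N ab; rewrite !expr1; apply; rewrite mu_gt0.
have [L eL] : exists L, \sum_(c | (c != a) && (c != b))
    T c = (Xv a - Xv b) * (Xv b - Xv a) * L.
  elim/big_ind: _ => [|x y [x' ->] [y' ->]|c /andP[ca cb]].
  - by exists 0; rewrite mulr0.
  - by exists (x' + y'); rewrite -mulrDr.
  rewrite /T (bigD1 a) /=; last by rewrite eq_sym.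
  rewrite (bigD1 b) /=; last by rewrite ba eq_sym cb.
  rewrite eda edb; move: (cst _) (num c) (\prod_(_ | _) _) (tau c F) => r1 r2 r3 r4.
  by exists (r1 * (r2 * (da * db * r3) * r4)); ring.
exists (L - E * K); rewrite eD eL /T ena enb ea eb mulrBr /=.
transitivity ((Xv a - Xv b) * E * Y + (Xv a - Xv b) * (Xv b - Xv a) * L).
  by rewrite /Y; ring.
by rewrite eK; ring.
Qed.
End Existence.

(** * Preservation of quasi-invariance *)

Section Coefficients.
Variables (n m : nat) (K : fieldType) (T : K) (u : 'I_n.+1 -> K).
Variables (c d : 'I_n.+1) (s : nat).
Local Notation sh := (shift m).
Hypothesis cd : c != d.
Hypothesis ucd : u c = u d.
Hypothesis u_neq0 : u d != 0.
Hypothesis Trs : T ^+ (rr m c * s) - 1 != 0.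

Let Tu : T ^+ (rr m c * s) * u d - u d != 0.
Proof. by rewrite -[X in _ - X]mul1r -mulrBl mulf_neq0. Qed.

Let uT : u d - T ^+ (rr m c * s) * u d != 0.
Proof. by rewrite -oppr_eq0 opprB. Qed.

(** By rr_mu the first factor vanishes when s is the multiplicity. *)
Lemma dcoef_self :
  dcoef m T (sh T c s u) c =
  (T ^+ (rr m c * s) - T ^+ pp m d) / (T ^+ (rr m c * s) - 1) *
  \prod_(x | (x != c) && (x != d))
   ((T ^+ (rr m c * s) * u d - T ^+ pp m x * u x) / (T ^+ (rr m c * s) * u d - u x)).
Proof.
rewrite /dcoef (bigD1 d) 1?eq_sym //=; congr (_ * _).
  by rewrite /shift eqxx [d == c]eq_sym (negbTE cd) ucd; field; rewrite ?Trs ?Tu ?uT.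
by apply: eq_bigr => x /andP[xc xd]; rewrite /shift eqxx (negbTE xc) ucd.
Qed.

Lemma dcoef_cross :
  dcoef m T (sh T c s u) d =
  (T ^+ (pp m c + rr m c * s) - 1) / (T ^+ (rr m c * s) - 1) *
  \prod_(x | (x != d) && (x != c)) ((u d - T ^+ pp m x * u x) / (u d - u x)).
Proof.
rewrite /dcoef (bigD1 c) //=; congr (_ * _).
  rewrite /shift eqxx [d == c]eq_sym (negbTE cd) ucd exprD.
  by field; rewrite ?Trs ?Tu ?uT.
by apply: eq_bigr => x /andP[xd xc]; rewrite /shift (negbTE xc) [d == c]eq_sym (negbTE cd).
Qed.
End Coefficients.

Section PointwisePreservation.
Variables (n m : nat) (A : idomainType) (t : A) (kap W : 'I_n.+1 -> A).
Local Notation I := 'I_n.+1.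
Local Notation P := (mpoly n.+1 A).
Local Notation sh := (shift m).

Hypothesis m_gt0 : (0 < m)%N.
Hypothesis kapE : forall c d, c != d ->
  kap c * (1 - t ^+ pp m d) = kap d * (1 - t ^+ pp m c).

Variables (K : fieldType) (phi : {rmorphism A -> K}) (F G : P).
Hypothesis qF : qi m t W F.
Hypothesis DFG : is_D m t kap W F G.
Local Notation T := (phi t).
Hypothesis T_nroot : forall k, (0 < k)%N -> T ^+ k != 1.

Variables (c d : I) (s : nat) (u : I -> K).
Hypothesis cd : c != d.
Hypothesis s_mu : (1 <= s <= mu m c d)%N.
Hypothesis ucd : u c = u d.
Hypothesis u_neq0 : u d != 0.
Hypothesis injc : injective (sh T c s u).
Hypothesis injd : injective (sh T d s u).

Let dc : d != c. Proof. by rewrite eq_sym. Qed.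

Let dcoef_split v e : e != c -> e != d ->
  dcoef m T v e =
  (v e - T ^+ pp m c * v c) / (v e - v c) *
  ((v e - T ^+ pp m d * v d) / (v e - v d) *
   \prod_(x | [&& x != e, x != c & x != d])
     ((v e - T ^+ pp m x * v x) / (v e - v x))).
Proof.
move=> ec ed; rewrite /dcoef (bigD1 c) 1?eq_sym //= (bigD1 d) /=; last first.
  by rewrite eq_sym ed.
by congr (_ * (_ * _)); apply: eq_bigl => x; rewrite andbA.
Qed.

Let uc_ne e : e != c -> u e - T ^+ (rr m c * s) * u d != 0.
Proof.
move=> ec; rewrite subr_eq0; apply: contra ec => /eqP E; apply/eqP/injc.
rewrite /shift eqxx ucd; case: (eqVneq e c) => [->|_] //.
by rewrite -ucd.
Qed.

Let ud_ne e : e != d -> u e - T ^+ (rr m d * s) * u d != 0.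
Proof.
move=> ed; rewrite subr_eq0; apply: contra ed => /eqP E; apply/eqP/injd.
by rewrite /shift eqxx; case: (eqVneq e d) => [->|_].
Qed.

Let u_ne e : e != c -> e != d -> u e - u d != 0.
Proof.
move=> ec ed; rewrite subr_eq0; apply: contra ed => /eqP E; apply/eqP/injc.
by rewrite /shift (negbTE ec) (negbTE dc).
Qed.

Let dcoef_other e : e != c -> e != d ->
  dcoef m T (sh T c s u) e = dcoef m T (sh T d s u) e.
Proof.
move=> ec ed; rewrite !dcoef_split //.
have tail : \prod_(x | [&& x != e, x != c & x != d])
     ((sh T c s u e - T ^+ pp m x * sh T c s u x) / (sh T c s u e - sh T c s u x)) =
   \prod_(x | [&& x != e, x != c & x != d])
     ((sh T d s u e - T ^+ pp m x * sh T d s u x) / (sh T d s u e - sh T d s u x)).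
  apply: eq_bigr => x /and3P[xe xc xd].
  by rewrite /shift (negbTE ec) (negbTE ed) (negbTE xc) (negbTE xd).
rewrite tail !mulrA; congr (_ * _); clear tail.
rewrite /shift !eqxx (negbTE ec) (negbTE ed) (negbTE cd) (negbTE dc) ucd.
have := uc_ne ec; have := ud_ne ed; have := u_ne ec ed.
have [[-> -> -> -> _] h1 h2 h3|[ms -> ->]] := mu_cases m cd.
  by field; rewrite h1 h3.
have -> : s = 1%N by move: s_mu; rewrite ms; case: s => [|[]].
rewrite !muln1 => h1 h2 h3.
by field; rewrite h1 h2 h3.
Qed.

Let kap_eq : T ^+ pp m c = T ^+ pp m d -> phi (kap c) = phi (kap d).
Proof.
move=> e; have := congr1 phi (kapE cd); rewrite !rmorphM !rmorphB !rmorph1 !rmorphXn e.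
apply: mulIf; rewrite subr_eq0 eq_sym T_nroot //.
by rewrite /pp; case: ifP.
Qed.

Let Trr (e : I) : T ^+ (rr m e * s) - 1 != 0.
Proof.
rewrite subr_eq0 T_nroot // muln_gt0 /rr; case/andP: s_mu => -> _.
by rewrite andbT; case: ifP.
Qed.

(** The operator is expanded at the point shifted s times along f_c and at the
    point shifted s times along f_d, and the terms are matched. A term of a
    third index gives the condition of order s at a shifted point of the
    hyperplane. The term shifting once more along the same index gives the
    condition of order s + 1, and its coefficient vanishes when s is the
    multiplicity. The term shifting along the opposite index gives the
    condition of order s - 1 at the point shifted once along both. *)
Lemma qi_preserved_at :
  phi (W c) ^+ s * ev phi (sh T c s u) G = phi (W d) ^+ s * ev phi (sh T d s u) G.
Proof.
rewrite (is_D_point phi injc DFG) (is_D_point phi injd DFG).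
rewrite (bigD1 c) // (bigD1 d) //= [in RHS](bigD1 c) // [in RHS](bigD1 d) //=.
have f_at v : v c = v d -> forall k, (k <= mu m c d)%N ->
    phi (W c) ^+ k * ev phi (sh T c k v) F = phi (W d) ^+ k * ev phi (sh T d k v) F.
  by move=> vcd k kmu; apply: qi_point.
have other : phi (W c) ^+ s * \sum_(e | (e != c) && (e != d))
      phi (kap e) * phi (W e) * dcoef m T (sh T c s u) e *
      ev phi (sh T e 1 (sh T c s u)) F =
    phi (W d) ^+ s * \sum_(e | (e != c) && (e != d))
      phi (kap e) * phi (W e) * dcoef m T (sh T d s u) e *
      ev phi (sh T e 1 (sh T d s u)) F.
  rewrite !mulr_sumr; apply: eq_bigr => e /andP[ec ed].
  rewrite dcoef_other // (eq_ev phi F (shiftC m T e c 1 s u)) (eq_ev phi F (shiftC m T e d 1 s u)) !(mulrCA (_ ^+ s)).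
  congr (_ * _); apply: f_at; last by case/andP: s_mu.
  by rewrite /shift ![_ == e]eq_sym (negbTE ec) (negbTE ed).
have self : phi (W c) ^+ s * (phi (kap c) * phi (W c) * dcoef m T (sh T c s u) c *
      ev phi (sh T c 1 (sh T c s u)) F) =
    phi (W d) ^+ s * (phi (kap d) * phi (W d) * dcoef m T (sh T d s u) d *
      ev phi (sh T d 1 (sh T d s u)) F).
  have [ms|sm] := eqVneq (mu m c d) s.
    rewrite (dcoef_self cd ucd u_neq0 (Trr c)) (dcoef_self dc (esym ucd) _ (Trr d)) ?ucd //.
    rewrite -ms rr_mu // muC rr_mu // !subrr !mul0r !mulr0 !mul0r.
    by rewrite !mulr0.
  case: (mu_cases m cd) => [[rc rd pc pd mm]|[mm _ _]]; last by lia.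
  rewrite (dcoef_self cd ucd u_neq0 (Trr c)) (dcoef_self dc (esym ucd) _ (Trr d)) ?ucd //.
  rewrite kap_eq ?pc ?pd // rc rd !mul1n.
  rewrite (eq_bigl (fun x => (x != d) && (x != c))); last by move=> x; rewrite andbC.
  rewrite (eq_ev phi F (shiftD m T c 1 s u)) (eq_ev phi F (shiftD m T d 1 s u)).
  have := f_at u ucd s.+1; rewrite !add1n mm => H.
  have {}H : phi (W c) ^+ s.+1 * ev phi (sh T c s.+1 u) F =
             phi (W d) ^+ s.+1 * ev phi (sh T d s.+1 u) F by apply: H; lia.
  move: H; rewrite !exprSr; set X := _ * (\prod_(_ | _) _) => H.
  transitivity (phi (kap d) * X * (phi (W c) ^+ s * phi (W c) * ev phi (sh T c s.+1 u) F)).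
    by ring.
  by rewrite H; ring.
have cross : phi (W c) ^+ s * (phi (kap d) * phi (W d) * dcoef m T (sh T c s u) d *
      ev phi (sh T d 1 (sh T c s u)) F) =
    phi (W d) ^+ s * (phi (kap c) * phi (W c) * dcoef m T (sh T d s u) c *
      ev phi (sh T c 1 (sh T d s u)) F).
  rewrite (dcoef_cross cd ucd u_neq0 (Trr c)) (dcoef_cross dc (esym ucd) _ (Trr d)) ?ucd //.
  rewrite [in RHS](eq_bigl (fun x => (x != d) && (x != c))); last by move=> x; rewrite andbC.
  have coefs : phi (kap d) * ((T ^+ (pp m c + rr m c * s) - 1) / (T ^+ (rr m c * s) - 1)) =
               phi (kap c) * ((T ^+ (pp m d + rr m d * s) - 1) / (T ^+ (rr m d * s) - 1)).
    case: (mu_cases m cd) => [[rc rd pc pd mm]|[mm pc pd]].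
      by rewrite (kap_eq _) ?rc ?rd ?pc ?pd.
    have s1 : s = 1%N by lia.
    have := congr1 phi (kapE cd); rewrite !rmorphM !rmorphB !rmorph1 !rmorphXn pd pc s1 !muln1.
    have := Trr c; have := Trr d; rewrite s1 !muln1 [(rr m d + _)%N]addnC => h1 h2 h3.
    rewrite !mulrA; apply/eqP; rewrite eqr_div //; apply/eqP.
    transitivity (- (phi (kap d) * (1 - T ^+ rr m d)) * (T ^+ (rr m c + rr m d) - 1)).
      by ring.
    by rewrite -h3; ring.
  pose v := sh T c 1 (sh T d 1 u).
  have [s' es] : exists s', s = s'.+1 by exists s.-1; lia.
  have ec : ev phi (sh T d 1 (sh T c s u)) F = ev phi (sh T c s' v) F.
    apply: eq_ev => x; rewrite shiftC /v shiftD.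
    by rewrite es addn1.
  have ed : ev phi (sh T c 1 (sh T d s u)) F = ev phi (sh T d s' v) F.
    apply: eq_ev => x; rewrite shiftC /v (eq_shift m T d s' (shiftC m T c d 1 1 u)) shiftD.
    by rewrite es addn1.
  (* The point shifted once along both f_c and f_d is on the hyperplane if
     both indices are ordinary; otherwise s' = 0. *)
  have efs : phi (W c) ^+ s' * ev phi (sh T c s' v) F = phi (W d) ^+ s' * ev phi (sh T d s' v) F.
    case: (mu_cases m cd) => [[rc rd pc pd mm]|[mm pc pd]].
      apply: f_at; last by lia.
      by rewrite /v /shift !eqxx (negbTE cd) (negbTE dc) rc rd ucd.
    have -> : s' = 0%N by lia.
    by rewrite !expr0 !mul1r; apply: eq_ev => x; rewrite !shift0.
  rewrite ec ed es !exprSr -es.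
  set X := \prod_(_ | _) _; move: coefs.
  set C1 := (_ - 1) / _; set C2 := (_ - 1) / _ => coefs.
  transitivity (phi (kap d) * C1 * phi (W c) * phi (W d) * X *
                (phi (W c) ^+ s' * ev phi (sh T c s' v) F)); first by ring.
  by rewrite coefs efs; ring.
by rewrite !mulrDr other self cross addrCA.
Qed.

End PointwisePreservation.

Section Preservation.
Variables (n m : nat) (A : idomainType) (t : A) (kap W : 'I_n.+1 -> A).
Local Notation I := 'I_n.+1.
Local Notation P := (mpoly n.+1 A).
Local Notation Xv i := (mpolyX A (mnm1 i)).
Local Notation cst := (@mpolyC n.+1 A).
Local Notation sh := (shift m).

Hypothesis m_gt0 : (0 < m)%N.
Hypothesis kapE : forall c d, c != d ->
  kap c * (1 - t ^+ pp m d) = kap d * (1 - t ^+ pp m c).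
Hypothesis t_neq0 : t != 0.
Hypothesis t_nroot : forall k, (0 < k)%N -> t ^+ k != 1.

Local Notation frac := (@tofrac P).
Local Notation phi := (frac \o cst : {rmorphism A -> {fraction P}}).

Lemma cstX_inj (a b : A) (e f : I) : a != 0 -> cst a * Xv e = cst b * Xv f ->
  (e = f) /\ (a = b).
Proof.
move=> a0 /(congr1 (mcoeff (mnm1 e))); rewrite !mul_mpolyC !mcoeffZ !mcoeffX eqxx mulr1.
have [->|ne] := eqVneq e f; first by rewrite eqxx mulr1.
case: eqP => [/(congr1 (fun x : multinom n.+1 => x e))|_ /eqP].
  by rewrite !mnmE eqxx eq_sym (negbTE ne).
by rewrite mulr0 (negbTE a0).
Qed.

(** Distinctness of the coordinates is what allows the operator to be
    evaluated at the shifted universal point. *)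
Lemma shift_diag_inj x c d s : c != d -> (x == c) || (x == d) -> (0 < s)%N ->
  injective (sh (cst t) x s (diag_pt A c d)).
Proof.
move=> cd xcd s0.
have k0 : (0 < rr m x * s)%N by rewrite muln_gt0 s0 andbT /rr; case: ifP.
pose k := (rr m x * s)%N.
pose a (e : I) := if e == x then t ^+ k else 1.
pose p (e : I) := if e == c then d else e.
have E e : sh (cst t) x s (diag_pt A c d) e = cst (a e) * Xv (p e).
  rewrite /shift /diag_pt /a /p; case: (e == x); case: (e == c);
  by rewrite ?rmorphXn ?rmorph1 ?mul1r.
have tk1 : t ^+ k != 1 by apply: t_nroot.
have a0 e : a e != 0 by rewrite /a; case: ifP; rewrite ?expf_neq0 ?oner_eq0.
move=> e f; rewrite !E => /(cstX_inj (a0 e)) []; rewrite /a /p.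
case: (eqVneq e c) => [->|ec]; case: (eqVneq f c) => [->|fc] //.
- move=> df; rewrite -df; case/orP: xcd => /eqP ->; rewrite eqxx 1?[d == c]eq_sym (negbTE cd).
    by move/eqP; rewrite (negbTE tk1).
  by move/esym/eqP; rewrite (negbTE tk1).
move=> df; rewrite df; case/orP: xcd => /eqP ->; rewrite eqxx 1?[d == c]eq_sym (negbTE cd).
  by move/esym/eqP; rewrite (negbTE tk1).
by move/eqP; rewrite (negbTE tk1).
Qed.

(** The condition is an identity at the universal point of the hyperplane, so
    it can be checked in the fraction field, where the coefficients of the
    operator have values. *)
Lemma qi_D F G : qi m t W F -> is_D m t kap W F G -> qi m t W G.
Proof.
move=> qF DFG c d s cd s_mu.
have [s0 _] := andP s_mu.
have fI : injective frac by move=> x y /eqP; rewrite tofrac_eq => /eqP.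
have E e : frac (cst (W e ^+ s) * ev cst (sh (cst t) e s (diag_pt A c d)) G) =
    phi (W e) ^+ s * ev phi (sh (phi t) e s (frac \o diag_pt A c d)) G.
  rewrite rmorphM !rmorphXn rmorph_ev; congr (_ * _); apply: eq_ev => x /=.
  rewrite /shift; case: (x == e) => //=.
  by rewrite rmorphM rmorphXn.
apply: (fI _ _); rewrite !E.
have inj_frac e : injective (sh (cst t) e s (diag_pt A c d)) ->
    injective (sh (phi t) e s (frac \o diag_pt A c d)).
  move=> H; apply: (eq_inj (f := frac \o sh (cst t) e s (diag_pt A c d))).
    exact: (inj_comp fI H).
  move=> x /=; rewrite /shift; case: (x == e) => //=.
  by rewrite rmorphM rmorphXn.
apply: (qi_preserved_at m_gt0 kapE qF DFG) => //.
- move=> k k0; rewrite -rmorphXn -(rmorph1 phi) /= tofrac_eq mpolyC_eq.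
  exact: t_nroot.
- by rewrite /= /diag_pt eqxx eq_sym (negbTE cd).
- rewrite /= tofrac_eq0 /diag_pt [d == c]eq_sym (negbTE cd).
  apply/eqP => /(congr1 (mcoeff (mnm1 d))); rewrite mcoeffX eqxx mcoeff0.
  by move/eqP; rewrite oner_eq0.
- by apply/inj_frac/shift_diag_inj; rewrite ?eqxx.
by apply/inj_frac/shift_diag_inj; rewrite ?eqxx ?orbT.
Qed.
End Preservation.

(** * Leading parts *)

Section Top.
Variable R : idomainType.
Implicit Types p q : {poly R}.

(** Unlike the leading coefficient, the coefficient at a given degree bound is
    multiplicative and additive even when it vanishes. *)
Definition top D p a := (size p <= D.+1)%N /\ p`_D = a.

Lemma topM D E p q a b : top D p a -> top E q b -> top (D + E) (p * q) (a * b).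
Proof.
case=> sp <- [sq <-]; split.
  by apply: leq_trans (size_polyMleq _ _) _; lia.
rewrite coefM (bigD1 (inord D)) //= inordK ?ltnS ?leq_addr // addKn.
rewrite big1 ?addr0 // => -[j jlt] /= jD.
have {jD} : j != D.
  apply: contraNneq jD => e; apply/eqP/val_inj.
  by rewrite /= inordK ?ltnS ?leq_addr.
rewrite neq_ltn => /orP[jD|Dj].
  by rewrite [q`_ _]nth_default ?mulr0 //; apply: leq_trans sq _; lia.
by rewrite [p`_ _]nth_default ?mul0r //; apply: leq_trans sp _.
Qed.

Lemma top1 : top 0 1 1.
Proof. by split; rewrite ?size_poly1 ?coef1. Qed.

Lemma topC a : top 0 a%:P a.
Proof. by split; rewrite ?size_polyC ?coefC //; case: eqP. Qed.

Lemma top_prod (T : Type) (s : seq T) (Q : pred T) (D : T -> nat)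
    (p : T -> {poly R}) (a : T -> R) :
  (forall i, Q i -> top (D i) (p i) (a i)) ->
  top (\sum_(i <- s | Q i) D i) (\prod_(i <- s | Q i) p i) (\prod_(i <- s | Q i) a i).
Proof.
move=> H; elim/big_ind3: _ => //; first exact: top1.
by move=> ? ? ? ? ? ?; apply: topM.
Qed.

Lemma top_sum (T : Type) (s : seq T) (Q : pred T) D
    (p : T -> {poly R}) (a : T -> R) :
  (forall i, Q i -> top D (p i) (a i)) ->
  top D (\sum_(i <- s | Q i) p i) (\sum_(i <- s | Q i) a i).
Proof.
move=> H; elim/big_ind2: _ => //; first by split; rewrite ?size_poly0 ?coef0.
move=> p1 a1 p2 a2 [s1 <-] [s2 <-]; split; last by rewrite coefD.
by apply: leq_trans (size_polyD _ _) _; rewrite geq_max s1 s2.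
Qed.

Lemma top_div D E p q a b :
  a != 0 -> top E p a -> top (E + D) (p * q) b -> top D q (q`_D) /\ a * q`_D = b.
Proof.
move=> a0 [sp pa] [spq <-].
have p0 : p != 0 by apply: contra_neq a0 => p0; rewrite -pa p0 coef0.
have szp : size p = E.+1.
  by apply/eqP; rewrite eqn_leq sp ltnNge; apply: contra a0 => /(nth_default 0); rewrite pa => ->.
have sq : (size q <= D.+1)%N.
  have [->|q0] := eqVneq q 0; first by rewrite size_poly0.
  by move: spq; rewrite size_mul // szp; lia.
have tq : top D q q`_D by split.
by split => //; case: (topM (conj sp pa) tq).
Qed.
End Top.

Section LeadingPart.
Variables (n m : nat) (A : idomainType) (t : A) (kap W : 'I_n.+1 -> A).
Local Notation I := 'I_n.+1.
Local Notation P := (mpoly n.+1 A).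
Local Notation Xv i := (mpolyX A (mnm1 i)).
Local Notation cst := (@mpolyC n.+1 A).
Local Notation sh := (shift m).
Local Notation is_D := (is_D m t kap W).
Local Notation tau := (tau m t).
Variable h : I -> nat.
Local Notation w := (wpoly h).

Lemma mcoeff_tau (c : I) F k : mcoeff k (tau c F) = t ^+ (rr m c * k c) * mcoeff k F.
Proof.
have E : tau c F =
    \sum_(j <- msupp F) (t ^+ (rr m c * j c) * mcoeff j F) *: mpolyX A j.
  rewrite /tau evE; apply: eq_bigr => j _.
  have -> : \prod_i sh (cst t) c 1 (fun i => Xv i) i ^+ j i =
      cst (t ^+ (rr m c * j c)) * mpolyX A j.
    rewrite mpolyXE_id (bigD1 c) //= [in RHS](bigD1 c) //= mulrA; congr (_ * _).
      by rewrite /shift eqxx muln1 exprMn -!rmorphXn -exprM.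
    by apply: eq_bigr => i ic; rewrite /shift (negbTE ic).
  by rewrite -mul_mpolyC (rmorphM cst) /= mulrCA mulrA.
rewrite E raddf_sum /=.
transitivity (\sum_(j <- msupp F) if j == k then t ^+ (rr m c * k c) * mcoeff k F else 0).
  apply: eq_bigr => j _; rewrite mcoeffZ mcoeffX.
  by case: eqP => [->|_]; rewrite ?mulr1 ?mulr0.
rewrite -big_mkcond /=.
have [kF|kF] := boolP (k \in msupp F).
  by rewrite -big_filter filter_pred1_uniq // big_seq1.
rewrite (memN_msupp_eq0 kF) mulr0 big1_seq //.
Qed.

(** The part of highest weight of Z_a - q Z_b. *)
Definition lin_top (a b : I) (q : A) : P :=
  if (h a < h b)%N then - (cst q * Xv b)
  else if (h b < h a)%N then Xv a else Xv a - cst q * Xv b.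

Lemma top_lin a b q :
  top (maxn (h a) (h b)) (w (Xv a - cst q * Xv b)) (lin_top a b q).
Proof.
have -> : w (Xv a - cst q * Xv b) =
    (Xv a)%:P * 'X^(h a) - (cst q * Xv b)%:P * 'X^(h b).
  by rewrite /wpoly evB evM evC !evX /= mulrA -rmorphM.
have szm (x : P) k D : (k <= D)%N -> (size (x%:P * 'X^k : {poly P})%R <= D.+1)%N.
  move=> kD; apply: leq_trans (size_polyMleq _ _) _.
  by rewrite size_polyXn size_polyC; case: (x != 0) => /=; lia.
split.
  apply: leq_trans (size_polyD _ _) _; rewrite size_polyN geq_max.
  by rewrite !szm ?leq_maxl ?leq_maxr.
rewrite coefB !coefCM !coefXn /lin_top.
case: (ltngtP (h a) (h b)) => hab.
- by rewrite eqxx (gtn_eqF hab) mulr0 mulr1 sub0r.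
- by rewrite eqxx (gtn_eqF hab) mulr0 mulr1 subr0.
- by rewrite hab eqxx !mulr1.
Qed.
Let dtop c := \prod_(d | d != c) lin_top c d 1.
Let ntop c := \prod_(d | d != c) lin_top c d (t ^+ pp m d).
Let deg c := (\sum_(d | d != c) maxn (h c) (h d))%N.

Let top_den c : top (deg c) (w (den A c)) (dtop c).
Proof.
rewrite /wpoly ev_prod; apply: top_prod => d _.
by have := top_lin c d 1; rewrite rmorph1 mul1r.
Qed.

Let top_num c : top (deg c) (w (num m t c)) (ntop c).
Proof. by rewrite /wpoly ev_prod; apply: top_prod => d _; apply: top_lin. Qed.

Let dtop_neq0 c : dtop c != 0.
Proof.
apply/prodf_neq0 => d dc; rewrite /lin_top rmorph1 mul1r.
have X0 i : Xv i != 0.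
  apply/eqP => /(congr1 (mcoeff (mnm1 i))); rewrite mcoeffX eqxx mcoeff0.
  by move/eqP; rewrite oner_eq0.
case: ifP => _; first by rewrite oppr_eq0 X0.
case: ifP => _; [exact: X0 | by apply: subX_neq0; rewrite eq_sym].
Qed.

Let top_tau c F D : (size (w F) <= D.+1)%N ->
  top D (w (tau c F)) (w (tau c F))`_D.
Proof.
move=> sF; split=> //; apply/size_wpolyP => k; rewrite mcoeff_tau => kF.
by move/size_wpolyP: sF; apply; apply: contraNneq kF => ->; rewrite mulr0.
Qed.

Let top_D F G D : is_D F G -> (size (w F) <= D.+1)%N ->
  top D (w G) (w G)`_D /\
  (\prod_c dtop c) * (w G)`_D =
  \sum_c cst (kap c * W c) *
     (ntop c * \prod_(a | a != c) dtop a * (w (tau c F))`_D).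
Proof.
move=> DFG sF; apply: (@top_div _ D (\sum_c deg c)%N (w (disc n A))).
- by apply/prodf_neq0 => c _.
- by rewrite /wpoly ev_prod; apply: top_prod => c _; apply: top_den.
have -> : w (disc n A) * w G = w (Dnum m t kap W F) by rewrite -DFG /wpoly evM.
rewrite /Dnum /wpoly ev_sum; apply: top_sum => c _.
rewrite !evM evC /= -[(_ + D)%N]add0n; apply: topM; first exact: topC.
apply: topM; last exact: top_tau.
rewrite (bigD1 c) //=; apply: topM; first exact: top_num.
by rewrite ev_prod; apply: top_prod => a _; apply: top_den.
Qed.

Lemma size_wpoly_D F G D : is_D F G -> (size (w F) <= D.+1)%N ->
  (size (w G) <= D.+1)%N.
Proof. by move=> DFG /(top_D DFG)[[]]. Qed.

(** The power of t contributed by the monomial k to the term of index c: the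
    exponent of Z_c, and one numerator for each index of higher weight. By
    rr_mu the latter is the power rr m c * mu m c d of t. *)
Definition exponent (k : multinom n.+1) (c : I) : nat :=
  (k c + \sum_(d | (h c < h d)%N) mu m c d)%N.

Definition eigval (om : I -> nat) : A :=
  \sum_c kap c * W c * t ^+ (rr m c * om c).

(** When the weights are distinct, the leading part of (Z_c - t^(pp d) Z_d) /
    (Z_c - Z_d) is 1 or t^(pp d), depending on which variable is heavier. So
    the leading part of the operator is diagonal in the monomials. *)
Lemma mcoeff_D_top F G k : injective h -> is_D F G ->
  (size (w F) <= (mwt h k).+1)%N ->
  mcoeff k G = eigval (exponent k) * mcoeff k F.
Proof.
move=> hI DFG sF; have [_ E] := top_D DFG sF.
have nd c : ntop c = cst (t ^+ (\sum_(d | (h c < h d)%N) pp m d)) * dtop c.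
  rewrite /ntop /dtop expr_sum (rmorph_prod cst) /=.
  rewrite [X in _ = X * _](_ : _ =
      \prod_(d | d != c) if (h c < h d)%N then cst (t ^+ pp m d) else 1); last first.
    rewrite -big_mkcondr; apply: eq_bigl => d.
    by case: (eqVneq d c) => [->|]; rewrite ?ltnn.
  rewrite -big_split; apply: eq_bigr => d dc; rewrite /lin_top.
  have : h c != h d by rewrite (inj_eq hI) eq_sym.
  rewrite neq_ltn; case: (ltngtP (h c) (h d)) => //= _ _.
    by rewrite rmorph1 mul1r mulrN.
  by rewrite mul1r.
have d0 : \prod_c dtop c != 0 by apply/prodf_neq0 => c _.
have {}E : (w G)`_(mwt h k) =
    \sum_c cst (kap c * W c) * cst (t ^+ (\sum_(d | (h c < h d)%N) pp m d)) *
      (w (tau c F))`_(mwt h k).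
  apply: (mulfI d0); rewrite E mulr_sumr; apply: eq_bigr => c _.
  rewrite nd [\prod_i dtop i](bigD1 c) //=.
  move: (cst _) (cst _) (dtop c) (\prod_(_ | _) _) (_`__) => *; ring.
have := congr1 (mcoeff k) E; rewrite mcoeff_wpoly eqxx => ->.
rewrite raddf_sum /eigval mulr_suml; apply: eq_bigr => c _ /=.
rewrite -mulrA !mul_mpolyC !mcoeffZ mcoeff_wpoly eqxx mcoeff_tau !mulrA; congr (_ * _).
rewrite -!mulrA -!exprD; congr (_ * (_ * t ^+ _)).
rewrite /exponent mulnDr addnC; congr (_ + _)%N; rewrite big_distrr /=.
apply: eq_bigr => d hcd; rewrite rr_mu //.
by apply: contraTneq hcd => ->; rewrite ltnn.
Qed.
End LeadingPart.

(** * Strings and wall crossing *)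

Lemma seq_argmin (T : eqType) (s : seq T) (f : T -> nat) x :
  x \in s -> exists2 y, y \in s & forall z, z \in s -> (f y <= f z)%N.
Proof.
move=> xs; have ex : exists k, has (fun y => f y == k) s.
  by exists (f x); apply/hasP; exists x.
case: (ex_minnP ex) => k /hasP[y ys /eqP yk] kmin; exists y => // z zs.
by rewrite yk; apply: kmin; apply/hasP; exists z.
Qed.

(** With y k = u k + v k and u k * v k = p, the sequences u k ^+ s - v k ^+ s
    satisfy a common recurrence, which turns the equations into the vanishing
    of the sum of f k (u k - v k) P(y k) for every P of degree less than M.
    The y k are distinct, because u k is neither u l nor v l, so P can be
    chosen to vanish at all of them but one. *)
Lemma reflected_vandermonde (R : idomainType) (T : eqType) (S : seq T)
    (f u v : T -> R) (p : R) (M : nat) :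
  uniq S -> (size S <= M)%N ->
  (forall k, k \in S -> u k * v k = p) ->
  (forall k l, k \in S -> l \in S -> u k != v l) ->
  (forall k l, k \in S -> l \in S -> k != l -> u k != u l) ->
  (forall s, (1 <= s <= M)%N -> \sum_(k <- S) f k * (u k ^+ s - v k ^+ s) = 0) ->
  forall k, k \in S -> f k = 0.
Proof.
move=> uS sS uvp uv uu H k0 k0S.
pose y k := u k + v k.
have step j : forall s, (s + j <= M)%N ->
    \sum_(k <- S) f k * (u k ^+ s - v k ^+ s) * y k ^+ j = 0.
  elim: j => [|j IH] [|s] sj.
  - by rewrite big1_seq // => k _; rewrite subrr mulr0 mul0r.
  - by rewrite -[RHS](H s.+1) ?addn0 //; [apply: eq_bigr => k _; rewrite mulr1 | lia].
  - by rewrite big1_seq // => k _; rewrite subrr mulr0 mul0r.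
  have e1 := IH s.+2; have e2 := IH s.
  transitivity (\sum_(k <- S) f k * (u k ^+ s.+2 - v k ^+ s.+2) * y k ^+ j +
                p * \sum_(k <- S) f k * (u k ^+ s - v k ^+ s) * y k ^+ j); last first.
    by rewrite e1 ?e2 ?mulr0 ?addr0 //; lia.
  rewrite mulr_sumr -big_split; apply: eq_big_seq => k kS /=.
  by rewrite -(uvp k kS) !exprS /y; ring.
have poly0 (P : {poly R}) : (size P <= M)%N ->
    \sum_(k <- S) f k * (u k - v k) * P.[y k] = 0.
  move=> sP; under eq_bigr => k _ do rewrite (horner_coef_wide _ sP) mulr_sumr.
  rewrite exchange_big big1 //= => i _.
  transitivity (P`_i * \sum_(k <- S) f k * (u k ^+ 1 - v k ^+ 1) * y k ^+ i).
    by rewrite mulr_sumr; apply: eq_bigr => k _; rewrite !expr1; ring.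
  by rewrite step ?mulr0 // add1n.
(* The polynomial that vanishes at all y k except y k0. *)
pose P := \prod_(z <- map y (rem k0 S)) ('X - z%:P).
have := poly0 P; rewrite size_prod_XsubC size_map size_rem // prednK; last by case: (S) k0S.
move/(_ sS); rewrite (big_rem k0) //= [\sum_(_ <- rem _ _) _]big1_seq ?addr0; last first.
  move=> k /andP[_ kS]; apply/eqP; rewrite mulf_eq0; apply/orP; right.
  by rewrite -[_ == 0]/(root P _) root_prod_XsubC; apply/map_f.
move/eqP; rewrite !mulf_eq0 subr_eq0 (negbTE (uv _ _ k0S k0S)) orbF.
case/orP=> [/eqP //|].
rewrite horner_prod big_map prodf_seq_eq0 => /hasP[l lS /=].
have lS' : l \in S by apply: mem_rem lS.
have lk : l != k0 by move: lS; rewrite mem_rem_uniq // inE => /andP[].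
rewrite hornerXsubC subr_eq0 => /eqP yy.
have : (u k0 - u l) * (u k0 - v l) = 0.
  transitivity (u k0 * (u k0 - y l) + u l * v l); first by rewrite /y; ring.
  by rewrite -yy (uvp l) // -(uvp k0) // /y; ring.
move/eqP; rewrite mulf_eq0 !subr_eq0 (negbTE (uv _ _ _ _)) // orbF.
by rewrite (negbTE (uu _ _ _ _ _)) // eq_sym.
Qed.

Lemma expr_neq (R : idomainType) (t : R) a b : t != 0 ->
  (forall k, (0 < k)%N -> t ^+ k != 1) -> (a < b)%N -> t ^+ a != t ^+ b.
Proof.
move=> t0 tn ab; rewrite -(subnKC (ltnW ab)) exprD -subr_eq0 -{1}[t ^+ a]mulr1 -mulrBr.
rewrite mulf_neq0 ?expf_neq0 // subr_eq0 eq_sym tn //; lia.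
Qed.

Section Strings.
Variables (n m : nat) (A : idomainType) (t : A) (W : 'I_n.+1 -> A).
Local Notation I := 'I_n.+1.
Local Notation P := (mpoly n.+1 A).
Local Notation cst := (@mpolyC n.+1 A).
Local Notation sh := (shift m).

Hypothesis t_neq0 : t != 0.
Hypothesis t_nroot : forall k, (0 < k)%N -> t ^+ k != 1.
Hypothesis W_neq0 : forall c, W c != 0.
Hypothesis W_generic : forall (c d : I) i j, c != d -> W c * t ^+ i != W d * t ^+ j.

Variables (F : P) (c d : I).
Hypothesis qF : qi m t W F.
Hypothesis cd : c != d.

(** The exponent of the restriction of the monomial k to the hyperplane Z_c =
    Z_d. *)
Definition fold_exp (k : multinom n.+1) : multinom n.+1 :=
  Multinom [tuple (if i == c then 0 else if i == d then k c + k d else k i)%N | i < n.+1].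

Lemma mcoeff_fold (x : I) s om : (x == c) || (x == d) ->
  mcoeff om (ev cst (sh (cst t) x s (diag_pt A c d)) F) =
  \sum_(k <- [seq k <- msupp F | fold_exp k == om])
     mcoeff k F * t ^+ (rr m x * s * k x).
Proof.
move=> xcd; rewrite evE raddf_sum big_filter [RHS]big_mkcond; apply: eq_bigr => k _ /=.
have -> : \prod_i sh (cst t) x s (diag_pt A c d) i ^+ k i =
    cst (t ^+ (rr m x * s * k x)) * mpolyX A (fold_exp k).
  have -> : \prod_i sh (cst t) x s (diag_pt A c d) i ^+ k i =
      cst (t ^+ (rr m x * s * k x)) * \prod_i diag_pt A c d i ^+ k i.
    rewrite (bigD1 x) //= [in RHS](bigD1 x) //= mulrA; congr (_ * _).
      by rewrite /shift eqxx exprMn -!rmorphXn -exprM.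
    by apply: eq_bigr => i ix; rewrite /shift (negbTE ix).
  congr (_ * _); rewrite mpolyXE_id.
  have dc : d != c by rewrite eq_sym.
  rewrite (bigD1 c) //= (bigD1 d) //= [RHS](bigD1 c) //= [in RHS](bigD1 d) //=.
  rewrite !mnmE /diag_pt !eqxx (negbTE dc) expr0 mul1r mulrA -exprD; congr (_ * _).
  by apply: eq_bigr => i /andP[ic id]; rewrite mnmE (negbTE ic) (negbTE id).
rewrite mulrA -(rmorphM cst) /= mul_mpolyC mcoeffZ mcoeffX.
by case: eqP => _; rewrite ?mulr1 ?mulr0.
Qed.

Lemma fold_expE k i :
  fold_exp k i = (if i == c then 0 else if i == d then k c + k d else k i)%N.
Proof. exact: mnmE. Qed.

(** Consider the monomials of F with the same restriction to Z_c = Z_d.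
    Quasi-invariance gives mu m c d equations for their coefficients. If their
    exponents of Z_d lay among mu m c d consecutive values, the system would
    be of the form treated in reflected_vandermonde, or concern a single
    monomial, and all the coefficients would vanish. *)
Lemma long_string k0 : mcoeff k0 F != 0 ->
  exists k1 k2 : multinom n.+1, [/\ mcoeff k1 F != 0, mcoeff k2 F != 0,
    fold_exp k1 = fold_exp k0, fold_exp k2 = fold_exp k0 &
    (k1 d + mu m c d <= k2 d)%N].
Proof.
move=> k0F; have dc : d != c by rewrite eq_sym.
pose S := [seq k <- msupp F | fold_exp k == fold_exp k0].
have SP k : (k \in S) = (mcoeff k F != 0) && (fold_exp k == fold_exp k0).
  by rewrite mem_filter mcoeff_msupp andbC.
have k0S : k0 \in S by rewrite SP k0F eqxx.
have uS : uniq S by rewrite filter_uniq.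
have [k1 k1S k1min] := seq_argmin (fun k : multinom n.+1 => k d) k0S.
have [/hasP[k2 k2S k12]|] := boolP (has (fun k : multinom n.+1 => (k1 d + mu m c d <= k d)%N) S).
  by exists k1, k2; move: k1S k2S; rewrite !SP => /andP[-> /eqP->] /andP[-> /eqP->].
move/hasPn => small; exfalso.
(* The total exponent of Z_c and Z_d is constant along the string, so that the
   two weights of a monomial have constant product. *)
pose N := (k0 c + k0 d)%N.
have SN (k : multinom n.+1) : k \in S -> (k c + k d)%N = N.
  rewrite SP => /andP[_ /eqP /(congr1 (fun x : multinom n.+1 => x d))].
  by rewrite !fold_expE eqxx (negbTE dc).
have Sinj (k l : multinom n.+1) : k \in S -> l \in S -> k d = l d -> k = l.
  move=> kS lS kld; have := SN k kS; have := SN l lS; rewrite -kld => e1 e2.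
  apply/mnmP => i; case: (eqVneq i c) => [->|ic]; first by lia.
  case: (eqVneq i d) => [->|id'] //.
  move: kS lS; rewrite !SP => /andP[_ /eqP ek] /andP[_ /eqP]; rewrite -ek.
  move=> /(congr1 (fun x : multinom n.+1 => x i)).
  by rewrite !fold_expE (negbTE ic) (negbTE id').
have sS : (size S <= mu m c d)%N.
  rewrite -(size_map (fun k : multinom n.+1 => k d) S) -(size_iota (k1 d) (mu m c d)).
  apply: uniq_leq_size; first by rewrite map_inj_in_uniq // => k l; apply: Sinj.
  move=> x /mapP[k kS ->]; rewrite mem_iota k1min //=.
  by have := small k kS; rewrite -ltnNge.
have zero s : (1 <= s <= mu m c d)%N -> \sum_(k <- S) mcoeff k F *
    ((W c * t ^+ (rr m c * k c)) ^+ s - (W d * t ^+ (rr m d * k d)) ^+ s) = 0.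
  move=> s_mu; have /(congr1 (mcoeff (fold_exp k0))) := qF cd s_mu.
  rewrite !mul_mpolyC !mcoeffZ !mcoeff_fold ?eqxx ?orbT // -/S => /eqP.
  rewrite -subr_eq0 !mulr_sumr -sumrB => /eqP E; rewrite -[RHS]E.
  apply: eq_bigr => k _; rewrite !exprMn -!exprM.
  by rewrite [(rr m c * s * k c)%N]mulnAC [(rr m d * s * k d)%N]mulnAC; ring.
suff /eqP : mcoeff k0 F = 0 by rewrite (negbTE k0F).
case: (mu_cases m cd) => [[rc rd _ _ mm]|[mm _ _]].
  apply: (@reflected_vandermonde _ _ S (fun k => mcoeff k F)
    (fun k : multinom n.+1 => W c * t ^+ (rr m c * k c))
    (fun k : multinom n.+1 => W d * t ^+ (rr m d * k d))
    (W c * W d * t ^+ N) _ uS sS _ _ _ zero) => //.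
  - move=> k kS; rewrite rc rd !mul1n -(SN k kS) exprD; ring.
  - by move=> k l _ _; apply: W_generic.
  move=> k l kS lS kl; rewrite rc !mul1n (inj_eq (mulfI (W_neq0 c))).
  have klc : k c != l c.
    apply: contra kl => /eqP e; apply/eqP/Sinj => //.
    by have := SN k kS; have := SN l lS; lia.
  have tI := expr_neq t_neq0 t_nroot.
  by move: klc; rewrite neq_ltn => /orP[/tI //|/tI]; rewrite eq_sym.
have [k' S1] : exists k', S = [:: k'].
  case: (S) k0S sS => [|k' [|k'' S']] //; first by exists k'.
  by rewrite mm.
have k0k' : k' = k0 by move: k0S; rewrite S1 inE => /eqP.
have := zero 1%N; rewrite mm => /(_ isT); rewrite S1 big_seq1 k0k' !expr1 => /eqP.
by rewrite mulf_eq0 subr_eq0 (negbTE (W_generic _ _ cd)) orbF => /eqP.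
Qed.

End Strings.

Section Tops.
Variables (n : nat) (A : nzRingType).
Local Notation I := 'I_n.+1.
Implicit Types (F : mpoly n.+1 A) (k : multinom n.+1) (w : I -> nat).

Definition mdegs (K : {set I}) (k : multinom n.+1) : nat := (\sum_(c in K) k c)%N.

Definition is_top F (w : I -> nat) (k : multinom n.+1) : Prop :=
  mcoeff k F != 0 /\ forall l, mcoeff l F != 0 -> (mwt w l <= mwt w k)%N.

Lemma top_exists F w : F != 0 -> exists k, is_top F w k.
Proof.
move=> F0; have [k kF] : exists k, k \in msupp F.
  by case E: (msupp F) => [|k s]; [rewrite (msuppnil0 E) eqxx in F0|exists k; rewrite mem_head].
pose b := (\max_(l <- msupp F) mwt w l)%N.
have lb l : l \in msupp F -> (mwt w l <= b)%N by move=> lF; apply: leq_bigmax_seq.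
have [k' k'F kmax] := seq_argmin (fun l => b - mwt w l)%N kF.
exists k'; split; first by rewrite -mcoeff_msupp.
move=> l; rewrite -mcoeff_msupp => lF.
by have := kmax l lF; have := lb l lF; have := lb k' k'F; lia.
Qed.

End Tops.

Section WallCrossing.
Variables (n m : nat) (A : idomainType) (t : A) (W : 'I_n.+1 -> A).
Local Notation I := 'I_n.+1.
Local Notation P := (mpoly n.+1 A).

Hypothesis t_neq0 : t != 0.
Hypothesis t_nroot : forall k, (0 < k)%N -> t ^+ k != 1.
Hypothesis W_neq0 : forall c, W c != 0.
Hypothesis W_generic : forall (c d : I) i j, c != d -> W c * t ^+ i != W d * t ^+ j.

Variables (F : P) (K : {set I}) (h : I -> nat).
Hypothesis qF : qi m t W F.
Hypothesis sidon : forall a b a' b' : I, (h b < h a)%N -> (h b' < h a')%N ->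
  (h a + h b' = h a' + h b)%N -> (a, b) = (a', b').

Let hT T (c : I) : nat := (h c + T * (c \in K))%N.

Let mwt_hT T k : mwt (hT T) k = (mwt h k + T * mdegs K k)%N.
Proof.
rewrite /mwt /hT (eq_bigr (fun c => h c * k c + T * ((c \in K) * k c))%N); last first.
  by move=> c _; rewrite mulnDl mulnA.
rewrite big_split /= -big_distrr /=; congr (_ + _ * _)%N.
by rewrite [RHS]big_mkcond; apply: eq_bigr => c _; case: (c \in K); rewrite ?mul1n ?mul0n.
Qed.

Definition crossed (p : I * I) := [&& p.1 \notin K, p.2 \in K & (h p.2 < h p.1)%N].

(** Add T to the weights of the indices in K and let T grow. The top changes
    only when the weights of some a outside K and some b in K become equal;
    then all monomials of a string in direction f_b - f_a are tops, and by
    long_string the degree in K grows by at least the multiplicity. The Sidon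
    property of h makes the walls come one at a time. *)
Lemma wall_crossing k0 : is_top F h k0 ->
  exists2 k, mcoeff k F != 0 &
    (mdegs K k0 + \sum_(p | crossed p) mu m p.1 p.2 <= mdegs K k)%N.
Proof.
move=> [k0F k0top].
have F0 : F != 0 by apply: contraNneq k0F => ->; rewrite mcoeff0.
(* For T = 0 no wall has been crossed; for T beyond all weights every wall
   has. *)
have walk T : exists2 k, is_top F (hT T) k &
    (mdegs K k0 + \sum_(p | crossed p && (h p.1 <= h p.2 + T)%N) mu m p.1 p.2 <= mdegs K k)%N.
  elim: T => [|T [k [kF ktop] kdeg]].
    exists k0; last first.
      rewrite big1 ?addn0 // => -[a b] /andP[/and3P[_ _ /=]]; lia.
    by split=> // l lF; rewrite !mwt_hT !addn0 k0top.
  have [k' k'top] := top_exists (hT T.+1) F0.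
  have face l : is_top F (hT T.+1) l -> (mdegs K k <= mdegs K l)%N.
    move=> [lF ltop]; have := ltop k kF; have := ktop l lF; rewrite !mwt_hT; lia.
  have [/existsP[[a b] /andP[/and3P[/= aK bK ba] /eqP hab]]|none] :=
      boolP [exists p, crossed p && (h p.1 == h p.2 + T.+1)%N].
    have ab : a != b by apply: contraNneq aK => ->.
    have [k1 [k2 [k1F k2F e1 e2 len]]] :=
      long_string t_neq0 t_nroot W_neq0 W_generic qF ab (proj1 k'top).
    have split_ab f (l : multinom n.+1) : (\sum_c f c * l c = f a * l a + (f b * l b +
        \sum_(c | (c != a) && (c != b)) f c * l c))%N.
      by rewrite (bigD1 a) //= (bigD1 b) 1?eq_sym.
    have string_wt l : fold_exp a b l = fold_exp a b k' ->
        mwt (hT T.+1) l = mwt (hT T.+1) k'.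
      move=> el; rewrite /mwt !split_ab.
      have habT : hT T.+1 a = hT T.+1 b by move: hab; rewrite /hT (negbTE aK) bK; clear; lia.
      have ed x := congr1 (fun y : multinom n.+1 => y x) el.
      have := ed b; rewrite /= !fold_expE eqxx eq_sym (negbTE ab) => eb.
      rewrite habT !addnA -!mulnDr eb; congr (_ + _)%N; apply: eq_bigr => c /andP[ca cb].
      by have := ed c; rewrite /= !fold_expE (negbTE ca) (negbTE cb) => ->.
    have top_of l : mcoeff l F != 0 -> fold_exp a b l = fold_exp a b k' ->
        is_top F (hT T.+1) l.
      by move=> lF /string_wt e; split=> // j jF; rewrite e; apply: (proj2 k'top).
    exists k2; first exact: top_of.
    have k1deg := face k1 (top_of k1 k1F e1).
    have degE l : mdegs K l = (l b + \sum_(c in K | c != b) l c)%N.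
      by rewrite /mdegs (bigD1 b).
    have tail : (\sum_(c in K | c != b) k1 c = \sum_(c in K | c != b) k2 c)%N.
      apply: eq_bigr => c /andP[cK cb].
      have ca : c != a by apply: contraNneq aK => <-.
      have := congr1 (fun y : multinom n.+1 => y c) (etrans e1 (esym e2)).
      by rewrite /= !fold_expE (negbTE ca) (negbTE cb).
    rewrite (bigD1 (a, b)) /=; last first.
      by rewrite /crossed /= aK bK ba; move: hab; clear; lia.
    have -> : (\sum_(p | crossed p && (h p.1 <= h p.2 + T.+1) && (p != (a, b))) mu m p.1 p.2 =
        \sum_(p | crossed p && (h p.1 <= h p.2 + T)) mu m p.1 p.2)%N.
      apply: eq_bigl => -[x y]; rewrite /crossed /=.
      clear - aK bK ba hab sidon.
      apply/idP/idP => /andP[].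
        case/andP=> /and3P[-> -> yx] le ne; rewrite yx /=.
        have : (h x != h y + T.+1)%N; last by lia.
        by apply: contra ne => /eqP e; apply/eqP; apply: sidon => //; lia.
      case/and3P=> -> -> yx le; rewrite yx /=; apply/andP; split; first by lia.
      by apply/eqP => -[xa yb]; subst; lia.
    move: k1deg len kdeg; rewrite !degE tail; clear; lia.
  exists k' => //; apply: leq_trans (face _ k'top); move: kdeg; congr (_ + _ <= _)%N.
  apply: eq_bigl => -[x y] /=; case: (boolP (crossed (x, y))) => //= cxy.
  move: none; rewrite negb_exists => /forallP/(_ (x, y)); rewrite cxy /=; lia.
have [k [kF _] kdeg] := walk (\sum_c h c)%N.
exists k => //; apply: leq_trans kdeg; rewrite leq_add2l.
rewrite leq_eqVlt; apply/orP; left; apply/eqP; apply: eq_bigl => p.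
rewrite [in RHS](_ : (h p.1 <= _)%N = true) ?andbT //.
by rewrite (bigD1 p.1) //=; lia.
Qed.
End WallCrossing.

(** * Integer flows *)

Section Flow.
Variable I : finType.
Implicit Types (E s : seq (I * I)) (nu : I -> int) (K J : {set I}).

Definition cut E K : nat := count (fun e => (e.1 \in K) && (e.2 \notin K)) E.

Lemma cut_submod E J K : (cut E (J :|: K) + cut E (J :&: K) <= cut E J + cut E K)%N.
Proof.
elim: E => //= -[a b] E; rewrite /cut /= !inE.
by case: (a \in J); case: (a \in K); case: (b \in J); case: (b \in K) => /=; lia.
Qed.

(** Induction on the edges. If the edge (a,b) can be dropped without violating
    a cut condition, it carries no flow. Otherwise some J is tight only with
    this edge, so that J contains a and not b; one unit is then sent through
    the edge, and submodularity of the cut function, applied to J and K, gives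
    the remaining cut conditions. *)
Lemma unit_flow E nu : \sum_c nu c = 0 ->
  (forall K, \sum_(c in K) nu c <= (cut E K)%:Z) ->
  exists2 s, subseq s E & forall c,
    nu c = (count (fun e => e.1 == c) s)%:Z - (count (fun e => e.2 == c) s)%:Z.
Proof.
elim: E nu => [|[a b] E IH] nu nu0 cutE.
  exists [::] => // c; rewrite subrr; apply/eqP; rewrite eq_le; apply/andP; split.
    by have := cutE [set c]; rewrite big_set1.
  move: nu0; rewrite (bigD1 c) //= => /eqP; rewrite addr_eq0 => /eqP ->.
  have := cutE (~: [set c]); rewrite (eq_bigl (fun i => i != c)); last first.
    by move=> i; rewrite !inE.
  by rewrite oppr_ge0.
have capE K : cut ((a, b) :: E) K = ((a \in K) && (b \notin K) + cut E K)%N by [].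
have [ok|bad] := pselect (forall K, \sum_(c in K) nu c <= (cut E K)%:Z).
  have [s sE es] := IH nu nu0 ok; exists s => //.
  exact: subseq_trans sE (subseq_cons _ _).
have [J nJ] : exists J, ~ (\sum_(c in J) nu c <= (cut E J)%:Z) by apply/existsNP.
(* The demand that remains after one unit has used the edge (a,b). *)
pose nu' c := nu c - (c == a)%:Z + (c == b)%:Z.
have sum_delta K x : \sum_(c in K) ((c == x)%:Z : int) = (x \in K)%:Z.
  rewrite big_mkcond (bigD1 x) //= eqxx big1 ?addr0 => [|i /negbTE ->].
    by case: (x \in K).
  by case: (i \in K).
have nu'E K : \sum_(c in K) nu' c = \sum_(c in K) nu c - (a \in K)%:Z + (b \in K)%:Z.
  by rewrite big_split sumrB /= !sum_delta.
have [||s sE es] := IH nu'.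
- have sumT (f : I -> int) : \sum_(c in finset.setT) f c = \sum_c f c.
    by apply: eq_bigl => c; rewrite finset.in_setT.
  by have := nu'E finset.setT; rewrite !sumT nu0 !finset.in_setT => ->.
- move=> K; rewrite nu'E.
  have := cutE J; have := cutE K; have := cutE (J :|: K); have := cutE (J :&: K).
  have UI : \sum_(c in J :|: K) nu c + \sum_(c in J :&: K) nu c =
            \sum_(c in J) nu c + \sum_(c in K) nu c.
    rewrite !(big_mkcond (fun c => c \in _)) -!big_split; apply: eq_bigr => c _ /=.
    rewrite !inE; case: (c \in J); case: (c \in K); rewrite /= ?addr0 ?add0r //.
  have := cut_submod E J K; rewrite !capE !inE; move: nJ UI.
  move: (\sum_(c in J) nu c) (\sum_(c in K) nu c) (\sum_(c in J :|: K) nu c) (\sum_(c in J :&: K) nu c).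
  move: (cut E J) (cut E K) (cut E (J :|: K)) (cut E (J :&: K)).
  clear; move=> cJ cK cU cI sJ sK sU sI.
  case: (a \in J); case: (a \in K); case: (b \in J); case: (b \in K) => /=; lia.
exists ((a, b) :: s); first by rewrite /= eqxx.
move=> c; have := es c; rewrite /nu' /= ![c == _]eq_sym; lia.
Qed.

Lemma count_sum (T : finType) (P : pred T) (s : seq T) :
  count P s = (\sum_p count_mem p s * P p)%N.
Proof.
elim: s => [|x s IH] /=; first by rewrite big1.
rewrite (eq_bigr (fun p => (x == p) * P p + count_mem p s * P p)%N); last first.
  by move=> p _; rewrite mulnDl.
rewrite big_split /= -IH (bigD1 x) //= eqxx mul1n big1 ?addn0 // => p px.
by rewrite eq_sym (negbTE px).
Qed.

(** Capacities are replaced by parallel edges of capacity one. *)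
Lemma integer_flow (w : I * I -> nat) nu : \sum_c nu c = 0 ->
  (forall K, \sum_(c in K) nu c <=
     (\sum_(p | (p.1 \in K) && (p.2 \notin K)) w p)%:Z) ->
  exists2 l : I * I -> nat, (forall p, (l p <= w p)%N) &
    forall c, nu c = \sum_p ((l p * (p.1 == c))%:Z - (l p * (p.2 == c))%:Z).
Proof.
move=> nu0 cutw.
pose E := flatten [seq nseq (w p) p | p <- enum {: I * I}].
have countE (P : pred (I * I)) : count P E = (\sum_(p | P p) w p)%N.
  rewrite count_flatten sumnE big_map big_map big_enum /= [RHS]big_mkcond.
  by apply: eq_bigr => p _; rewrite count_nseq; case: (P p); rewrite ?mul1n ?mul0n.
have [|s sE es] := unit_flow (E := E) nu0.
  by move=> K; rewrite /cut countE.
exists (fun p => count_mem p s).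
  move=> p; apply: leq_trans (leq_count_subseq _ sE) _.
  by rewrite countE big_pred1_eq.
by move=> c; rewrite es !count_sum sumrB !(big_morph _ PoszD (erefl _)).
Qed.
End Flow.

(** * Products of factors of the operator *)

Section OperatorAlgebra.
Variables (n m : nat) (A : idomainType) (t : A) (kap W : 'I_n.+1 -> A).
Local Notation I := 'I_n.+1.
Local Notation P := (mpoly n.+1 A).
Local Notation Xv i := (mpolyX A (mnm1 i)).
Local Notation cst := (@mpolyC n.+1 A).
Local Notation is_D := (is_D m t kap W).
Local Notation qi := (qi m t W).

Hypothesis m_gt0 : (0 < m)%N.
Hypothesis t_neq0 : t != 0.
Hypothesis t_nroot : forall k, (0 < k)%N -> t ^+ k != 1.
Hypothesis kapE : forall c d, c != d ->
  kap c * (1 - t ^+ pp m d) = kap d * (1 - t ^+ pp m c).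

Lemma is_D_lin F G F' G' a : is_D F F' -> is_D G G' ->
  is_D (F - cst a * G) (F' - cst a * G').
Proof.
rewrite /is_D => eF eG; rewrite mulrBr mulrCA eF eG mulr_sumr -sumrB.
apply: eq_bigr => c _; rewrite /tau evB evM evC /=.
move: (cst _) (cst _) (num _ _ _ * _) (ev _ _ F) (ev _ _ G) => *; ring.
Qed.

Lemma is_D0 : is_D 0 0.
Proof.
by rewrite /is_D mulr0 /Dnum big1 // => c _; rewrite /tau ev0 !mulr0.
Qed.

(** The value 0 stands for the absence of a polynomial image. *)
Definition Dq (F : P) : P := xget 0 [set G | is_D F G].

Lemma DqP F : qi F -> is_D F (Dq F).
Proof.
move=> qF; have [G DG] := D_exists m_gt0 kapE qF.
exact: (xgetI 0 DG).
Qed.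

Lemma qi_Dq F : qi F -> qi (Dq F).
Proof. by move=> qF; apply: (qi_D m_gt0 kapE t_neq0 t_nroot qF (DqP qF)). Qed.

Definition step (e : A) (F : P) : P := Dq F - cst e * F.
Definition steps (s : seq A) (F : P) : P := foldr step F s.

Lemma qi_step e F : qi F -> qi (step e F).
Proof. move=> qF; exact: (qiB e (qi_Dq qF) qF). Qed.

Lemma qi_steps s F : qi F -> qi (steps s F).
Proof. move=> qF; elim: s => [|e s IH]; [exact: qF | exact: (qi_step e IH)]. Qed.

Lemma stepC a b F : qi F -> step a (step b F) = step b (step a F).
Proof.
move=> qF; have qD := qi_Dq qF.
have E e : Dq (step e F) = Dq (Dq F) - cst e * Dq F.
  by apply: (is_D_inj (DqP (qi_step e qF))); apply: is_D_lin; apply: DqP.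
have S e G : step e G = Dq G - cst e * G by [].
rewrite (S a (step b F)) (S b (step a F)) !E !S.
by move: (Dq (Dq F)) (Dq F) (cst a) (cst b) => *; ring.
Qed.

(** The factors commute on quasi-invariant polynomials, so any of them can be
    taken as the last one. *)
Lemma steps_front e s F : qi F -> e \in s ->
  exists2 G, qi G & steps s F = step e G.
Proof.
move=> qF; elim: s => //= a s IH; rewrite inE.
case: eqP => [<- _|_ /= /IH[G qG ->]].
  by exists (steps s F); [exact: qi_steps|].
by exists (step a G); [apply: qi_step | rewrite stepC].
Qed.

Lemma top_size (F : P) h k : is_top F h k -> (size (wpoly h F) <= (mwt h k).+1)%N.
Proof. by case=> _ ktop; apply/size_wpolyP. Qed.

Hypothesis eigval_inj : forall om om',
  eigval m t kap W om = eigval m t kap W om' -> om =1 om'.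

(** If k is among the heaviest monomials of G, its coefficient is multiplied
    by 0. Otherwise G has a heavier top k', whose coefficient is multiplied by
    a difference of distinct eigenvalues; so k' remains in the image and k is
    not a top. *)
Lemma step_top_neq h G k : injective h -> qi G -> 
  ~ is_top (step (eigval m t kap W (exponent m h k)) G) h k.
Proof.
move=> hI qG; set e := eigval _ _ _ _ _ => -[kD ktop].
have G0 : G != 0.
  apply: contraNneq kD => G0.
  have DG := DqP qG; rewrite {1}G0 in DG.
  by rewrite /step -(is_D_inj is_D0 DG) G0 mulr0 subr0 mcoeff0.
have [k' k'top] := top_exists h G0.
have sG := top_size k'top.
have coefD l : mwt h l = mwt h k' -> mcoeff l (step e G) =
    (eigval m t kap W (exponent m h l) - e) * mcoeff l G.
  move=> el; rewrite /step raddfB /= mul_mpolyC mcoeffZ mulrBl; congr (_ - _).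
  by apply: mcoeff_D_top => //; [apply: DqP | rewrite el].
have le_kk' : (mwt h k <= mwt h k')%N.
  have sD := size_wpoly_D (DqP qG) sG.
  move: kD; rewrite /step raddfB /= mul_mpolyC mcoeffZ => kD.
  have [DGk|] := eqVneq (mcoeff k (Dq G)) 0; last first.
    by move/size_wpolyP: sD; apply.
  apply: (proj2 k'top); apply: contraNneq kD => ->.
  by rewrite DGk mulr0 subr0.
move: le_kk'; rewrite leq_eqVlt => /orP[/eqP ekk'|lt].
  by move: kD; rewrite coefD // subrr mul0r eqxx.
have := ktop k'; rewrite leqNgt lt coefD // mulf_neq0 //.
  by move=> /(_ isT).
  rewrite subr_eq0; apply/eqP => /eigval_inj E.
  suff kk' : k' = k by rewrite kk' ltnn in lt.
  by apply/mnmP => c; apply: (@addIn (\sum_(d | (h c < h d)%N) mu m c d)); apply: E.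
exact: (proj1 k'top).
Qed.

Lemma steps_top h s F k : injective h -> qi F -> is_top (steps s F) h k ->
  eigval m t kap W (exponent m h k) \notin s.
Proof.
move=> hI qF ktop; apply/negP => es.
have [G qG eG] := steps_front qF es.
by rewrite eG in ktop; apply: (step_top_neq hI qG ktop).
Qed.

Lemma size_wpoly_steps h s F D : qi F -> (size (wpoly h F) <= D.+1)%N ->
  (size (wpoly h (steps s F)) <= D.+1)%N.
Proof.
move=> qF sF; elim: s => //= e s IH.
have qS := qi_steps s qF; have := size_wpoly_D (DqP qS) IH.
move/size_wpolyP: IH => IH /size_wpolyP HD; apply/size_wpolyP => k.
rewrite /step raddfB /= mul_mpolyC mcoeffZ => kS.
have [DGk|/HD //] := eqVneq (mcoeff k (Dq (steps s F))) 0.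
by apply: IH; apply: contraNneq kS => ->; rewrite DGk mulr0 subr0.
Qed.

Lemma mcoeff_steps_top h s F k : injective h -> qi F ->
  (size (wpoly h F) <= (mwt h k).+1)%N ->
  mcoeff k (steps s F) =
    (\prod_(e <- s) (eigval m t kap W (exponent m h k) - e)) * mcoeff k F.
Proof.
move=> hI qF sF; elim: s => [|e s IH] /=; first by rewrite big_nil mul1r.
rewrite big_cons -mulrA -IH mulrBl /step raddfB /= mul_mpolyC mcoeffZ.
congr (_ - _); apply: mcoeff_D_top => //; first exact: DqP (qi_steps s qF).
exact: size_wpoly_steps.
Qed.

(** Homogeneity as an identity between polynomials in one more variable, a
    form in which common factors can be cancelled; see homogP. *)
Definition homog (d : nat) (F : P) : Prop :=
  wpoly (fun=> 1%N) F = F%:P * 'X^d.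

Lemma homogP d F :
  homog d F <-> (forall k, mcoeff k F != 0 -> (\sum_c k c)%N = d).
Proof.
have wt k : mwt (fun=> 1%N) k = (\sum_(c < n.+1) k c)%N.
  by apply: eq_bigr => c _; rewrite mul1n.
split=> [hF k kF|H].
  have := mcoeff_wpoly (fun=> 1%N) F (mwt (fun=> 1%N) k) k.
  rewrite eqxx hF coefCM coefXn -wt; case: eqP => // _.
  by rewrite mulr0 mcoeff0 => e; rewrite -e eqxx in kF.
rewrite /homog; apply/polyP => j; apply/mpolyP => k.
rewrite mcoeff_wpoly coefCM coefXn wt.
have [k0|kF] := eqVneq (mcoeff k F) 0.
  by rewrite k0 if_same; case: (j == d); rewrite ?mulr1 ?mulr0 ?mcoeff0 ?k0.
by rewrite (H k kF) eq_sym; case: eqP; rewrite ?mulr1 ?mulr0 ?mcoeff0.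
Qed.

Lemma homogM d e F G : homog d F -> homog e G -> homog (d + e) (F * G).
Proof.
move=> hF hG; rewrite /homog wpolyM hF hG (rmorphM (@polyC P)) exprD /=.
move: (F%:P) (G%:P) => *; ring.
Qed.

Lemma homogC a : homog 0 (cst a).
Proof. by rewrite /homog /wpoly evC /= expr0 mulr1. Qed.

Lemma homog1 : homog 0 1.
Proof. by rewrite -mpolyC1; apply: homogC. Qed.

Lemma homogB d F G : homog d F -> homog d G -> homog d (F - G).
Proof.
by move=> hF hG; rewrite /homog wpolyB hF hG (rmorphB (@polyC P)) mulrBl.
Qed.

Lemma homog0 d : homog d 0.
Proof. by rewrite /homog /wpoly ev0 mul0r. Qed.

Lemma homogX i : homog 1 (Xv i).
Proof. by rewrite /homog /wpoly evX. Qed.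

Lemma homog_prod (T : Type) (r : seq T) (Q : pred T) (d : T -> nat) (F : T -> P) :
  (forall i, Q i -> homog (d i) (F i)) ->
  homog (\sum_(i <- r | Q i) d i) (\prod_(i <- r | Q i) F i).
Proof.
move=> H; elim/big_ind2: _ => [|d1 F1 d2 F2 h1 h2|i Qi].
- exact: homog1.
- exact: homogM h1 h2.
- exact: H.
Qed.

Lemma homog_sum (T : Type) (r : seq T) (Q : pred T) d (F : T -> P) :
  (forall i, Q i -> homog d (F i)) -> homog d (\sum_(i <- r | Q i) F i).
Proof.
move=> H; elim/big_ind: _ => [|F1 F2 h1 h2|i Qi]; [exact: homog0| |exact: H].
rewrite -[F2]opprK -[- F2]add0r; apply: homogB h1 _; exact: homogB (homog0 d) h2.
Qed.

Lemma homog_lin a b q : homog 1 (Xv a - cst q * Xv b).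
Proof. by apply: homogB; [|apply: (homogM (homogC q))]; apply: homogX. Qed.

(** The two sides of the equation defining the image are homogeneous, and disc
    can be cancelled. *)
Lemma homog_step e d F : qi F -> homog d F -> homog d (step e F).
Proof.
move=> qF hF; have DF := DqP qF.
pose deg (c : I) := (\sum_(x | x != c) 1)%N.
have hden c : homog (deg c) (den A c).
  apply: homog_prod => x _; have := homog_lin c x 1.
  by rewrite mpolyC1 mul1r.
have hnum c : homog (deg c) (num m t c).
  by apply: homog_prod => x _; apply: homog_lin.
have htau c : homog d (tau m t c F).
  apply/homogP => k; rewrite mcoeff_tau => kF.
  by apply: (proj1 (homogP d F) hF); apply: contraNneq kF => ->; rewrite mulr0.
have hR : homog (\sum_c deg c + d) (Dnum m t kap W F).
  apply: homog_sum => c _; rewrite -[(_ + d)%N]add0n; apply: (homogM (homogC _)).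
  apply: homogM (htau c); rewrite (bigD1 c) //=; apply: homogM (hnum c) _.
  by apply: homog_prod.
have hd : homog (\sum_c deg c) (disc n A) by apply: homog_prod.
apply: homogB; last by rewrite -[d]add0n; apply: homogM (homogC _) hF.
have nz : wpoly (fun=> 1%N) (disc n A) != 0.
  apply: contraNneq (disc_neq0 n A) => e0; apply/eqP/(wpoly_inj (h := fun=> 1%N)).
  by rewrite e0 /wpoly ev0.
apply: (mulfI nz); rewrite -wpolyM DF hR -DF (rmorphM (@polyC P)) /= hd exprD.
by move: (_%:P) (_%:P) => *; ring.
Qed.

Lemma homog_steps s d F : qi F -> homog d F -> homog d (steps s F).
Proof.
move=> qF hF; elim: s => [|e s IH]; [exact: hF | exact: (homog_step e (qi_steps s qF) IH)].
Qed.
End OperatorAlgebra.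

(** * Sums over pairs of indices and generic directions *)

Section Pairs.
Variables n m : nat.
Local Notation I := 'I_n.+1.

Definition lt_pair (p : I * I) : bool := (p.1 < p.2)%N.

Lemma big_lt_pair (T : Type) (idx : T) (op : Monoid.com_law idx) (f : I * I -> T) :
  \big[op/idx]_(p | lt_pair p) f p =
  \big[op/idx]_(c : I) \big[op/idx]_(a : I | (a < c)%N) f (a, c).
Proof.
rewrite pair_big_dep /= (reindex_inj (h := fun p : I * I => (p.2, p.1))) /=; last first.
  by move=> [a b] [c d] [-> ->].
by apply: eq_bigl => -[a b].
Qed.

Lemma sum_off_diag (g : I -> I -> nat) : (forall c, g c c = 0%N) ->
  (\sum_c \sum_d g c d = \sum_(p | lt_pair p) (g p.1 p.2 + g p.2 p.1))%N.
Proof.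
move=> g0; rewrite pair_big /= (bigID lt_pair) /= big_split /=; congr (_ + _)%N.
rewrite (bigID (fun p : I * I => p.1 == p.2)) /= big1 ?add0n; last first.
  by move=> [a b] /andP[_ /eqP /= ->].
rewrite (reindex_inj (h := fun p : I * I => (p.2, p.1))) /=; last first.
  by move=> [a b] [c d] [-> ->].
apply: eq_bigl => -[a b]; rewrite /lt_pair /= -val_eqE /=; lia.
Qed.

Lemma sum_mu_in (K : {set I}) (Q : rel I) : (forall c, Q c c = false) ->
  (\sum_(c in K) \sum_(d | Q c d) mu m c d =
   \sum_(p | lt_pair p) mu m p.1 p.2 *
     (((p.1 \in K) && Q p.1 p.2) + ((p.2 \in K) && Q p.2 p.1)))%N.
Proof.
move=> Q0; rewrite big_mkcond /=.
rewrite (eq_bigr (fun c => \sum_d if (c \in K) && Q c d then mu m c d else 0)%N); last first.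
  by move=> c _; case: (c \in K) => /=; [rewrite -big_mkcond | rewrite big1].
rewrite sum_off_diag; last by move=> c; rewrite Q0 andbF.
apply: eq_bigr => p _; rewrite (muC m p.2 p.1) mulnDr; congr (_ + _)%N.
  by case: ifP => _; rewrite ?muln1 ?muln0.
by case: ifP => _; rewrite ?muln1 ?muln0.
Qed.

(** The exponent of the monomial of Q which corresponds to the vector - rho:
    in increasing order of the indices, each factor of Q attached to a pair
    contributes its second variable. *)
Definition bot (c : I) : nat := (2 * \sum_(a : I | (a < c)%N) mu m a c)%N.
(** The value of exponent at every vertex of the zonotope of psi, in
    particular at bot for increasing weights. *)
Definition om0 (c : I) : nat :=
  (\sum_(d | d != c) mu m c d + \sum_(a : I | (a < c)%N) mu m a c)%N.

Lemma sum_lt_in (K : {set I}) : (\sum_(c in K) \sum_(a : I | (a < c)%N) mu m a c =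
   \sum_(p | lt_pair p) mu m p.1 p.2 * (p.2 \in K))%N.
Proof.
rewrite (eq_bigr (fun c : I => \sum_(a : I | (a < c)%N) mu m c a)%N); last first.
  by move=> c _; apply: eq_bigr => a _; rewrite muC.
rewrite (@sum_mu_in K (fun c a : I => (a < c)%N)) => [|c]; last by rewrite ltnn.
apply: eq_bigr => p; rewrite /lt_pair => lp; congr (_ * _)%N.
by rewrite lp andbT ltnNge (ltnW lp) andbF.
Qed.

Lemma sum_om0_in (K : {set I}) : (\sum_(c in K) om0 c =
   \sum_(p | lt_pair p) mu m p.1 p.2 * ((p.1 \in K) + (p.2 \in K).*2))%N.
Proof.
rewrite /om0 big_split /= sum_lt_in (@sum_mu_in K (fun c d => d != c)) => [|c]; last first.
  by rewrite eqxx.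
rewrite -big_split; apply: eq_bigr => p; rewrite /lt_pair => lp /=.
have ne : p.2 != p.1 by rewrite neq_ltn lp orbT.
by rewrite -mulnDr ne eq_sym ne !andbT -addnn addnA.
Qed.

Lemma sum_bot_in (K : {set I}) : (\sum_(c in K) bot c =
   \sum_(p | lt_pair p) mu m p.1 p.2 * (p.2 \in K).*2)%N.
Proof.
rewrite /bot -big_distrr /= sum_lt_in big_distrr /=; apply: eq_bigr => p _.
by rewrite -mul2n mulnCA.
Qed.

Lemma sum_crossed (K : {set I}) (h : I -> nat) :
  (\sum_(p | crossed K h p) mu m p.1 p.2 =
   \sum_(p | lt_pair p) mu m p.1 p.2 *
    ([&& p.1 \in K, p.2 \notin K & h p.1 < h p.2] +
     [&& p.2 \in K, p.1 \notin K & h p.2 < h p.1]))%N.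
Proof.
rewrite -(@sum_mu_in K (fun c d => (d \notin K) && (h c < h d)%N)); last first.
  by move=> c; rewrite ltnn andbF.
rewrite pair_big_dep /= (reindex_inj (h := fun p : I * I => (p.2, p.1))) /=; last first.
  by move=> [a b] [c d] [-> ->].
apply: eq_big => [[a b]|[a b] _]; last by rewrite /= muC.
by rewrite /crossed /= andbCA.
Qed.

(** The vectors nu of the theorem, in the coordinates of the f_c, together
    with 0. *)
Definition feasible (nu : I -> int) : Prop :=
  exists2 l : I * I -> nat,
    (forall p, (l p <= if lt_pair p then mu m p.1 p.2 else 0)%N) &
    forall c, nu c = \sum_p ((l p * (p.1 == c))%:Z - (l p * (p.2 == c))%:Z).

(** Network flow on the graph whose edges are the positive roots, with the
    multiplicities as capacities. *)
Lemma cut_feasible (x y : I -> nat) :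
  (\sum_c x c = \sum_c y c)%N ->
  (forall K : {set I}, (\sum_(c in K) x c <= \sum_(c in K) y c +
     \sum_(p | lt_pair p) mu m p.1 p.2 * ((p.1 \in K) && (p.2 \notin K)))%N) ->
  feasible (fun c => (x c)%:Z - (y c)%:Z).
Proof.
move=> exy cutK; apply: integer_flow.
  by rewrite sumrB -!(big_morph _ PoszD (erefl _)) exy subrr.
move=> K; rewrite sumrB -!(big_morph _ PoszD (erefl _)).
rewrite lerBlDl -PoszD lez_nat; apply: leq_trans (cutK K) _; rewrite leq_add2l.
rewrite [in leqRHS]big_mkcond [in leqLHS]big_mkcond; apply: leq_sum => p _.
by case: ifP => lp; case: ifP => _; rewrite ?muln1 ?muln0.
Qed.

Lemma pow2_sidon x y z w : (2 ^ x + 2 ^ y = 2 ^ z + 2 ^ w)%N ->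
  (x = z /\ y = w) \/ (x = w /\ y = z).
Proof.
have aux a b c d : (2 ^ a + 2 ^ b = 2 ^ c + 2 ^ d -> b <= a -> d <= c ->
    a = c /\ b = d)%N.
  have lt u v u' v' : (2 ^ u + 2 ^ v = 2 ^ u' + 2 ^ v' -> v <= u -> u < u' -> False)%N.
    move=> e vu uu'.
    have h1 : (2 ^ v <= 2 ^ u)%N by rewrite leq_exp2l.
    have h2 : (2 ^ u.+1 <= 2 ^ u')%N by rewrite leq_exp2l.
    have h3 : (0 < 2 ^ v')%N by rewrite expn_gt0.
    by rewrite expnS in h2; lia.
  move=> e ba dc; case: (ltngtP a c) => ac.
  - by case: (lt _ _ _ _ e ba ac).
  - by case: (lt _ _ _ _ (esym e) dc ac).
  split=> //; rewrite ac in e; move/addnI/eqP: e.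
  by rewrite eqn_exp2l // => /eqP.
move=> e; case: (leqP y x) => yx; case: (leqP w z) => wz.
- by left; apply: aux e yx wz.
- by rewrite [in RHS]addnC in e; right; apply: aux e yx (ltnW wz).
- by rewrite addnC in e; right; case: (aux _ _ _ _ e (ltnW yx) wz).
- rewrite addnC [in RHS]addnC in e; left.
  by case: (aux _ _ _ _ e (ltnW yx) (ltnW wz)).
Qed.

(** Powers of 2 form a Sidon set, as wall_crossing demands; for large M the
    weight compares degrees in K first. *)
Definition weightK (K : {set I}) (M : nat) (c : I) : nat := (2 ^ c + M * (c \in K))%N.

Lemma weightK_sum (K : {set I}) M (a b a' b' : I) : (2 ^ n.+2 <= M)%N ->
  (weightK K M a + weightK K M b = weightK K M a' + weightK K M b')%N ->
  (a = a' /\ b = b') \/ (a = b' /\ b = a').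
Proof.
move=> bM e.
have lt2 (c : I) : (2 ^ c < 2 ^ n.+1)%N by rewrite ltn_exp2l.
have : (2 ^ a + 2 ^ b = 2 ^ a' + 2 ^ b')%N.
  have := lt2 a; have := lt2 b; have := lt2 a'; have := lt2 b'; move: e bM.
  rewrite /weightK expnS.
  move: (2 ^ a)%N (2 ^ b)%N (2 ^ a')%N (2 ^ b')%N (2 ^ n.+1)%N; clear.
  case: (a \in K); case: (b \in K); case: (a' \in K); case: (b' \in K) => /=; nia.
by case/pow2_sidon => -[] /val_inj -> /val_inj ->; [left|right].
Qed.

Lemma weightK_inj (K : {set I}) M : (2 ^ n.+2 <= M)%N -> injective (weightK K M).
Proof.
move=> bM a b e; have := @weightK_sum K M a a b b bM.
by rewrite e => /(_ erefl) [][].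
Qed.

Lemma weightK_sidon (K : {set I}) M (a b a' b' : I) : (2 ^ n.+2 <= M)%N ->
  (weightK K M b < weightK K M a)%N ->
  (weightK K M a + weightK K M b' = weightK K M a' + weightK K M b)%N ->
  (a, b) = (a', b').
Proof.
move=> bM ba /(weightK_sum bM) [[-> ->] //|[ab _]].
by rewrite ab ltnn in ba.
Qed.
End Pairs.

(** * The polynomial part of Q *)

Section Seed.
Variables (n m : nat) (A : idomainType) (t : A) (W : 'I_n.+1 -> A).
Local Notation I := 'I_n.+1.
Local Notation P := (mpoly n.+1 A).
Local Notation Xv i := (mpolyX A (mnm1 i)).
Local Notation cst := (@mpolyC n.+1 A).
Local Notation lt_pair := (@lt_pair n).

Definition seed_factor (a b : I) (s : nat) : P :=
  (Xv a - cst (t ^+ (rr m a * s)) * Xv b) * (Xv b - cst (t ^+ (rr m b * s)) * Xv a).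

Definition seed : P :=
  \prod_(p | lt_pair p) \prod_(1 <= s < (mu m p.1 p.2).+1) seed_factor p.1 p.2 s.

Lemma ev_seed0 (B : idomainType) (phi : {rmorphism A -> B}) (u : I -> B) p s :
  lt_pair p -> (1 <= s <= mu m p.1 p.2)%N ->
  ev phi u (seed_factor p.1 p.2 s) = 0 -> ev phi u seed = 0.
Proof.
move=> lp sm e; rewrite /seed (bigD1 p) //= evM ev_prod (bigD1_seq s) /=.
- by rewrite e !mul0r.
- by rewrite mem_index_iota ltnS.
exact: iota_uniq.
Qed.

(** Each shifted point that occurs in a condition is a zero of a factor, so
    both sides vanish. *)
Lemma qi_seed : qi m t W seed.
Proof.
move=> c d s cd sm.
suff E x : (x == c) || (x == d) -> ev cst (shift m (cst t) x s (diag_pt A c d)) seed = 0.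
  by rewrite !E ?eqxx ?orbT // !mulr0.
move=> xcd; have dc : d != c by rewrite eq_sym.
have U : ev cst (shift m (cst t) x s (diag_pt A c d)) (seed_factor c d s) = 0.
  rewrite evM !evB !evM !evC !evX /shift /diag_pt !eqxx (negbTE dc) !rmorphXn /=.
  case/orP: xcd => /eqP ->; rewrite ?eqxx ?(negbTE cd) ?(negbTE dc).
    by rewrite subrr mul0r.
  by rewrite subrr mulr0.
case: (ltngtP c d) => [lt|lt|e]; last by case/eqP: cd; apply: val_inj.
  exact: (@ev_seed0 _ cst _ (c, d) s).
by apply: (@ev_seed0 _ cst _ (d, c) s) => //=; [rewrite muC | rewrite /seed_factor mulrC].
Qed.

Definition seed_deg (h : I -> nat) : nat :=
  (\sum_(p | lt_pair p) mu m p.1 p.2 * (maxn (h p.1) (h p.2)).*2)%N.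

Lemma top_seed h : top (seed_deg h) (wpoly h seed)
  (\prod_(p | lt_pair p) \prod_(1 <= s < (mu m p.1 p.2).+1)
    (lin_top h p.1 p.2 (t ^+ (rr m p.1 * s)) *
     lin_top h p.2 p.1 (t ^+ (rr m p.2 * s)))).
Proof.
rewrite /wpoly /seed ev_prod; apply: top_prod => p _.
rewrite ev_prod; set b := maxn _ _.
have -> : (mu m p.1 p.2 * b.*2 = \sum_(1 <= s < (mu m p.1 p.2).+1) (b + b))%N.
  by rewrite sum_nat_const_nat subn1 addnn.
apply: top_prod => s _; rewrite evM; apply: topM; first exact: top_lin.
by rewrite /b maxnC; apply: top_lin.
Qed.

Lemma mdegs_mwt (K : {set I}) k : mwt (fun c => c \in K : nat) k = mdegs K k.
Proof.
rewrite /mdegs [RHS]big_mkcond; apply: eq_bigr => c _.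
by case: (c \in K); rewrite ?mul1n ?mul0n.
Qed.

Lemma seed_degK (K : {set I}) : seed_deg (fun c => c \in K : nat) =
  (\sum_(p | lt_pair p) mu m p.1 p.2 * ((p.1 \in K) || (p.2 \in K)).*2)%N.
Proof.
by apply: eq_bigr => p _; case: (p.1 \in K); case: (p.2 \in K).
Qed.

Lemma homog_seed : homog (\sum_(p | lt_pair p) mu m p.1 p.2 * 2)%N seed.
Proof.
apply: homog_prod => p _.
have -> : (mu m p.1 p.2 * 2 = \sum_(1 <= s < (mu m p.1 p.2).+1) (1 + 1))%N.
  by rewrite sum_nat_const_nat subn1.
by apply: homog_prod => s _; apply: homogM; apply: homog_lin.
Qed.

Definition bot_mnm : multinom n.+1 := Multinom [tuple bot m c | c < n.+1].

Lemma bot_mnmE c : bot_mnm c = bot m c.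
Proof. exact: mnmE. Qed.

Definition seed_lead : A :=
  \prod_(p | lt_pair p) \prod_(1 <= s < (mu m p.1 p.2).+1) - t ^+ (rr m p.1 * s).

Lemma seed_deg_bot : seed_deg (@nat_of_ord _) = mwt (@nat_of_ord _) bot_mnm.
Proof.
rewrite /mwt (eq_bigr (fun c : I => \sum_(a : I | (a < c)%N) c * 2 * mu m a c)%N); last first.
  by move=> c _; rewrite bot_mnmE /bot mulnA big_distrr.
rewrite -(big_lt_pair _ (fun p : I * I => p.2 * 2 * mu m p.1 p.2)%N).
apply: eq_bigr => p; rewrite /lt_pair => lp.
by rewrite (maxn_idPr (ltnW lp)) mulnC muln2.
Qed.

Lemma mcoeff_seed_bot : mcoeff bot_mnm seed = seed_lead.
Proof.
have [_ /(congr1 (mcoeff bot_mnm))] := top_seed (@nat_of_ord _).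
rewrite seed_deg_bot mcoeff_wpoly eqxx => ->.
have -> : \prod_(p | lt_pair p) \prod_(1 <= s < (mu m p.1 p.2).+1)
    (lin_top (@nat_of_ord _) p.1 p.2 (t ^+ (rr m p.1 * s)) *
     lin_top (@nat_of_ord _) p.2 p.1 (t ^+ (rr m p.2 * s))) =
    cst seed_lead * mpolyX A bot_mnm.
  transitivity (\prod_(p | lt_pair p) \prod_(1 <= s < (mu m p.1 p.2).+1)
     (cst (- t ^+ (rr m p.1 * s)) * (Xv p.2 * Xv p.2))).
    apply: eq_bigr => p; rewrite /lt_pair => lp; apply: eq_bigr => s _.
    rewrite /lin_top lp ltnNge (ltnW lp) /= (rmorphN cst) /=; ring.
  transitivity (\prod_(p | lt_pair p)
     (cst (\prod_(1 <= s < (mu m p.1 p.2).+1) - t ^+ (rr m p.1 * s)) *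
      Xv p.2 ^+ (2 * mu m p.1 p.2))).
    apply: eq_bigr => p _; rewrite big_split /= (rmorph_prod cst); congr (_ * _).
    by rewrite prodr_const_nat subn1 /= exprM expr2.
  rewrite big_split /= -(rmorph_prod cst); congr (_ * _).
  rewrite (big_lt_pair _ (fun p : I * I => Xv p.2 ^+ (2 * mu m p.1 p.2))).
  rewrite mpolyXE_id; apply: eq_bigr => c _.
  by rewrite bot_mnmE /bot big_distrr expr_sum.
by rewrite mul_mpolyC mcoeffZ mcoeffX eqxx mulr1.
Qed.
End Seed.

(** * The eigenfunction over a ring with distinct eigenvalues *)

Section GenericEigenfunction.
Variables (n m : nat) (A : idomainType) (t : A) (kap W : 'I_n.+1 -> A).
Local Notation I := 'I_n.+1.
Local Notation P := (mpoly n.+1 A).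
Local Notation cst := (@mpolyC n.+1 A).
Local Notation lt_pair := (@lt_pair n).
Local Notation qi := (qi m t W).
Local Notation eigval := (eigval m t kap W).
Local Notation steps := (steps m t kap W).
Local Notation seed := (seed n m t).

Hypothesis m_gt0 : (0 < m)%N.
Hypothesis t_neq0 : t != 0.
Hypothesis t_nroot : forall k, (0 < k)%N -> t ^+ k != 1.
Hypothesis kapE : forall c d, c != d ->
  kap c * (1 - t ^+ pp m d) = kap d * (1 - t ^+ pp m c).
Hypothesis W_neq0 : forall c, W c != 0.
Hypothesis W_generic : forall (c d : I) i j, c != d -> W c * t ^+ i != W d * t ^+ j.
Hypothesis eigval_inj : forall om om', eigval om = eigval om' -> om =1 om'.

Let sum_setT (x : I -> nat) : (\sum_c x c = \sum_(c in finset.setT) x c)%N.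
Proof. by apply: eq_bigl => c; rewrite finset.in_setT. Qed.

Let cmp_dominant (x y u v M : nat) :
  (u < M)%N -> (v + M * x <= u + M * y)%N -> (x <= y)%N.
Proof. clear; nia. Qed.

Let qseed : qi seed.
Proof. exact: (@qi_seed n m A t W). Qed.

Let qsteps s : qi (steps s seed).
Proof. exact: (qi_steps m_gt0 t_neq0 t_nroot kapE s qseed). Qed.

(** The half-spaces of twice the zonotope are indexed by sets of indices, the
    facet normals of a zonotope of type A being indicators. *)
Definition in_double_zonotope (F : P) : Prop :=
  (forall (K : {set I}) k, mcoeff k F != 0 ->
     (mdegs K k <= seed_deg m (fun c => c \in K : nat))%N) /\
  homog (\sum_(p | lt_pair p) mu m p.1 p.2 * 2)%N F.

Lemma in_double_zonotope_steps s : in_double_zonotope (steps s seed).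
Proof.
split; last exact: (homog_steps m_gt0 t_neq0 t_nroot kapE s qseed (homog_seed n m t)).
move=> K k kF; rewrite -mdegs_mwt; move: k kF; apply/size_wpolyP.
apply: (size_wpoly_steps m_gt0 t_neq0 t_nroot kapE s qseed).
exact: (proj1 (top_seed m t _)).
Qed.

(** Crossing the walls between h and the indicator of K, F reaches a monomial
    whose degree in K exceeds that of k by the multiplicities of the roots
    crossed. The bound by the double zonotope for that monomial is the cut
    condition for k relative to the vertex of the zonotope in direction h. *)
Lemma top_feasible F h k : qi F -> in_double_zonotope F -> injective h ->
  (forall a b a' b' : I, (h b < h a)%N -> (h b' < h a')%N ->
     (h a + h b' = h a' + h b)%N -> (a, b) = (a', b')) ->
  is_top F h k ->
  feasible m (fun c => (exponent m h k c)%:Z - (om0 m c)%:Z).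
Proof.
move=> qF [Fdeg Fhom] hI hS ktop.
have cmp p : lt_pair p -> ((h p.1 < h p.2) + (h p.2 < h p.1) = 1)%N.
  rewrite /lt_pair => lp; have : h p.1 != h p.2.
    by rewrite (inj_eq hI) neq_ltn lp.
  by case: ltngtP.
have sumE (K : {set I}) : (\sum_(c in K) exponent m h k c = mdegs K k +
    \sum_(p | lt_pair p) mu m p.1 p.2 * (((p.1 \in K) && (h p.1 < h p.2)) +
      ((p.2 \in K) && (h p.2 < h p.1))))%N.
  rewrite big_split /= (@sum_mu_in _ _ K (fun c d => h c < h d)%N) // => c.
  by rewrite ltnn.
apply: cut_feasible => [|K].
  rewrite !sum_setT sumE sum_om0_in /mdegs -sum_setT.
  rewrite (proj1 (homogP _ F) Fhom k (proj1 ktop)) -big_split.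
  apply: eq_bigr => p lp; rewrite !finset.in_setT /= -mulnDr cmp //.
have [k' k'F k'deg] := wall_crossing t_neq0 t_nroot W_neq0 W_generic
  K qF hS ktop.
have := leq_trans k'deg (Fdeg K k' k'F); rewrite seed_degK sumE sum_om0_in sum_crossed.
move: (mdegs K k) => x le.
rewrite -(leq_add2r (\sum_(p | lt_pair p) mu m p.1 p.2 *
    ([&& p.1 \in K, p.2 \notin K & h p.1 < h p.2] +
     [&& p.2 \in K, p.1 \notin K & h p.2 < h p.1])))%N.
rewrite addnAC; apply: leq_trans (leq_add le (leqnn _)) _.
rewrite -!big_split /=; apply: leq_sum => p lp; rewrite -!mulnDr leq_mul2l; apply/orP; right.
have := cmp p lp.
by case: (p.1 \in K); case: (p.2 \in K); case: (h p.1 < h p.2)%N; case: (h p.2 < h p.1)%N.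
Qed.

Variable s : seq A.
Hypothesis s_feasible : forall om : I -> nat,
  feasible m (fun c => (om c)%:Z - (om0 m c)%:Z) ->
  om =1 om0 m \/ eigval om \in s.
Local Notation Psi := (steps s seed).

Lemma qi_Psi : qi Psi.
Proof. exact: qsteps. Qed.

(** For increasing weights no monomial of Q or of its images is heavier than
    bot_mnm, so each factor multiplies the coefficient there by a scalar. *)
Lemma mcoeff_Psi_bot :
  mcoeff (bot_mnm n m) Psi = (\prod_(e <- s) (eigval (om0 m) - e)) * seed_lead n m t.
Proof.
rewrite (mcoeff_steps_top m_gt0 t_neq0 t_nroot kapE (h := @nat_of_ord _)).
- rewrite mcoeff_seed_bot; congr (_ * _); apply: eq_bigr => e _; congr (_ - _).
  apply: eq_bigr => c _; congr (_ * t ^+ (_ * _)).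
  rewrite /exponent bot_mnmE /bot /om0 [in RHS](bigID (fun d : I => (c < d)%N)) /=.
  have -> : (\sum_(d | (d != c) && (c < d)) mu m c d = \sum_(d : I | c < d) mu m c d)%N.
    by apply: eq_bigl => d; rewrite -val_eqE /=; lia.
  have -> : (\sum_(d | (d != c) && ~~ (c < d)) mu m c d = \sum_(d : I | d < c) mu m d c)%N.
    by apply: eq_big => d; [rewrite -val_eqE /=; lia | rewrite muC].
  by rewrite mul2n -addnn addnC addnA.
- exact: val_inj.
- exact: qseed.
by rewrite -seed_deg_bot; apply: (proj1 (top_seed m t _)).
Qed.

(** If the difference were not 0, it would have a top in a generic direction.
    Its exponent would be feasible, so its eigenvalue would be that of one of
    the factors already applied, contrary to steps_top. *)
Lemma Dq_Psi : Dq m t kap W Psi = cst (eigval (om0 m)) * Psi.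
Proof.
apply/eqP; rewrite -subr_eq0; apply/negPn/negP => G0.
have zon := in_double_zonotope_steps (eigval (om0 m) :: s).
have qG := qsteps (eigval (om0 m) :: s).
(* Any generic direction serves here. *)
pose h := weightK (finset.set0 : {set I}) (2 ^ n.+2).
have hI : injective h by apply: weightK_inj.
have [k ktop] := top_exists h G0.
have feas := top_feasible qG zon hI (fun a b a' b' ba _ e => weightK_sidon (leqnn _) ba e) ktop.
have := steps_top m_gt0 t_neq0 t_nroot kapE eigval_inj hI qseed
  (ktop : is_top (steps (eigval (om0 m) :: s) seed) h k).
rewrite inE negb_or; case: (s_feasible feas) => [e|->]; last by rewrite andbF.
suff -> : eigval (exponent m h k) = eigval (om0 m) by rewrite eqxx.
by apply: eq_bigr => c _; rewrite e.
Qed.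

(** All tops of Psi in generic directions have exponent om0, the others having
    been removed. In a direction where the degree in K dominates, the top
    bounds the degree in K of every monomial by that of the zonotope, which is
    the cut condition. *)
Lemma supp_Psi k : mcoeff k Psi != 0 ->
  feasible m (fun c => (k c)%:Z - (bot m c)%:Z).
Proof.
move=> kPsi; have [Pdeg Phom] := in_double_zonotope_steps s.
pose D := (\sum_(p | lt_pair p) mu m p.1 p.2 * 2)%N.
have degE := proj1 (homogP _ _) Phom.
apply: cut_feasible => [|K].
  rewrite (degE k kPsi) sum_setT sum_bot_in; apply: eq_bigr => p _.
  by rewrite finset.in_setT.
(* The weights 2 ^ c contribute less than M to the weight of a monomial of
   degree D, so a difference in the degree in K prevails. *)
pose M := (2 ^ n.+2 * D.+1)%N.
have bM : (2 ^ n.+2 <= M)%N by rewrite leq_pmulr.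
pose h := weightK K M.
have hI : injective h by apply: weightK_inj.
have P0 : Psi != 0 by apply: contraNneq kPsi => ->; rewrite mcoeff0.
have [k' k'top] := top_exists h P0.
have feas := top_feasible qi_Psi (conj Pdeg Phom) hI
  (fun a b a' b' ba _ e => weightK_sidon bM ba e) k'top.
have k'om : exponent m h k' =1 om0 m.
  have := steps_top m_gt0 t_neq0 t_nroot kapE eigval_inj hI qseed k'top.
  by case: (s_feasible feas) => [//|->].
have mwtE l : mwt h l = (\sum_(c < n.+1) 2 ^ c * l c + M * mdegs K l)%N.
  rewrite /mwt /h /weightK (eq_bigr (fun c : I => 2 ^ c * l c + M * ((c \in K) * l c))%N).
    rewrite big_split /= -big_distrr /=; congr (_ + _ * _)%N.
    rewrite /mdegs [RHS]big_mkcond; apply: eq_bigr => c _.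
    by case: (c \in K); rewrite ?mul1n ?mul0n.
  by move=> c _; rewrite mulnDl mulnA.
have kk' : (mdegs K k <= mdegs K k')%N.
  have := proj2 k'top k kPsi; rewrite !mwtE.
  have small : (\sum_(c < n.+1) 2 ^ c * k' c < M)%N.
    apply: (@leq_ltn_trans (\sum_(c < n.+1) 2 ^ n.+2 * k' c)%N).
      apply: leq_sum => c _; rewrite leq_mul2r leq_exp2l // orbC.
      by rewrite ltnW // ltnS ltnW.
    rewrite -big_distrr /= (degE k' (proj1 k'top)) -/D /M ltn_mul2l ltnSn andbT.
    by rewrite expn_gt0.
  exact: cmp_dominant small.
apply: (leq_trans kk').
have : (\sum_(c in K) exponent m h k' c = \sum_(c in K) om0 m c)%N.
  by apply: eq_bigr => c _; apply: k'om.
rewrite big_split /= (@sum_mu_in _ _ K (fun c d => h c < h d)%N); last by move=> c; rewrite ltnn.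
rewrite sum_om0_in sum_bot_in -/(mdegs K k') => e.
rewrite -(leq_add2r (\sum_(p | lt_pair p) mu m p.1 p.2 *
   (((p.1 \in K) && (h p.1 < h p.2)) + ((p.2 \in K) && (h p.2 < h p.1)))))%N e.
rewrite -!big_split /=; apply: leq_sum => p lp; rewrite -!mulnDr leq_mul2l; apply/orP; right.
have : h p.1 != h p.2 by move: lp; rewrite /lt_pair (inj_eq hI) neq_ltn => ->.
by case: (p.1 \in K); case: (p.2 \in K); case: (ltngtP (h p.1) (h p.2)).
Qed.
End GenericEigenfunction.

(** * Exponentials, coordinates and roots *)

Section Exponentials.
Variables (R : realType) (logq : R[i]).
Local Notation C := R[i].
Local Notation qpow := (qpow logq).
Local Notation qbr := (qbr logq).

Lemma expCD (a b : C) : expC (a + b) = expC a * expC b.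
Proof.
case: a => a1 a2; case: b => b1 b2; rewrite /expC /= expRD cosD sinD.
apply/eqP; rewrite eq_complex /=; apply/andP; split; apply/eqP; ring.
Qed.

Lemma expC0 : expC (0 : C) = 1.
Proof. by rewrite /expC /= expR0 cos0 sin0 mulr1 mulr0. Qed.

Lemma qpowD a b : qpow (a + b) = qpow a * qpow b.
Proof. by rewrite /Defs.qpow mulrDl expCD. Qed.

Lemma qpow0 : qpow 0 = 1.
Proof. by rewrite /Defs.qpow mul0r expC0. Qed.

Lemma qpow_neq0 a : qpow a != 0.
Proof.
apply/eqP => e; have := qpowD a (- a); rewrite subrr qpow0 e mul0r => /eqP.
by rewrite oner_eq0.
Qed.

Lemma qpowN a : qpow (- a) = (qpow a)^-1.
Proof.
apply: (mulfI (qpow_neq0 a)); rewrite -qpowD subrr qpow0.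
by rewrite mulfV ?qpow_neq0.
Qed.

Lemma qpowB a b : qpow (a - b) = qpow a / qpow b.
Proof. by rewrite qpowD qpowN. Qed.

Lemma qpowMn k a : qpow (k%:R * a) = qpow a ^+ k.
Proof.
by elim: k => [|k IH]; rewrite ?mul0r ?qpow0 ?expr0 // -natr1 mulrDl mul1r qpowD IH exprSr.
Qed.

Lemma qpow1 : qpow 1 = expC logq.
Proof. by rewrite /Defs.qpow mul1r. Qed.

Lemma qpow_sum (T : Type) (r : seq T) (Q : pred T) (F : T -> C) :
  qpow (\sum_(i <- r | Q i) F i) = \prod_(i <- r | Q i) qpow (F i).
Proof. exact: (big_morph qpow qpowD qpow0). Qed.

Lemma qbrE a : qbr a = qpow (- a) * (qpow (2 * a) - 1).
Proof.
rewrite /Defs.qbr mulrBr mulr1 -qpowD; congr (qpow _ - _); ring.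
Qed.

Lemma qbr_eq0 a : (qbr a == 0) = (qpow (2 * a) == 1).
Proof. by rewrite qbrE mulf_eq0 (negbTE (qpow_neq0 _)) /= subr_eq0. Qed.

Lemma qbr_mul u v : qbr (u + v) * qbr (u - v) =
  (qpow (2 * u))^-1 * ((qpow (2 * u) - qpow (2 * v)) * (qpow (2 * u) - qpow (- (2 * v)))).
Proof.
rewrite !qbrE !mulrDr !mulrN !qpowB !qpowD !opprD !opprK !qpowD !qpowN.
have -> : qpow (2 * u) = qpow u * qpow u by rewrite -qpowD; congr qpow; ring.
have -> : qpow (2 * v) = qpow v * qpow v by rewrite -qpowD; congr qpow; ring.
by field; rewrite !qpow_neq0.
Qed.

(** Brings a quotient of brackets to the form of the coefficients of dcoef. *)
Lemma qbr_ratio a b X Y : Y != 0 -> qpow (2 * b) = X / Y -> X != Y ->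
  qbr a / qbr b = qpow (a - b) * ((X - qpow (2 * (b - a)) * Y) / (X - Y)).
Proof.
move=> Y0 eb XY; have ba : qpow (2 * a) = X / (qpow (2 * (b - a)) * Y).
  apply: (mulfI (qpow_neq0 (2 * (b - a)))); rewrite -qpowD.
  have -> : 2 * (b - a) + 2 * a = 2 * b by ring.
  by rewrite eb; field; rewrite Y0 qpow_neq0.
have e : qpow (2 * (b - a)) = qpow (b - a) * qpow (b - a).
  by rewrite -qpowD; congr qpow; ring.
have e2 : qpow (a - b) = (qpow (b - a))^-1 by rewrite -qpowN opprB.
rewrite !qbrE invfM mulrACA -qpowN opprK -qpowD addrC eb ba e2 e.
by field; rewrite qpow_neq0 Y0 subr_eq0 XY.
Qed.

End Exponentials.

Section Coordinates.
Variables (R : realType) (n m : nat).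
Hypothesis m_gt0 : (0 < m)%N.
Local Notation C := R[i].
Local Notation V := 'rV[C]_n.+1.
Local Notation I := 'I_n.+1.
Local Notation sqrtm := (sqrtm R m).

Definition scal (c : I) : C := if c == ord_max then sqrtm else 1.
(** The vectors by which the operator shifts, orthogonal but of unequal
    length. *)
Definition fv (c : I) : V := scal c *: delta_mx 0 c.
Definition yc (z : V) (c : I) : C := scal c * z 0 c.

Lemma fst_idx_neq_max (i : 'I_n) : (fst_idx i == ord_max :> I) = false.
Proof. by rewrite -val_eqE /= ltn_eqF. Qed.

Lemma fst_idx_inj : injective (@fst_idx n).
Proof. by move=> i j /(congr1 val) /= /val_inj. Qed.

Lemma fv_fst i : fv (fst_idx i) = evec R i.
Proof. by rewrite /fv /scal fst_idx_neq_max scale1r. Qed.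

Lemma fv_max : fv ord_max = slast R n m.
Proof. by rewrite /fv /scal eqxx. Qed.

Lemma yc_fst z i : yc z (fst_idx i) = crd z i.
Proof. by rewrite /yc /scal fst_idx_neq_max mul1r. Qed.

Lemma yc_max z : yc z ord_max = scrd m z.
Proof. by rewrite /yc /scal eqxx. Qed.

Lemma sqrtm_sq : sqrtm * sqrtm = m%:R.
Proof.
rewrite /Defs.sqrtm -rmorphM -expr2 sqr_sqrtr ?ler0n //.
by rewrite rmorph_nat.
Qed.

Lemma sqrtm_neq0 : sqrtm != 0.
Proof.
apply/eqP => e; have := sqrtm_sq; rewrite e mul0r => /esym/eqP.
by rewrite pnatr_eq0 eqn0Ngt m_gt0.
Qed.

Lemma scal_neq0 c : scal c != 0.
Proof. by rewrite /scal; case: ifP => _; rewrite ?sqrtm_neq0 ?oner_eq0. Qed.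

Lemma scal_sq c : scal c * scal c = (rr m c)%:R.
Proof. by rewrite /scal /rr; case: ifP => _; rewrite ?sqrtm_sq ?mulr1. Qed.

Lemma ycD x z c : yc (x + z) c = yc x c + yc z c.
Proof. by rewrite /yc mxE mulrDr. Qed.

Lemma ycB x z c : yc (x - z) c = yc x c - yc z c.
Proof. by rewrite /yc !mxE mulrBr. Qed.

Lemma ycZ a z c : yc (a *: z) c = a * yc z c.
Proof. by rewrite /yc mxE mulrCA. Qed.

Lemma yc_fv c d : yc (fv c) d = if d == c then (rr m c)%:R else 0.
Proof.
rewrite /fv /yc !mxE eqxx /=; case: eqP => [->|_]; last by rewrite mulr0 mulr0.
by rewrite mulr1 scal_sq.
Qed.

Lemma yc_inj x z : yc x =1 yc z -> x = z.
Proof.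
move=> e; apply/rowP => c; have := e c; by rewrite /yc => /(mulfI (scal_neq0 c)).
Qed.

Lemma dotpDr (x u v : V) : dotp x (u + v) = dotp x u + dotp x v.
Proof. by rewrite /dotp -big_split; apply: eq_bigr => i _; rewrite mxE mulrDr. Qed.

Lemma dotpDl (x u v : V) : dotp (u + v) x = dotp u x + dotp v x.
Proof. by rewrite /dotp -big_split; apply: eq_bigr => i _; rewrite mxE mulrDl. Qed.

Lemma dotpBl (x u v : V) : dotp (u - v) x = dotp u x - dotp v x.
Proof. by rewrite /dotp -sumrB; apply: eq_bigr => i _; rewrite !mxE mulrBl. Qed.

Lemma dotpZl a (u v : V) : dotp (a *: u) v = a * dotp u v.
Proof. by rewrite /dotp mulr_sumr; apply: eq_bigr => i _; rewrite mxE mulrA. Qed.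

Lemma dotp_suml (T : Type) (r : seq T) (Q : pred T) (F : T -> V) v :
  dotp (\sum_(i <- r | Q i) F i) v = \sum_(i <- r | Q i) dotp (F i) v.
Proof.
apply: (big_morph (fun u => dotp u v)) => [u w|]; first exact: dotpDl.
by rewrite /dotp big1 // => i _; rewrite mxE mul0r.
Qed.

Lemma dotp_fvr x c : dotp x (fv c) = yc x c.
Proof.
rewrite /dotp (bigD1 c) //= big1 => [|i ic]; last first.
  by rewrite /fv !mxE eqxx (negbTE ic) !mulr0.
by rewrite /fv /yc !mxE !eqxx mulr1 addr0 mulrC.
Qed.

Lemma dotp_fvl x c : dotp (fv c) x = yc x c.
Proof. by rewrite -dotp_fvr; apply: eq_bigr => i _; rewrite mulrC. Qed.

Definition vec (a : I -> C) : V := \sum_c a c *: fv c.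

Lemma dotp_vec a z : dotp (vec a) z = \sum_c a c * yc z c.
Proof. by rewrite dotp_suml; apply: eq_bigr => c _; rewrite dotpZl dotp_fvl. Qed.

Lemma yc_vec a c : yc (vec a) c = a c * (rr m c)%:R.
Proof.
rewrite -dotp_fvr dotp_vec (bigD1 c) //= yc_fv eqxx big1 ?addr0 // => d dc.
by rewrite yc_fv (negbTE dc) mulr0.
Qed.

Lemma rr_gt0 (c : I) : (0 < rr m c)%N.
Proof. by rewrite /rr; case: ifP. Qed.

Lemma vec_inj a b : vec a = vec b -> a =1 b.
Proof.
move=> e c; have := yc_vec a c; rewrite e yc_vec => /esym; apply: mulIf.
by rewrite pnatr_eq0 -lt0n rr_gt0.
Qed.

Lemma eq_vec a b : a =1 b -> vec a = vec b.
Proof. by move=> e; apply: eq_bigr => c _; rewrite e. Qed.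

Lemma vecD a b : vec (fun c => a c + b c) = vec a + vec b.
Proof. by rewrite -big_split; apply: eq_bigr => c _; rewrite scalerDl. Qed.

Lemma vecZ x a : vec (fun c => x * a c) = x *: vec a.
Proof. by rewrite scaler_sumr; apply: eq_bigr => c _; rewrite scalerA. Qed.

Lemma vec_lattice (a : I -> int) : lattice R n m (vec (fun c => (a c)%:~R)).
Proof.
exists (fun i => a (fst_idx i)), (a ord_max); rewrite /vec big_ord_recr /=.
rewrite fv_max; congr (_ + _); apply: eq_bigr => i _.
by rewrite -fv_fst.
Qed.

(** With the f_c all positive roots, deformed or not, are differences f_a -
    f_b with a < b. *)
Definition ends (a : posroot n) : I * I :=
  match a with
  | inl p => (fst_idx (val p).1, fst_idx (val p).2)
  | inr i => (fst_idx i, ord_max)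
  end.

Lemma ends_inj : injective ends.
Proof.
move=> [[[a b] /= ab]|i] [[[c d] /= cd]|j] //= [].
- by move=> /val_inj e1 /val_inj e2; subst; congr inl; apply: val_inj.
- by move=> _ e; have := ltn_ord b; rewrite e ltnn.
- by move=> _ e; have := ltn_ord d; rewrite -e ltnn.
- by move=> /val_inj ->.
Qed.

Lemma ends_lt a : lt_pair (ends a).
Proof. by case: a => [[[a b] /= ab]|i] //=; rewrite /lt_pair /=. Qed.

Lemma ends_onto p : lt_pair p -> exists a, ends a = p.
Proof.
case: p => a b; rewrite /lt_pair /= => ab.
have an : (a < n)%N by apply: leq_trans ab _; rewrite -ltnS.
have [bn|bn] := ltnP b n; last first.
  exists (inr (Ordinal an)); congr (_, _); apply: val_inj => //=.
  by apply/eqP; rewrite eqn_leq bn -ltnS ltn_ord.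
exists (inl (exist (fun p : 'I_n * 'I_n => (p.1 < p.2)%N) (Ordinal an, Ordinal bn) ab)).
by congr (_, _); apply: val_inj.
Qed.

Lemma big_posroot (T : Type) (idx : T) (op : Monoid.com_law idx) (f : I * I -> T) :
  \big[op/idx]_(a : posroot n) f (ends a) = \big[op/idx]_(p | lt_pair p) f p.
Proof.
rewrite -[LHS](big_imset (h := ends) (A := predT) f) /=; last by move=> x y _ _; apply: ends_inj.
apply: eq_bigl => p; apply/imsetP/idP => [[a _ ->]|/ends_onto[a <-]].
  exact: ends_lt.
by exists a.
Qed.

Lemma mult_ends a : mult m a = mu m (ends a).1 (ends a).2.
Proof. by case: a => [p|i]; rewrite /mu /= !fst_idx_neq_max // eqxx. Qed.

Lemma root_vec_ends a : root_vec R m a = fv (ends a).1 - fv (ends a).2.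
Proof. by case: a => [p|i] /=; rewrite !fv_fst // fv_max. Qed.

End Coordinates.

(** * Symmetric form of the deformed operator *)

Section Link.
Variables (R : realType) (n m : nat) (logq : R[i]).
Local Notation C := R[i].
Local Notation V := 'rV[C]_n.+1.
Local Notation I := 'I_n.+1.
Local Notation qpow := (qpow logq).
Local Notation qbr := (qbr logq).
Local Notation yc := (yc m).
Local Notation fv := (@fv R n m).
Local Notation M := (m%:R : C).
Hypothesis m_gt0 : (0 < m)%N.
Hypothesis q_nroot : forall k, (0 < k)%N -> qpow 1 ^+ k != 1.

Definition tq : C := qpow 2.
(** The factor that moves the hyperplanes of the deformed roots, which are
    displaced by 1 - m, to Z_i = Z_max. *)
Definition gam (c : I) : C := if c == ord_max then qpow (M - 1) else 1.
Definition Zc (z : V) (c : I) : C := gam c * qpow (2 * yc z c).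
(** Proportional to 1 - t ^+ pp m c, as the cancellation of residues demands.
    *)
Definition kapC (c : I) : C := if c == ord_max then 1 else \sum_(k < m) tq ^+ k.
Definition K0 : C := qbr 1 / qbr M * qpow (- M) ^+ n.

Lemma tqE : tq = qpow 1 ^+ 2.
Proof. by rewrite -qpowMn mulr1. Qed.

Lemma tqX k : tq ^+ k = qpow (2 * k%:R).
Proof. by rewrite mulrC -qpowMn. Qed.

Lemma tq_neq0 : tq != 0. Proof. exact: qpow_neq0. Qed.

Lemma tq_nroot k : (0 < k)%N -> tq ^+ k != 1.
Proof. by move=> k0; rewrite tqE -exprM q_nroot // muln_gt0. Qed.

Lemma qbrn_neq0 k : (0 < k)%N -> qbr k%:R != 0.
Proof. by move=> k0; rewrite qbr_eq0 -tqX tq_nroot. Qed.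

Lemma qbr1_neq0 : qbr 1 != 0.
Proof. exact: (@qbrn_neq0 1). Qed.

Lemma K0_neq0 : K0 != 0.
Proof.
by rewrite mulf_neq0 ?expf_neq0 ?qpow_neq0 // mulf_neq0 ?qbr1_neq0 // invr_eq0 qbrn_neq0.
Qed.

Lemma geo : (\sum_(k < m) tq ^+ k) * (1 - tq) = 1 - tq ^+ m.
Proof. by rewrite mulrC -opprB mulNr -subrX1 opprB. Qed.

Lemma kapC_neq0 c : kapC c != 0.
Proof.
rewrite /kapC; case: ifP => _; first exact: oner_neq0.
apply/eqP => e; have := geo; rewrite e mul0r => /esym/eqP; rewrite subr_eq0 eq_sym.
by rewrite (negbTE (tq_nroot m_gt0)).
Qed.

Lemma kapCE c d : c != d -> kapC c * (1 - tq ^+ pp m d) = kapC d * (1 - tq ^+ pp m c).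
Proof.
rewrite /kapC /pp => cd; case: (eqVneq c ord_max) => [ec|_]; case: (eqVneq d ord_max) => [ed|_] //.
- by rewrite expr1 geo mul1r.
- by rewrite expr1 geo mul1r.
Qed.

Lemma gam_neq0 c : gam c != 0.
Proof. by rewrite /gam; case: ifP => _; rewrite ?qpow_neq0 ?oner_eq0. Qed.

Lemma Zc_neq0 z c : Zc z c != 0.
Proof. by rewrite mulf_neq0 ?gam_neq0 ?qpow_neq0. Qed.

Lemma Zc_fst z i : Zc z (fst_idx i) = qpow (2 * crd z i).
Proof. by rewrite /Zc /gam fst_idx_neq_max mul1r yc_fst. Qed.

Lemma Zc_max z : Zc z ord_max = qpow (M - 1) * qpow (2 * scrd m z).
Proof. by rewrite /Zc /gam eqxx yc_max. Qed.

Lemma Zc_shift z c s : Zc (z + s%:R *: fv c) =1 shift m tq c s (Zc z).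
Proof.
move=> d; rewrite /Zc /shift ycD ycZ yc_fv; case: (d == c); last first.
  by rewrite mulr0 addr0.
rewrite mulrDr qpowD.
have -> : qpow (2 * (s%:R * (rr m c)%:R)) = tq ^+ (rr m c * s).
  by rewrite tqX natrM; congr qpow; ring.
ring.
Qed.

Lemma big_fst (T : Type) (idx : T) (op : Monoid.com_law idx) (Q : pred I) (F : I -> T) :
  \big[op/idx]_(c | Q c) F c =
  op (\big[op/idx]_(i < n | Q (fst_idx i)) F (fst_idx i))
     (if Q ord_max then F ord_max else idx).
Proof. by rewrite big_mkcond big_ord_recr -big_mkcond. Qed.

Lemma kapC_K0 (i : 'I_n) : kapC (fst_idx i) * K0 = qpow (- 1) * qpow (- M) ^+ n.-1.
Proof.
rewrite /kapC fst_idx_neq_max /K0.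
have -> : \sum_(k < m) tq ^+ k = (tq ^+ m - 1) / (tq - 1).
  by rewrite subrX1 mulrC mulKf // subr_eq0 -[tq]expr1 tq_nroot.
have -> : qpow (- M) ^+ n = qpow (- M) * qpow (- M) ^+ n.-1.
  by rewrite -exprS prednK //; case: (n) (i) => [[]|].
rewrite !qbrE mulr1 -tqX -/tq !qpowN.
have := tq_nroot m_gt0; have := tq_nroot (ltn0Sn 0); rewrite expr1 -!(subr_eq0 _ 1).
move=> h1 h2; field; rewrite h1 h2 !qpow_neq0 //.
Qed.

Lemma acoefE z (i : 'I_n) : D_regular m logq z ->
  acoef m logq i z = kapC (fst_idx i) * K0 * dcoef m tq (Zc z) (fst_idx i).
Proof.
case=> reg1 reg2 _.
have fac_max : qbr (crd z i - scrd m z - (M + 1) / 2) / qbr (crd z i - scrd m z - (M - 1) / 2) =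
    qpow (- 1) * ((Zc z (fst_idx i) - tq ^+ pp m (ord_max : I) * Zc z ord_max) /
      (Zc z (fst_idx i) - Zc z ord_max)).
  have E : qpow (2 * (crd z i - scrd m z - (M - 1) / 2)) = Zc z (fst_idx i) / Zc z ord_max.
    by rewrite Zc_fst Zc_max -qpowD -qpowB; congr qpow; field.
  have ne : Zc z (fst_idx i) != Zc z ord_max.
    have := reg1 i; rewrite qbr_eq0 E; apply: contra => /eqP ->.
    by rewrite divff ?Zc_neq0.
  rewrite (qbr_ratio _ _ E ne) ?Zc_neq0 // /pp eqxx tqX; congr (qpow _ * ((_ - qpow _ * _) / _)).
    by field.
  by field.
have fac j : j != i -> qbr (crd z i - crd z j - M) / qbr (crd z i - crd z j) =
    qpow (- M) * ((Zc z (fst_idx i) - tq ^+ pp m (fst_idx j) * Zc z (fst_idx j)) /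
      (Zc z (fst_idx i) - Zc z (fst_idx j))).
  move=> ji; have E : qpow (2 * (crd z i - crd z j)) = Zc z (fst_idx i) / Zc z (fst_idx j).
    by rewrite !Zc_fst -qpowB; congr qpow; ring.
  have ne : Zc z (fst_idx i) != Zc z (fst_idx j).
    have := reg2 i j ji; rewrite qbr_eq0 E; apply: contra => /eqP ->.
    by rewrite divff ?Zc_neq0.
  rewrite (qbr_ratio _ _ E ne) ?Zc_neq0 // /pp fst_idx_neq_max tqX.
  by congr (qpow _ * ((_ - qpow _ * _) / _)); ring.
rewrite /acoef fac_max (eq_bigr _ fac) big_split /= prodr_const.
rewrite kapC_K0 /dcoef (big_fst _ (fun d => d != fst_idx i)) /= eq_sym fst_idx_neq_max /=.
rewrite [in RHS](eq_bigl (fun j : 'I_n => j != i)); last by move=> j; rewrite (inj_eq (@fst_idx_inj n)).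
have -> : #|[pred j | j != i]| = n.-1 by rewrite cardC1 card_ord.
by move: (qpow (-1)) (qpow _ ^+ _) (_ / _) (\prod_(_ < _ | _) _) => *; ring.
Qed.

Lemma acoef_lastE z : D_regular m logq z ->
  acoef_last m logq z = kapC ord_max * K0 * dcoef m tq (Zc z) ord_max.
Proof.
case=> _ _ reg.
have fac j : qbr (scrd m z - crd z j - (M + 1) / 2) / qbr (scrd m z - crd z j + (M - 1) / 2) =
    qpow (- M) * ((Zc z ord_max - tq ^+ pp m (fst_idx j) * Zc z (fst_idx j)) /
      (Zc z ord_max - Zc z (fst_idx j))).
  have E : qpow (2 * (scrd m z - crd z j + (M - 1) / 2)) = Zc z ord_max / Zc z (fst_idx j).
    by rewrite Zc_fst Zc_max -qpowD -qpowB; congr qpow; field.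
  have ne : Zc z ord_max != Zc z (fst_idx j).
    have := reg j; rewrite qbr_eq0 E; apply: contra => /eqP ->.
    by rewrite divff ?Zc_neq0.
  rewrite (qbr_ratio _ _ E ne) ?Zc_neq0 // /pp fst_idx_neq_max tqX.
  by congr (qpow _ * ((_ - qpow _ * _) / _)); field.
rewrite /acoef_last (eq_bigr _ (fun j _ => fac j)) big_split /= prodr_const card_ord.
rewrite /kapC eqxx mul1r /K0 -[RHS]mulrA; congr (_ * (_ * _)).
rewrite /dcoef (big_fst _ (fun d => d != ord_max)) /= eqxx mulr1.
by apply: eq_bigl => j; rewrite fst_idx_neq_max.
Qed.

Lemma DopE f z : D_regular m logq z ->
  Dop m logq f z = \sum_c kapC c * K0 * dcoef m tq (Zc z) c * f (z + fv c).
Proof.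
move=> reg; rewrite /Dop big_ord_recr /= fv_max acoef_lastE //; congr (_ + _).
by apply: eq_bigr => i _; rewrite acoefE // -(fv_fst R m).
Qed.

Lemma Zc_inj z : D_regular m logq z -> injective (Zc z).
Proof.
case=> reg1 reg2 _.
have lastne i : Zc z (fst_idx i) != Zc z ord_max.
  have := reg1 i; rewrite qbr_eq0; apply: contra => /eqP.
  rewrite Zc_fst Zc_max => e; apply/eqP.
  have -> : 2 * (crd z i - scrd m z - (M - 1) / 2) = 2 * crd z i - (M - 1 + 2 * scrd m z).
    by field.
  by rewrite qpowB e -qpowD divff ?qpow_neq0.
have fstne i j : j != i -> Zc z (fst_idx i) != Zc z (fst_idx j).
  move=> ji; have := reg2 i j ji; rewrite qbr_eq0; apply: contra => /eqP.
  by rewrite !Zc_fst mulrBr qpowB => ->; rewrite divff ?qpow_neq0.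
have cases (c : I) : c = ord_max \/ exists i, c = fst_idx i.
  case: (ltnP c n) => cn; last by left; apply: val_inj => /=; apply/eqP; rewrite eqn_leq cn -ltnS ltn_ord.
  by right; exists (Ordinal cn); apply: val_inj.
move=> c d e; have [ec|[i ci]] := cases c; have [ed|[j dj]] := cases d; subst => //.
- by move: e => /esym/eqP; rewrite (negbTE (lastne j)).
- by move: e => /eqP; rewrite (negbTE (lastne i)).
- have [->//|ij] := eqVneq i j.
  by move: e => /eqP; rewrite (negbTE (fstne i j _)) // eq_sym.
Qed.
End Link.

(** * Conjugation by the exponential factor *)

Section Conjugation.
Variables (R : realType) (n m : nat) (logq : R[i]).
Local Notation C := R[i].
Local Notation V := 'rV[C]_n.+1.
Local Notation I := 'I_n.+1.
Local Notation qpow := (qpow logq).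
Local Notation qbr := (qbr logq).
Local Notation yc := (yc m).
Local Notation fv := (@fv R n m).
Local Notation vec := (@vec R n m).
Local Notation M := (m%:R : C).
Local Notation tq := (tq logq).
Local Notation gam := (@gam R n m logq).
Local Notation Zc := (@Zc R n m logq).
Local Notation kapC := (@kapC R n m logq).
Local Notation K0 := (@K0 R n m logq).
Hypothesis m_gt0 : (0 < m)%N.
Hypothesis q_nroot : forall k, (0 < k)%N -> qpow 1 ^+ k != 1.

Definition upn (c : I) : nat := (\sum_(d : I | (c < d)%N) mu m c d)%N.
Definition dnn (c : I) : nat := (\sum_(a : I | (a < c)%N) mu m a c)%N.

(** The factor by which the prefactor pref x of psiF is multiplied under the
    shift along f_c, times the constant K0 of the operator. *)
Definition wC (x : V) (c : I) : C :=
  K0 * (qpow (2 * yc x c) * qpow (- (rr m c * (upn c + 3 * dnn c))%:R)).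

Definition tA : {poly C} := tq%:P.
Definition kapA (c : I) : {poly C} := (kapC c)%:P.
(** The indeterminate perturbs x. Eigenvalues and weights thereby become
    distinct polynomials for each x; their values of interest are those at 1.
    *)
Definition WA (x : V) (c : I) : {poly C} := (wC x c)%:P * 'X^c.

Lemma wC_neq0 x c : wC x c != 0.
Proof.
by apply: mulf_neq0; [exact: K0_neq0 | apply: mulf_neq0; exact: qpow_neq0].
Qed.

Lemma WA_neq0 x c : WA x c != 0.
Proof.
apply: mulf_neq0; first by rewrite polyC_eq0 wC_neq0.
by rewrite expf_neq0 ?polyX_eq0.
Qed.

Lemma tA_neq0 : tA != 0.
Proof. by rewrite polyC_eq0 tq_neq0. Qed.

Lemma tA_nroot k : (0 < k)%N -> tA ^+ k != 1.
Proof. by move=> k0; rewrite -rmorphXn -polyC1 (inj_eq polyC_inj) tq_nroot. Qed.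

Lemma kapAE c d : c != d -> kapA c * (1 - tA ^+ pp m d) = kapA d * (1 - tA ^+ pp m c).
Proof.
by move=> cd; rewrite /kapA /tA -!rmorphXn -polyC1 -!rmorphB -!rmorphM /= kapCE.
Qed.

Lemma WA_generic x (c d : I) i j : c != d -> WA x c * tA ^+ i != WA x d * tA ^+ j.
Proof.
move=> cd; apply/eqP => /(congr1 (fun p : {poly C} => p`_c)).
rewrite /WA /tA -!rmorphXn !coefMC !coefCM !coefXn eqxx mulr1.
have -> : ((c : nat) == d) = false by apply/negbTE.
by rewrite mulr0 mul0r => /eqP; rewrite mulf_eq0 (negbTE (wC_neq0 _ _)) expf_eq0 (negbTE (tq_neq0 _)) andbF.
Qed.

Lemma coef_eigval x om (c : I) :
  (eigval m tA kapA (WA x) om)`_c = kapC c * wC x c * tq ^+ (rr m c * om c).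
Proof.
rewrite coef_sum (bigD1 c) //= big1 => [|d dc].
  by rewrite addr0 /kapA /WA /tA -rmorphXn coefMC coefCM coefCM coefXn eqxx mulr1.
rewrite /kapA /WA /tA -rmorphXn coefMC !coefCM coefXn.
have -> : ((c : nat) == d) = false by apply/negbTE; rewrite eq_sym.
by rewrite !mulr0 mul0r.
Qed.

Lemma eigval_inj x om om' :
  eigval m tA kapA (WA x) om = eigval m tA kapA (WA x) om' -> om =1 om'.
Proof.
move=> e c; have := coef_eigval x om c; rewrite e coef_eigval => /mulfI.
rewrite mulf_neq0 ?kapC_neq0 ?wC_neq0 // => /(_ isT) E.
have ne a b := expr_neq (b := b) (a := a) (tq_neq0 logq) (tq_nroot q_nroot).
case: (ltngtP (om c) (om' c)) => // lt.
  by have /ne/eqP[] : (rr m c * om c < rr m c * om' c)%N by rewrite ltn_pmul2l ?rr_gt0.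
by have /ne/eqP[] : (rr m c * om' c < rr m c * om c)%N by rewrite ltn_pmul2l ?rr_gt0.
Qed.

Definition ev1 : {rmorphism {poly C} -> C} := @horner_eval C 1.

Lemma ev1E (p : {poly C}) : ev1 p = p.[1].
Proof. by []. Qed.

Lemma ev1_tA : ev1 tA = tq.
Proof. by rewrite ev1E hornerC. Qed.

Lemma ev1_kapA c : ev1 (kapA c) = kapC c.
Proof. by rewrite ev1E hornerC. Qed.

Lemma ev1_WA x c : ev1 (WA x c) = wC x c.
Proof. by rewrite ev1E hornerM hornerC hornerXn expr1n mulr1. Qed.

(** The exponent of the monomial by which Q, a Laurent polynomial, differs
    from a polynomial. *)
Definition bt (z : V) : C := \sum_c - (upn c + 3 * dnn c)%:R / 2 * yc z c.
Definition pref (x z : V) : C := qpow (2 * dotp x z) * qpow (2 * bt z).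
Definition psiF (x : V) (F : mpoly n.+1 {poly C}) (z : V) : C :=
  pref x z * ev ev1 (Zc z) F.

Lemma pref_shift x z c s : pref x (z + s%:R *: fv c) = pref x z * (wC x c / K0) ^+ s.
Proof.
have K0' : K0 != 0 by apply: K0_neq0.
have -> : wC x c / K0 = qpow (2 * yc x c) * qpow (- (rr m c * (upn c + 3 * dnn c))%:R).
  by rewrite /wC mulrC mulKf.
have ebt : bt (z + s%:R *: fv c) =
    bt z - (upn c + 3 * dnn c)%:R / 2 * (s%:R * (rr m c)%:R).
  rewrite /bt (bigD1 c) //= [in RHS](bigD1 c) //= ycD ycZ yc_fv eqxx mulrDr.
  rewrite (eq_bigr (fun d => - (upn d + 3 * dnn d)%:R / 2 * yc z d)) => [|d dc].
    by move: (\sum_(_ | _) _) => S; field.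
  by rewrite ycD ycZ yc_fv (negbTE dc) mulr0 addr0.
rewrite /pref ebt dotpDr exprMn -!qpowMn -!qpowD.
have -> : dotp x (s%:R *: fv c) = s%:R * yc x c.
  by rewrite -dotp_fvr /dotp mulr_sumr; apply: eq_bigr => i _; rewrite mxE mulrCA.
by congr qpow; rewrite !natrM; field.
Qed.

Lemma Dop_psiF x F G z : is_D m tA kapA (WA x) F G -> D_regular m logq z ->
  Dop m logq (psiF x F) z = psiF x G z.
Proof.
move=> DFG reg; rewrite DopE // /psiF (is_D_point ev1 (Zc_inj reg) DFG) mulr_sumr.
apply: eq_bigr => c _.
have -> : ev ev1 (Zc (z + fv c)) F = ev ev1 (shift m (ev1 tA) c 1 (Zc z)) F.
  by apply: eq_ev => d; rewrite -[fv c]scale1r -[1]/(1%:R) Zc_shift ev1_tA.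
have -> : pref x (z + fv c) = pref x z * (wC x c / K0).
  by rewrite -[fv c]scale1r -[1]/(1%:R) pref_shift expr1.
rewrite ev1_kapA ev1_WA ev1_tA.
have K0' : K0 != 0 by apply: K0_neq0.
move: (ev _ _ F) (dcoef _ _ _ _) (pref x z) (wC x c) (kapC c) => *; field.
exact: K0'.
Qed.

Lemma bigop_split_ne (c : I) : (\sum_(d | d != c) mu m c d = upn c + dnn c)%N.
Proof.
rewrite (bigID (fun d : I => (c < d)%N)) /=; congr (_ + _)%N.
  by apply: eq_bigl => d; rewrite -val_eqE /=; lia.
by apply: eq_big => d; [rewrite -val_eqE /=; lia | rewrite muC].
Qed.

(** The polynomial whose value at 1 is frakm (x + nu), and whose coefficients
    separate the vectors nu. *)
Definition Evec (x nu : V) : {poly C} :=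
  \sum_c (kapC c * wC x c * (qpow (2 * yc nu c) * tq ^+ (rr m c * om0 m c)))%:P * 'X^c.

Lemma eigval_Evec x om : eigval m tA kapA (WA x) om =
  Evec x (vec (fun c => (om c)%:R - (om0 m c)%:R)).
Proof.
apply: eq_bigr => c _.
have -> : qpow (2 * yc (vec (fun c => (om c)%:R - (om0 m c)%:R)) c) *
    tq ^+ (rr m c * om0 m c) = tq ^+ (rr m c * om c).
  by rewrite yc_vec !tqX -qpowD; congr qpow; rewrite !natrM; ring.
rewrite /kapA /WA /tA -rmorphXn !polyCM /=.
move: (_%:P) (_%:P) (_%:P) => *; ring.
Qed.

Lemma norm_exponent c : qpow (- (rr m c * (upn c + 3 * dnn c))%:R) * tq ^+ (rr m c * om0 m c) =
  qpow (\sum_(d | d != c) pp m d)%:R.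
Proof.
rewrite tqX -qpowD; congr qpow.
rewrite (eq_bigr (fun d => rr m c * mu m c d)%N) => [|d dc]; last by rewrite rr_mu // eq_sym.
rewrite -big_distrr /= bigop_split_ne /om0 bigop_split_ne -/(dnn c) !(natrM, natrD).
ring.
Qed.

Lemma Evec1 x nu : (Evec x nu).[1] = frakm m logq (x + nu).
Proof.
have E c : kapC c * wC x c * (qpow (2 * yc nu c) * tq ^+ (rr m c * om0 m c)) =
    kapC c * K0 * qpow (\sum_(d | d != c) pp m d)%:R * qpow (2 * yc (x + nu) c).
  rewrite -norm_exponent /wC ycD mulrDr qpowD.
  by move: (kapC c) K0 (qpow _) (qpow _) (qpow _) (tq ^+ _) => *; ring.
rewrite /Evec horner_sum.
under eq_bigr => c _ do rewrite hornerM hornerC hornerXn expr1n mulr1 E.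
rewrite /frakm big_ord_recr /=; congr (_ + _).
  apply: eq_bigr => i _; rewrite -/(fst_idx i) yc_fst.
  have -> : kapC (fst_idx i) * K0 * qpow (\sum_(d | d != fst_idx i) pp m d)%:R = 1.
    rewrite kapC_K0 // (big_fst _ (fun d => d != fst_idx i)) /= eq_sym fst_idx_neq_max /=.
    rewrite (eq_big (fun j : 'I_n => j != i) (fun=> m)); first last.
    - by move=> j _; rewrite /pp fst_idx_neq_max.
    - by move=> j; rewrite (inj_eq (@fst_idx_inj n)).
    rewrite sum_nat_const cardC1 card_ord /pp eqxx -qpowMn -!qpowD -[RHS](qpow0 logq).
    by congr qpow; rewrite natrD natrM; ring.
  by rewrite mul1r.
rewrite yc_max; congr (_ * _).
rewrite (big_fst _ (fun d => d != ord_max)) /= eqxx addn0 /kapC eqxx mul1r /K0.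
rewrite (eq_big (fun j : 'I_n => true) (fun=> m)); first last.
- by move=> j _; rewrite /pp fst_idx_neq_max.
- by move=> j; rewrite fst_idx_neq_max.
rewrite sum_nat_const card_ord -qpowMn -mulrA -qpowD.
have -> : n%:R * - M + (n * m)%:R = 0 by rewrite natrM; ring.
by rewrite qpow0 mulr1.
Qed.
End Conjugation.

(** * The zonotope in coordinates *)

Section BakerAkhiezer.
Variables (R : realType) (n m : nat) (logq : R[i]).
Local Notation C := R[i].
Local Notation I := 'I_n.+1.
Local Notation qpow := (qpow logq).
Local Notation qbr := (qbr logq).
Local Notation yc := (yc m).
Local Notation fv := (@fv R n m).
Local Notation vec := (@vec R n m).
Local Notation tq := (tq logq).
Local Notation gam := (@gam R n m logq).
Local Notation Zc := (@Zc R n m logq).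
Local Notation kapC := (@kapC R n m logq).
Local Notation K0 := (@K0 R n m logq).
Local Notation tA := (tA logq).
Local Notation kapA := (@kapA R n m logq).
Local Notation WA := (@WA R n m logq).
Local Notation Evec := (@Evec R n m logq).
Local Notation ev1 := (ev1 R).
Local Notation rho := (rho R n m).
Local Notation nus := (nus R n m).
Local Notation lt_pair := (@lt_pair n).
Hypothesis m_gt0 : (0 < m)%N.
Hypothesis q_nroot : forall k, (0 < k)%N -> qpow 1 ^+ k != 1.

Lemma sum_ends (l : I * I -> nat) :
  (forall p, (l p <= if lt_pair p then mu m p.1 p.2 else 0)%N) ->
  \sum_(a : posroot n) (l (ends a))%:R *: root_vec R m a =
  \sum_p (l p)%:R *: (fv p.1 - fv p.2).
Proof.
move=> lmu; under eq_bigr do rewrite root_vec_ends.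
rewrite (big_posroot _ (fun p => (l p)%:R *: (fv p.1 - fv p.2))).
rewrite big_mkcond; apply: eq_bigr => p _; case: ifP => // lp.
by have := lmu p; rewrite lp leqn0 => /eqP ->; rewrite scale0r.
Qed.

Lemma vec_flow (T : finType) (e : T -> I * I) (a : I -> int) (l : T -> nat) :
  (forall c, a c = \sum_p ((l p * ((e p).1 == c))%:Z - (l p * ((e p).2 == c))%:Z)) ->
  vec (fun c => (a c)%:~R) = \sum_p (l p)%:R *: (fv (e p).1 - fv (e p).2).
Proof.
move=> aE; rewrite /vec.
have pick (x : C) (d : I) : \sum_c (x * (d == c)%:R) *: fv c = x *: fv d.
  rewrite (bigD1 d) //= eqxx mulr1 big1 ?addr0 // => c cd.
  by rewrite eq_sym (negbTE cd) mulr0 scale0r.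
transitivity (\sum_c \sum_p (((l p)%:R * ((e p).1 == c)%:R) *: fv c -
                               ((l p)%:R * ((e p).2 == c)%:R) *: fv c)).
  apply: eq_bigr => c _; rewrite aE rmorph_sum scaler_suml; apply: eq_bigr => p _.
  by rewrite rmorphB scalerBl /= -!natrM.
rewrite exchange_big; apply: eq_bigr => p _ /=.
by rewrite sumrB !pick scalerBr.
Qed.

Lemma vec_feasible (a : I -> int) : feasible m a ->
  exists2 l : posroot n -> nat, (forall r, (l r <= mult m r)%N) &
    vec (fun c => (a c)%:~R) = \sum_r (l r)%:R *: root_vec R m r.
Proof.
case=> l lmu la; exists (fun r => l (ends r)).
  by move=> r; rewrite mult_ends; have := lmu (ends r); rewrite ends_lt.
by rewrite sum_ends // (vec_flow (e := id) la).
Qed.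

(** The product over nu contains a factor for each feasible exponent but that
    of nu = 0. *)
Lemma nus_feasible x (om : I -> nat) :
  feasible m (fun c => (om c)%:Z - (om0 m c)%:Z) ->
  om =1 om0 m \/ eigval m tA kapA (WA x) om \in [seq Evec x nu | nu <- nus].
Proof.
move=> feas; have [l lmult lE] := vec_feasible feas.
have vE : vec (fun c => ((om c)%:Z - (om0 m c)%:Z)%:~R) =
          vec (fun c => (om c)%:R - (om0 m c)%:R).
  by apply: eq_vec => c; rewrite rmorphB.
rewrite vE in lE.
have [v0|v0] := eqVneq (vec (fun c => (om c)%:R - (om0 m c)%:R)) 0.
  left=> c; have z0 : 0 = vec (fun=> 0).
    by rewrite /vec big1 // => d _; rewrite scale0r.
  rewrite z0 in v0; have := vec_inj m_gt0 v0 c => /= /subr0_eq /eqP.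
  by rewrite eqr_nat => /eqP.
right; rewrite eigval_Evec; apply: map_f; rewrite mem_filter v0 mem_undup.
pose l' : {dffun forall a : posroot n, 'I_(mult m a).+1} := [ffun a => inord (l a)].
apply/mapP; exists l'; rewrite ?mem_enum // lE; apply: eq_bigr => r _.
by rewrite ffunE inordK // ltnS.
Qed.

Lemma nus_coords nu : nu \in nus ->
  exists2 a : I -> int, nu = vec (fun c => (a c)%:~R) & exists c, a c != 0.
Proof.
rewrite mem_filter mem_undup => /andP[nu0 /mapP[l _ nuE]].
pose a c := \sum_(r : posroot n) (((l r : nat) * ((ends r).1 == c))%:Z -
                                  ((l r : nat) * ((ends r).2 == c))%:Z).
have aE : nu = vec (fun c => (a c)%:~R).
  rewrite nuE (vec_flow (e := @ends n) (l := fun r => l r : nat)) //.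
  by apply: eq_bigr => r _; rewrite root_vec_ends.
exists a => //; apply: contrapT => /forallNP a0; case/eqP: nu0.
rewrite aE /vec big1 // => c _; have := a0 c => /negP/negPn/eqP ->.
by rewrite scale0r.
Qed.

Lemma sum_mu_fst (F : I -> C) :
  \sum_(p | lt_pair p) (mu m p.1 p.2)%:R * F p.1 = \sum_c (upn m c)%:R * F c.
Proof.
rewrite (eq_bigr (fun c : I => \sum_(d : I | (c < d)%N) (mu m c d)%:R * F c)); last first.
  by move=> c _; rewrite /upn natr_sum mulr_suml.
by rewrite pair_big_dep.
Qed.

Lemma sum_mu_snd (F : I -> C) :
  \sum_(p | lt_pair p) (mu m p.1 p.2)%:R * F p.2 = \sum_c (dnn m c)%:R * F c.
Proof.
rewrite (big_lt_pair _ (fun p : I * I => (mu m p.1 p.2)%:R * F p.2)) /=.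
by apply: eq_bigr => c _; rewrite /dnn natr_sum mulr_suml.
Qed.

Lemma dotp_rho z : dotp rho z =
  \sum_c ((upn m c)%:R - (dnn m c)%:R) / 2 * yc z c.
Proof.
rewrite /Defs.rho dotpZl dotp_suml.
rewrite (eq_bigr (fun r => (mu m (ends r).1 (ends r).2)%:R *
    (yc z (ends r).1 - yc z (ends r).2))); last first.
  move=> r _; rewrite dotpZl mult_ends root_vec_ends; congr (_ * _).
  by rewrite dotpBl !dotp_fvl.
rewrite (big_posroot _ (fun p => (mu m p.1 p.2)%:R * (yc z p.1 - yc z p.2))).
under eq_bigr do rewrite mulrBr.
rewrite sumrB sum_mu_fst sum_mu_snd -sumrB mulr_sumr; apply: eq_bigr => c _.
by field.
Qed.

Lemma rho_vec : rho = vec (fun c => ((upn m c)%:R - (dnn m c)%:R) / 2).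
Proof.
apply: (yc_inj m_gt0) => c; rewrite yc_vec -dotp_fvr dotp_rho (bigD1 c) //= yc_fv eqxx.
by rewrite big1 ?addr0 // => d dc; rewrite yc_fv (negbTE dc) mulr0.
Qed.

(** Each pair of brackets in Q is a scalar, times an exponential in z, times a
    factor of the seed; this is the product of the scalars. *)
Definition norm_const : C :=
  \prod_(p | lt_pair p) \prod_(1 <= s < (mu m p.1 p.2).+1)
     (- (tq ^+ (rr m p.1 * s) * gam p.2 ^+ 2))^-1.

Lemma qbr_factor z p s : lt_pair p -> (1 <= s <= mu m p.1 p.2)%N ->
  qbr (yc z p.1 - yc z p.2 + s%:R / 2 * (rr m p.1 + rr m p.2)%:R) *
  qbr (yc z p.1 - yc z p.2 - s%:R / 2 * (rr m p.1 + rr m p.2)%:R) =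
  (- (tq ^+ (rr m p.1 * s) * gam p.2 ^+ 2))^-1 * qpow (- (2 * (yc z p.1 + yc z p.2))) *
  ev ev1 (Zc z) (seed_factor m tA p.1 p.2 s).
Proof.
case: p => a b; rewrite /lt_pair /= => ab sm.
have ga : gam a = 1.
  rewrite /gam; case: eqP => // e; move: ab; rewrite e /= ltnNge -ltnS ltn_ord //.
have evf : ev ev1 (Zc z) (seed_factor m tA a b s) =
   (Zc z a - tq ^+ (rr m a * s) * Zc z b) * (Zc z b - tq ^+ (rr m b * s) * Zc z a).
  by rewrite evM !evB !evM !evC !evX !rmorphXn -!/(ev1 _) !ev1_tA.
rewrite qbr_mul evf /Zc ga mul1r.
have -> : 2 * (s%:R / 2 * (rr m a + rr m b)%:R) = (s * (rr m a + rr m b))%:R :> C.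
  by rewrite natrM; field.
have -> : qpow (2 * (yc z a - yc z b)) = qpow (2 * yc z a) / qpow (2 * yc z b).
  by rewrite mulrBr qpowB.
have -> : qpow (- (2 * (yc z a + yc z b))) = (qpow (2 * yc z a))^-1 / qpow (2 * yc z b).
  by rewrite qpowN mulrDr qpowD invfM.
rewrite !qpowN.
set E : C := qpow (s * (rr m a + rr m b))%:R.
have [g1 g2] : tq ^+ (rr m a * s) * gam b = E /\ tq ^+ (rr m b * s) = gam b * E.
  rewrite /E !tqX /gam; have ab' : a != b by rewrite neq_ltn ab.
  have ra : rr m a = 1%N.
    rewrite /rr; case: eqP => // e; move: ab; rewrite e /= ltnNge -ltnS ltn_ord //.
  have [eb|nb] := eqVneq b ord_max.
    have s1 : s = 1%N by move: sm; rewrite /mu eb eqxx orbT; lia.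
    rewrite s1 ra /rr eb eqxx -!qpowD; split; congr qpow; rewrite !natrM natrD; ring.
  rewrite ra /rr (negbTE nb) mulr1 mul1r; split; congr qpow; rewrite !natrM; ring.
have tn : tq ^+ (rr m a * s) != 0 by rewrite expf_neq0 ?tq_neq0.
have gn : gam b != 0 by apply: gam_neq0.
have En : E != 0 by apply: qpow_neq0.
have -> : tq ^+ (rr m a * s) * gam b ^+ 2 = E * gam b by rewrite expr2 mulrA g1.
have -> : tq ^+ (rr m a * s) * (gam b * qpow (2 * yc z b)) = E * qpow (2 * yc z b).
  by rewrite mulrA g1.
rewrite g2; have := qpow_neq0 logq (2 * yc z a); have := qpow_neq0 logq (2 * yc z b).
clear g1 g2; clearbody E.
move: (qpow (2 * yc z a)) (qpow (2 * yc z b)) E En (gam b) gn; clear.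
move=> x y e e0 g g0 y0 x0; field.
by rewrite ?x0 ?y0 ?e0 ?g0 ?oppr_eq0 ?mulf_neq0.
Qed.
End BakerAkhiezer.

(** * The function psi *)

Section Assembly.
Variables (R : realType) (n m : nat) (logq : R[i]).
Local Notation C := R[i].
Local Notation V := 'rV[C]_n.+1.
Local Notation I := 'I_n.+1.
Local Notation qpow := (qpow logq).
Local Notation qbr := (qbr logq).
Local Notation yc := (yc m).
Local Notation fv := (@fv R n m).
Local Notation vec := (@vec R n m).
Local Notation tq := (tq logq).
Local Notation gam := (@gam R n m logq).
Local Notation Zc := (@Zc R n m logq).
Local Notation kapC := (@kapC R n m logq).
Local Notation K0 := (@K0 R n m logq).
Local Notation wC := (@wC R n m logq).
Local Notation tA := (tA logq).
Local Notation kapA := (@kapA R n m logq).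
Local Notation WA := (@WA R n m logq).
Local Notation psiF := (@psiF R n m logq).
Local Notation Evec := (@Evec R n m logq).
Local Notation ev1 := (ev1 R).
Local Notation rho := (rho R n m).
Local Notation nus := (nus R n m).
Local Notation lt_pair := (@lt_pair n).
Hypothesis m_gt0 : (0 < m)%N.
Hypothesis q_nroot : forall k, (0 < k)%N -> qpow 1 ^+ k != 1.
Local Notation norm_const := (norm_const n m logq).

Lemma Qfun_seed x z :
  qpow (2 * dotp x z) * Qfun m logq z = norm_const * psiF x (seed n m tA) z.
Proof.
pose f (p : I * I) := \prod_(1 <= s < (mu m p.1 p.2).+1)
  ((- (tq ^+ (rr m p.1 * s) * gam p.2 ^+ 2))^-1 * qpow (- (2 * (yc z p.1 + yc z p.2))) *
   ev ev1 (Zc z) (seed_factor m tA p.1 p.2 s)).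
have E1 : \prod_(a : posroot n) \prod_(1 <= j < (mult m a).+1)
      (qbr (dotp (root_vec R m a) (z + (j%:R / 2) *: root_vec R m a)) *
       qbr (dotp (root_vec R m a) (z - (j%:R / 2) *: root_vec R m a))) =
    \prod_(p | lt_pair p) f p.
  rewrite -big_posroot; apply: eq_bigr => a _.
  rewrite /f mult_ends; apply: eq_big_nat => s sm; rewrite -qbr_factor ?ends_lt //.
  have rz w : dotp (root_vec R m a) w = yc w (ends a).1 - yc w (ends a).2.
    by rewrite root_vec_ends dotpBl !dotp_fvl.
  have ne : ((ends a).1 == (ends a).2) = false.
    by apply/negbTE; rewrite neq_ltn; have := ends_lt a; rewrite /lt_pair => ->.
  have rr1 : yc (root_vec R m a) (ends a).1 = (rr m (ends a).1)%:R.
    by rewrite root_vec_ends ycB !yc_fv eqxx ne subr0.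
  have rr2 : yc (root_vec R m a) (ends a).2 = - (rr m (ends a).2)%:R.
    by rewrite root_vec_ends ycB !yc_fv eqxx eq_sym ne sub0r.
  rewrite !rz !ycB !ycD !ycZ rr1 rr2 natrD.
  congr (qbr _ * qbr _); ring.
have E2 : \prod_(p | lt_pair p) f p = norm_const *
    qpow (- (2 * \sum_c ((upn m c)%:R + (dnn m c)%:R) * yc z c)) *
    ev ev1 (Zc z) (seed n m tA).
  rewrite /f; under eq_bigr do rewrite 2!big_split /=.
  rewrite 2!big_split /= -/norm_const ev_prod.
  congr (_ * _ * _); last by apply: eq_bigr => p _; rewrite ev_prod.
  transitivity (\prod_(p | lt_pair p)
      qpow ((mu m p.1 p.2)%:R * (- (2 * (yc z p.1 + yc z p.2))))).
    by apply: eq_bigr => p _; rewrite prodr_const_nat subn1 /= qpowMn.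
  rewrite -qpow_sum; congr qpow.
  rewrite (eq_bigr (fun p : I * I => - (2 * ((mu m p.1 p.2)%:R * yc z p.1 +
     (mu m p.1 p.2)%:R * yc z p.2)))); last first.
    by move=> p _; rewrite mulrN mulrCA mulrDr.
  rewrite sumrN -mulr_sumr big_split /= sum_mu_fst sum_mu_snd -big_split /=.
  by congr (- (_ * _)); apply: eq_bigr => c _; rewrite mulrDl.
rewrite /Qfun E1 E2 /psiF /pref.
have E3 : qpow (2 * dotp rho z) *
    qpow (- (2 * \sum_c ((upn m c)%:R + (dnn m c)%:R) * yc z c)) = qpow (2 * bt m z).
  rewrite -qpowD -mulrN -mulrDr dotp_rho -sumrN -big_split /=; congr (qpow (_ * _)).
  by apply: eq_bigr => c _; rewrite natrD natrM; field.
rewrite -E3; move: (qpow _) (qpow _) (qpow _) norm_const (ev _ _ _) => *; ring.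
Qed.

Lemma eq_Dop (f g : V -> C) z : (forall i, f (z + evec R i) = g (z + evec R i)) ->
  f (z + slast R n m) = g (z + slast R n m) -> Dop m logq f z = Dop m logq g z.
Proof.
by move=> e1 e2; rewrite /Dop e2; congr (_ + _); apply: eq_bigr => i _; rewrite e1.
Qed.

Lemma DopZ a (f : V -> C) z : Dop m logq (fun z' => a * f z') z = a * Dop m logq f z.
Proof.
rewrite /Dop mulrDr mulr_sumr mulrCA; congr (_ + _).
by apply: eq_bigr => i _; rewrite mulrCA.
Qed.

Let D_hyp x F : qi m tA (WA x) F -> is_D m tA kapA (WA x) F (Dq m tA kapA (WA x) F).
Proof. exact: (DqP m_gt0 (@kapAE R n m logq)). Qed.

Definition gsteps x := steps m tA kapA (WA x).

Let qi_gsteps x s : qi m tA (WA x) (gsteps x s (seed n m tA)).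
Proof.
exact: (qi_steps m_gt0 (tA_neq0 logq) (tA_nroot q_nroot) (@kapAE R n m logq) s
  (@qi_seed n m _ tA (WA x))).
Qed.

Lemma psiF_scale x a F z : psiF x (mpolyC _ a * F) z = a.[1] * psiF x F z.
Proof. by rewrite /psiF evM evC ev1E mulrCA. Qed.

Lemma psiF_sub x F G z : psiF x (F - G) z = psiF x F z - psiF x G z.
Proof. by rewrite /psiF evB mulrBr. Qed.

(** The operators applied pointwise agree with those applied to polynomials as
    long as no denominator vanishes. *)
Lemma psi_op_steps x (l : seq V) z : D_domain m logq (size l) z ->
  foldr (fun nu f z => Dop m logq f z - frakm m logq (x + nu) * f z)
    (fun z => qpow (2 * dotp x z) * Qfun m logq z) l z =
  norm_const * psiF x (gsteps x [seq Evec x nu | nu <- l] (seed n m tA)) z.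
Proof.
elim: l z => [|nu l IH] z /=; first by rewrite Qfun_seed.
case=> reg dz de ds; rewrite IH //.
rewrite (@eq_Dop _ (fun z' => norm_const *
   psiF x (gsteps x [seq Evec x nu | nu <- l] (seed n m tA)) z')); first last.
- by apply: IH.
- by move=> i; apply: IH.
rewrite DopZ (Dop_psiF m_gt0 q_nroot (D_hyp (qi_gsteps x _)) reg).
rewrite psiF_sub psiF_scale (Evec1 m_gt0 q_nroot) mulrBr; congr (_ - _).
by rewrite mulrCA.
Qed.

Lemma psiF_shift x G z c s : psiF x G (z + s%:R *: fv c) =
  pref m logq x z * (wC x c / K0) ^+ s * ev ev1 (shift m tq c s (Zc z)) G.
Proof.
rewrite /psiF pref_shift //; congr (_ * _).
by apply: eq_ev => a; rewrite Zc_shift.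
Qed.

Definition Psi x := gsteps x [seq Evec x nu | nu <- nus] (seed n m tA).
Definition psi x z := norm_const * psiF x (Psi x) z.

Lemma eigval_om0 x : eigval m tA kapA (WA x) (om0 m) = Evec x 0.
Proof.
rewrite eigval_Evec; congr Evec; rewrite /vec big1 // => c _.
by rewrite subrr scale0r.
Qed.

Lemma psi_eigen x z : D_regular m logq z ->
  Dop m logq (psi x) z = frakm m logq x * psi x z.
Proof.
move=> reg; rewrite /psi DopZ (Dop_psiF m_gt0 q_nroot (D_hyp (qi_gsteps x _)) reg).
rewrite (Dq_Psi m_gt0 (tA_neq0 logq) (tA_nroot q_nroot) (@kapAE R n m logq)
  (WA_neq0 m_gt0 q_nroot x) (WA_generic m_gt0 q_nroot x) (@eigval_inj R n m logq m_gt0 q_nroot x)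
  (@nus_feasible R n m logq m_gt0 x)).
by rewrite psiF_scale eigval_om0 (Evec1 m_gt0 q_nroot) addr0 mulrCA.
Qed.

Lemma psi_quasi_invariant x z (c d : I) s : c != d -> (s <= mu m c d)%N ->
  Zc z c = Zc z d -> psi x (z + s%:R *: fv c) = psi x (z + s%:R *: fv d).
Proof.
move=> cd sm zcd; rewrite /psi !psiF_shift.
have qP : qi m tA (WA x) (Psi x) by apply: qi_gsteps.
have := qi_point ev1 qP cd zcd sm.
rewrite !ev1_WA !ev1_tA; move: (Psi x) => G e.
move: e; move: (wC x c) (wC x d) (K0^-1) => a b k.
move: (ev _ _ _) (ev _ _ _) (pref _ _ _ _) norm_const => f g p N e.
rewrite !exprMn; transitivity (N * (p * k ^+ s * (a ^+ s * g))); first by ring.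
by rewrite e; ring.
Qed.
End Assembly.

(** * Support and coefficients of psi *)

Section Solution.
Variables (R : realType) (n m : nat) (logq : R[i]).
Local Notation C := R[i].
Local Notation V := 'rV[C]_n.+1.
Local Notation I := 'I_n.+1.
Local Notation qpow := (qpow logq).
Local Notation yc := (yc m).
Local Notation fv := (@fv R n m).
Local Notation vec := (@vec R n m).
Local Notation tq := (tq logq).
Local Notation gam := (@gam R n m logq).
Local Notation Zc := (@Zc R n m logq).
Local Notation kapC := (@kapC R n m logq).
Local Notation K0 := (@K0 R n m logq).
Local Notation wC := (@wC R n m logq).
Local Notation tA := (tA logq).
Local Notation WA := (@WA R n m logq).
Local Notation psiF := (@psiF R n m logq).
Local Notation Evec := (@Evec R n m logq).
Local Notation ev1 := (ev1 R).
Local Notation rho := (rho R n m).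
Local Notation nus := (nus R n m).
Local Notation lt_pair := (@lt_pair n).
Hypothesis m_gt0 : (0 < m)%N.
Hypothesis q_nroot : forall k, (0 < k)%N -> qpow 1 ^+ k != 1.
Local Notation norm_const := (norm_const n m logq).
Local Notation Psi := (@Psi R n m logq).
Local Notation psi := (@psi R n m logq).

(** The vector nu for which the monomial k produces the exponential
    q^(2(nu,z)). *)
Definition mono_vec (k : multinom n.+1) : V :=
  - rho + vec (fun c => (k c)%:R - (bot m c)%:R).

Lemma mono_vec_inj : injective mono_vec.
Proof.
move=> k l /addrI /(vec_inj m_gt0) e; apply/mnmP => c.
by have := e c => /= /addIr /eqP; rewrite eqr_nat => /eqP.
Qed.

Definition mono_coef x (k : multinom n.+1) : C :=
  norm_const * (mcoeff k (Psi x)).[1] * \prod_c gam c ^+ k c.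

Lemma dotp_mono_vec k z : dotp (mono_vec k) z = bt m z + \sum_c (k c)%:R * yc z c.
Proof.
rewrite /mono_vec addrC dotpBl dotp_vec dotp_rho -sumrB -big_split /=.
by apply: eq_bigr => c _; rewrite /bot natrD !natrM; field.
Qed.

Lemma psi_expand x z : psi x z =
  qpow (2 * dotp x z) *
  \sum_(k <- msupp (Psi x)) mono_coef x k * qpow (2 * dotp (mono_vec k) z).
Proof.
rewrite /psi /psiF evE /pref mulr_sumr mulr_sumr mulr_sumr.
apply: eq_bigr => k _; rewrite dotp_mono_vec mulrDr qpowD /mono_coef ev1E.
have -> : \prod_c Zc z c ^+ k c = (\prod_c gam c ^+ k c) * qpow (2 * \sum_c (k c)%:R * yc z c).
  rewrite mulr_sumr qpow_sum -big_split; apply: eq_bigr => c _ /=.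
  by rewrite /Zc exprMn -qpowMn mulrCA.
move: (qpow _) (qpow _) (qpow _) norm_const (\prod_(_ < _) _) (_.[1]) => *; ring.
Qed.

Let supp_feasible x k : mcoeff k (Psi x) != 0 ->
  feasible m (fun c => (k c)%:Z - (bot m c)%:Z).
Proof.
exact: (supp_Psi m_gt0 (tA_neq0 logq) (tA_nroot q_nroot) (@kapAE R n m logq)
  (WA_neq0 m_gt0 q_nroot x) (WA_generic m_gt0 q_nroot x) (@eigval_inj R n m logq m_gt0 q_nroot x)
  (@nus_feasible R n m logq m_gt0 x)).
Qed.

Lemma mono_vec_support x k : mcoeff k (Psi x) != 0 -> ba_support R n m (mono_vec k).
Proof.
move=> kP; split.
  have -> : mono_vec k - rho = vec (fun c => ((k c)%:Z - (bot m c)%:Z - (upn m c)%:Z + (dnn m c)%:Z)%:~R).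
    rewrite /mono_vec (rho_vec R n m_gt0) addrAC -opprD -scaleN1r -vecD -vecZ -vecD.
    apply: eq_vec => c.
    have -> : (((k c)%:Z - (bot m c)%:Z - (upn m c)%:Z + (dnn m c)%:Z)%:~R : C) =
      (k c)%:R - (bot m c)%:R - (upn m c)%:R + (dnn m c)%:R by rewrite intrD !intrB.
    by field.
  exact: vec_lattice.
have [l lmult lE] := vec_feasible R (supp_feasible kP).
exists (fun r => (l r)%:R); split.
  by move=> r; rewrite ler0n ler_nat lmult.
congr (_ + _).
have -> : vec (fun c => (k c)%:R - (bot m c)%:R) =
    vec (fun c => ((k c)%:Z - (bot m c)%:Z)%:~R).
  by apply: eq_vec => c; rewrite rmorphB.
by rewrite lE; apply: eq_bigr => r _; rewrite rmorph_nat.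
Qed.

Definition psi_coef (nu x : V) : C := \sum_(k <- msupp (Psi x) | mono_vec k == nu) mono_coef x k.

Lemma psi_coef_mono_vec x k : psi_coef (mono_vec k) x = mono_coef x k.
Proof.
rewrite /psi_coef (eq_bigl (pred1 k)); last by move=> l; rewrite /= (inj_eq mono_vec_inj).
have [kP|kP] := boolP (k \in msupp (Psi x)).
  by rewrite -big_filter filter_pred1_uniq // big_seq1.
rewrite big1_seq => [|l /andP[/eqP -> lP]]; last by rewrite lP in kP.
by rewrite /mono_coef (memN_msupp_eq0 kP) horner0 mulr0 mul0r.
Qed.

Lemma psi_fsbig x z : psi x z =
  qpow (2 * dotp x z) *
  \sum_(nu \in ba_support R n m) (psi_coef nu x * qpow (2 * dotp nu z)).
Proof.
rewrite psi_expand; congr (_ * _).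
have inS k : k \in msupp (Psi x) -> ba_support R n m (mono_vec k).
  by rewrite mcoeff_msupp; apply: mono_vec_support.
rewrite (@fsbigE _ _ _ _ _ [seq mono_vec k | k <- msupp (Psi x)]).
- rewrite [RHS]big_map [LHS]big_seq_cond [RHS]big_seq_cond; apply: eq_big => [k|k].
    by rewrite andbT; case: (boolP (k \in _)) => //= kP; rewrite mem_set //; apply: inS.
  by move=> _; rewrite psi_coef_mono_vec.
- by rewrite (map_inj_uniq mono_vec_inj) msupp_uniq.
- by move=> nu /= /mapP[k kP ->]; apply: inS.
move=> nu _ nuP; rewrite /psi_coef big1_seq ?mul0r // => k /andP[/eqP e kP].
by case/negP: nuP; rewrite -e map_f.
Qed.

Lemma mono_vec_bot : mono_vec (bot_mnm n m) = - rho.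
Proof.
rewrite /mono_vec /vec big1 ?addr0 // => c _.
by rewrite bot_mnmE subrr scale0r.
Qed.

Lemma norm_const_seed : norm_const * (seed_lead n m tA).[1] *
  \prod_c gam c ^+ bot_mnm n m c = 1.
Proof.
have -> : \prod_c gam c ^+ bot_mnm n m c =
    \prod_(p | lt_pair p) \prod_(1 <= s < (mu m p.1 p.2).+1) gam p.2 ^+ 2.
  rewrite (big_lt_pair _ (fun p : I * I => \prod_(1 <= s < (mu m p.1 p.2).+1) gam p.2 ^+ 2)).
  apply: eq_bigr => c _; rewrite bot_mnmE /bot exprM expr_sum; apply: eq_bigr => a _.
  by rewrite prodr_const_nat subn1.
rewrite horner_prod /norm_const -!big_split /= big1 // => p _.
rewrite horner_prod -!big_split /= big1 // => s _.
rewrite hornerN -rmorphXn hornerC; have := gam_neq0 m logq p.2.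
have : tq ^+ (rr m p.1 * s) != 0 by rewrite expf_neq0 ?tq_neq0.
by move=> h1 h2; field; rewrite h1 h2.
Qed.

Lemma psi_coef_bot x : psi_coef (- rho) x =
  \prod_(nu <- nus) (frakm m logq x - frakm m logq (x + nu)).
Proof.
rewrite -mono_vec_bot psi_coef_mono_vec /mono_coef.
rewrite (mcoeff_Psi_bot (WA x) m_gt0 (tA_neq0 logq) (tA_nroot q_nroot) (@kapAE R n m logq)).
rewrite hornerM; set p := \prod_(e <- _) _.
have -> : p.[1] = \prod_(nu <- nus) (frakm m logq x - frakm m logq (x + nu)).
  rewrite /p big_map horner_prod; apply: eq_bigr => nu _.
  by rewrite hornerD hornerN eigval_om0 !(Evec1 m_gt0 q_nroot) addr0.
have := norm_const_seed; move: (\prod_(nu <- _) _) (\prod_(_ < _) _) (_.[1]) norm_const.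
by move=> a b c d e; rewrite -[RHS]mulr1 -e; ring.
Qed.

(** The powers of t are infinitely many points, as q is not a root of unity.
    *)
Lemma poly_nonroot (p : {poly C}) : p != 0 -> exists j, p.[tq ^+ j] != 0.
Proof.
move=> p0; apply: contrapT => /forallNP H.
have := @max_poly_roots _ p [seq tq ^+ j | j <- iota 0 (size p)] p0.
rewrite size_map size_iota ltnn => F; suff : false by []. 
apply: F; first by apply/allP => x /mapP[j _ ->]; apply/negPn/negP/H.
rewrite map_inj_uniq ?iota_uniq // => i j e.
have ne a b := expr_neq (b := b) (a := a) (tq_neq0 logq) (tq_nroot q_nroot).
by case: (ltngtP i j) => // /ne; rewrite e eqxx.
Qed.

Definition point_at (y : I -> C) : V := vec (fun c => y c / (rr m c)%:R).

Lemma yc_point_at y c : yc (point_at y) c = y c.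
Proof. by rewrite yc_vec divfK // pnatr_eq0 -lt0n rr_gt0. Qed.

Lemma yc0 (c : I) : yc (0 : V) c = 0.
Proof. by rewrite -(scale0r (0 : V)) ycZ mul0r. Qed.

Lemma Evec_neq nu : nu \in nus -> Evec 0 0 != Evec 0 nu.
Proof.
case/nus_coords=> a -> [c ac]; apply/eqP => /(congr1 (fun p : {poly C} => p`_c)).
have coefE v : (Evec 0 v)`_c =
    kapC c * wC 0 c * (qpow (2 * yc v c) * tq ^+ (rr m c * om0 m c)).
  rewrite coef_sum (bigD1 c) //= big1 ?addr0; first by rewrite coefCM coefXn eqxx mulr1.
  move=> d dc; rewrite coefCM coefXn; have -> : ((c : nat) == d) = false.
    by apply/negbTE; rewrite eq_sym.
  by rewrite mulr0.
rewrite !coefE => /mulfI.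
rewrite mulf_neq0 ?kapC_neq0 ?wC_neq0 // => /(_ isT) /mulIf.
rewrite expf_neq0 ?tq_neq0 // => /(_ isT).
rewrite yc0 mulr0 qpow0 yc_vec => e.
have qk k : (0 < k)%N -> qpow (2 * k%:R) != 1 by move=> k0; rewrite -tqX tq_nroot.
have rc := rr_gt0 m_gt0 c.
have [k ak] : exists k : nat, (0 < k)%N /\ (a c = k%:Z \/ a c = - k%:Z).
  exists `|a c|%N; split; first by rewrite absz_gt0.
  by case: (a c) => k; [left | right; rewrite NegzE].
case: ak => k0 [] ak; move: e; rewrite ak.
  move/esym/eqP; rewrite -[_ * (rr m c)%:R](natrM C k (rr m c)).
  by rewrite (negbTE (qk _ _)) // muln_gt0 k0.
rewrite rmorphN mulNr mulrN qpowN => /esym/eqP; rewrite invr_eq1.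
rewrite -[_ * (rr m c)%:R](natrM C k (rr m c)).
by rewrite (negbTE (qk _ _)) // muln_gt0 k0.
Qed.

(** For x with coordinates j times 0, 1, 2, ... the factors are the values of
    the polynomials Evec 0 0 - Evec 0 nu at t^j. These polynomials are not 0.
    *)
Lemma exists_generic : exists x : V,
  \prod_(nu <- nus) (frakm m logq x - frakm m logq (x + nu)) != 0.
Proof.
pose p := \prod_(nu <- nus) (Evec 0 0 - Evec 0 nu).
have p0 : p != 0.
  by rewrite prodf_seq_neq0; apply/allP => nu nuP; rewrite subr_eq0 Evec_neq.
have [j pj] := poly_nonroot p0.
(* At this point the multiplier q^(2 (f_c,x)) is (t^j)^c, the value at w = t^j
   of the perturbation w^c of the weight at x = 0. *)
pose x := point_at (fun c : I => (j * c)%:R); exists x.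
have E nu : frakm m logq (x + nu) = (Evec 0 nu).[tq ^+ j].
  rewrite -(Evec1 m_gt0 q_nroot) !horner_sum; apply: eq_bigr => c _.
  rewrite !hornerM !hornerC !hornerXn expr1n mulr1 -exprM /wC yc_point_at.
  rewrite yc0 mulr0 qpow0 mul1r.
  by rewrite !tqX; move: (kapC c) K0 (qpow _) (qpow _) (qpow _) (qpow _) => *; ring.
move: pj; rewrite horner_prod; congr (_ != 0); apply: eq_bigr => nu _.
by rewrite hornerD hornerN -!E addr0.
Qed.

(** At the points z with coordinates j times 0, 1, 2, ..., psi is an
    exponential factor times the value of a polynomial at t^j. The exponents
    of the monomials differ from bot_mnm by sums of positive roots, each of
    which lowers the weight h; so bot_mnm alone has its weight, and its
    coefficient is not 0 for suitable x. *)
Lemma psi_nonzero : exists x z, psi x z != 0.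
Proof.
have [x px] := exists_generic; exists x.
have cb : mono_coef x (bot_mnm n m) != 0 by rewrite -psi_coef_mono_vec mono_vec_bot psi_coef_bot.
pose h (k : multinom n.+1) := (\sum_(c < n.+1) c * k c)%N.
pose p := \sum_(k <- msupp (Psi x)) (mono_coef x k)%:P * 'X^(h k).
have hbot k : k \in msupp (Psi x) -> h k = h (bot_mnm n m) -> k = bot_mnm n m.
  rewrite mcoeff_msupp => /supp_feasible[l lmu lE] hk.
  have sumh : \sum_(c < n.+1) (c%:Z * ((k c)%:Z - (bot m c)%:Z)) = 0 :> int.
    transitivity ((h k)%:Z - (h (bot_mnm n m))%:Z); last by rewrite hk subrr.
    rewrite /h !(big_morph _ PoszD (erefl _)) -sumrB; apply: eq_bigr => c _.
    by rewrite bot_mnmE mulrBr.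
  have pick (a : I) (r : nat) : \sum_(c < n.+1) c%:Z * (r * (a == c))%:Z = r%:Z * a%:Z :> int.
    rewrite (bigD1 a) //= eqxx muln1 big1 ?addr0 => [|c ca]; first by rewrite mulrC.
    by rewrite eq_sym (negbTE ca) muln0 mulr0.
  have e : \sum_p ((l p)%:Z * ((p.2 : nat)%:Z - (p.1 : nat)%:Z)) = 0 :> int.
    apply: oppr_inj; rewrite oppr0; apply: etrans sumh; rewrite -sumrN.
    transitivity (\sum_(c < n.+1) \sum_p (c%:Z * (l p * (p.1 == c))%:Z - c%:Z * (l p * (p.2 == c))%:Z) : int).
      by rewrite exchange_big; apply: eq_bigr => r _; rewrite sumrB !pick mulrBr opprB.
    by apply: eq_bigr => c _; rewrite lE mulr_sumr; apply: eq_bigr => r _; rewrite mulrBr.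
  have l0 r : l r = 0%N.
    have := lmu r; case: ifP => [lp _|_]; last by rewrite leqn0 => /eqP.
    have pos s : 0 <= (l s)%:Z * ((s.2 : nat)%:Z - (s.1 : nat)%:Z) :> int.
      have := lmu s; case: ifP => [ls _|_]; last by rewrite leqn0 => /eqP ->; rewrite mul0r.
      by rewrite mulr_ge0 // subr_ge0 lez_nat ltnW.
    have /eqP := e; rewrite psumr_eq0 // => /allP/(_ r).
    rewrite mem_index_enum => /(_ isT); rewrite /= mulf_eq0 subr_eq0.
    case/orP=> [/eqP[] //|/eqP[] e']; move: lp; rewrite /lt_pair.
    by rewrite e' ltnn.
  apply/mnmP => c; rewrite bot_mnmE; have := lE c; rewrite big1 => [|r _].
    by move/subr0_eq => [].
  by rewrite l0 !mul0n subrr.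
have p0 : p != 0.
  apply/eqP => /(congr1 (fun p : {poly C} => p`_(h (bot_mnm n m)))).
  rewrite coef0 coef_sum (eq_big_seq (fun k => if k == bot_mnm n m then mono_coef x (bot_mnm n m) else 0)).
    rewrite -big_mkcond /= -big_filter filter_pred1_uniq // ?big_seq1.
      by move/eqP; rewrite (negbTE cb).
    rewrite mcoeff_msupp; apply: contraNneq cb => e.
    by rewrite /mono_coef e horner0 mulr0 mul0r.
  move=> k kP; rewrite coefCM coefXn; have [->|ne] := eqVneq k (bot_mnm n m).
    by rewrite eqxx mulr1.
  case: eqP => [/esym/(hbot k kP) e|_]; last by rewrite mulr0.
  by rewrite e eqxx in ne.
have [j pj] := poly_nonroot p0.
pose z := point_at (fun c : I => (j * c)%:R); exists z.
rewrite psi_expand mulf_neq0 ?qpow_neq0 //.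
have E k : qpow (2 * dotp (mono_vec k) z) = qpow (2 * bt m z) * (tq ^+ j) ^+ h k.
  have -> : (tq ^+ j) ^+ h k = qpow (2 * \sum_(c < n.+1) (k c)%:R * yc z c).
    rewrite -exprM tqX natrM /h natr_sum mulr_sumr; congr (qpow (_ * _)).
    by apply: eq_bigr => c _; rewrite yc_point_at !natrM; ring.
  by rewrite dotp_mono_vec mulrDr qpowD.
rewrite (eq_bigr (fun k => qpow (2 * bt m z) * ((mono_coef x k)%:P * 'X^(h k)).[tq ^+ j])).
  by rewrite -mulr_sumr -horner_sum mulf_neq0 ?qpow_neq0.
by move=> k _; rewrite E hornerM hornerC hornerXn mulrCA.
Qed.
End Solution.

(* psi is the meromorphic function of z defined by the product of operators:
   psi_op computes its values pointwise, away from the poles of the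
   coefficients. *)
Theorem theorem7p3 (R : realType) (n m : nat) (q logq : R[i])
  (m_gt0 : (0 < m)%N)
  (q_def : q = expC logq)
  (q_nroot : forall k : nat, (0 < k)%N -> q ^+ k != 1) :
  exists (psi c : 'rV[R[i]]_n.+1 -> 'rV[R[i]]_n.+1 -> R[i]),
    [/\ forall x z, D_domain m logq (size (nus R n m)) z ->
          psi x z = psi_op m logq x z,
        baker_akhiezer m logq psi c,
        forall x, c (- rho R n m) x =
          \prod_(nu <- nus R n m) (frakm m logq x - frakm m logq (x + nu)),
        exists x, \prod_(nu <- nus R n m)
          (frakm m logq x - frakm m logq (x + nu)) != 0 &
        forall x z, D_regular m logq z ->
          Dop m logq (psi x) z = frakm m logq x * psi x z].
Proof.
have qn k : (0 < k)%N -> qpow logq 1 ^+ k != 1 by rewrite qpow1 -q_def; apply: q_nroot.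
exists (@psi R n m logq), (@psi_coef R n m logq); split.
- by move=> x z dz; rewrite /psi_op psi_op_steps.
- split.
  + exact: psi_nonzero.
  + by move=> x z; apply: psi_fsbig.
  + move=> x z i j s ij /andP[_ sm] zij; rewrite -!(fv_fst R m).
    have ne : fst_idx i != fst_idx j.
      by rewrite (inj_eq (@fst_idx_inj n)) neq_ltn ij.
    apply: psi_quasi_invariant => //.
      by rewrite /mu !fst_idx_neq_max.
    by rewrite !Zc_fst.
  move=> x z i zi; rewrite -(fv_fst R m) -(fv_max R n m).
  have ne : fst_idx i != ord_max by rewrite fst_idx_neq_max.
  have := @psi_quasi_invariant R n m logq m_gt0 qn x z (fst_idx i) ord_max 1 ne.
  rewrite !scale1r; apply; first by rewrite /mu eqxx orbT.
  rewrite Zc_fst Zc_max -zi -qpowD; congr qpow; ring.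
- by move=> x; apply: psi_coef_bot.
- exact: exists_generic.
by move=> x z; apply: psi_eigen.
Qed.
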